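(* Let $B\subset\mathbb R^d$ be a compact convex set containing a neighbourhood of $0$. Let $Z=N$ and $\tilde Z=\tilde N$ be Neyman-Scott point processes in $\mathbb R^d$ with cluster sizes $\eta$ and $\tilde\eta$, respectively, and the same cluster point distribution $V$. If $N$ and $\tilde N$ have the same intensity and $\eta<_{l-g}\tilde\eta$, then $Z<_{h-B}\tilde Z$, i.e. the directed $B$-relative empty space hazards satisfy $r_B(t,C)\ge\tilde r_B(t,C)$ for all $t\ge0$ and all Borel sets $C\subset\mathbb R^d$.
   Context: Distances. $B^*:=\{-x:x\in B\}$. For $x\in\mathbb R^d$ and $K\subset\mathbb R^d$, $d_B(x,K):=\inf\{t\ge 0:(x+tB)\cap K\ne\emptyset\}$ (with $\inf\emptyset=\infty$). If $0<d_B(x,K)<\infty$ and $(x+d_B(x,K)B)\cap K=\{y\}$ is a single point, then $u_B(K,x):=(x-y)/d_B(x,K)\in\partial B^*$. Empty space hazard. For a stationary random closed set $Z$ for which $u_B(Z,0)$ is a.s. well defined on $\{0<d_B(0,Z)<\infty\}$ (this holds here), put $u_B(Z,0):=u_0$ for a fixed $u_0\in\partial B^*$ if $0\in Z$ or $d_B(0,Z)=\infty$, and let $F_B(t,C):=P(d_B(0,Z)\le t,\ u_B(Z,0)\in C)$, $F_B(t):=F_B(t,\mathbb R^d)$. $F_B(\cdot,C)$ is absolutely continuous on $(0,\infty)$; $f_B(\cdot,C)$ denotes its density, taken in the right-continuous version on $[0,\infty)$ (the right-hand derivative of $F_B(\cdot,C)$). The hazard is $r_B(t,C):=f_B(t,C)/(1-F_B(t))$,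 with $a/0:=0$; $\tilde r_B$ is the hazard of $\tilde Z$. Poisson cluster point process. $N=\bigcup_{x\in\Pi}(L_x+x)$, where $\Pi$ is a stationary Poisson process with intensity $\lambda_\Pi\in(0,\infty)$ and, given $\Pi$, the $L_x$ are i.i.d. finite random point sets distributed as the typical cluster $L_0$; $\gamma:=E\,\mathrm{card}\,L_0\in(0,\infty)$; $N$ has intensity $\lambda_\Pi\gamma$. For both processes the measure $E\big[\sum_{x,y\in L_0,\,x\ne y}\mathbf 1\{x-y\in\cdot\}\big]$ is assumed absolutely continuous with respect to Lebesgue measure. Neyman-Scott process. A Poisson cluster process with $L_0=\emptyset$ if $\eta=0$ and $L_0=\{Y_{1,n},\dots,Y_{n,n}\}$ if $\eta=n\ge1$, where the cluster size $\eta\in\{0,1,2,\dots\}$ and all $Y_{i,n}$ are independent, each $Y_{i,n}$ has distribution $V$ on $\mathbb R^d$, and $E[\eta]\in(0,\infty)$. The underlying Poisson intensities of $N$ and $\tilde N$ may differ. Order $<_{l-g}$. $\eta<_{l-g}\tilde\eta$ means $E[\eta]^{-1}E[\mathbf 1\{\eta\ge1\}\eta s^{\eta-1}]\ge E[\tilde\eta]^{-1}E[\mathbf 1\{\tilde\eta\ge1\}\tilde\eta s^{\tilde\eta-1}]$ for all $s\in[0,1]$ (with $0^0=1$). *)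

(* Defs.v *)
From HB Require Import structures.
From mathcomp Require Import all_boot all_order all_algebra finmap.
From mathcomp Require Import all_classical all_reals all_analysis.
From mathcomp Require Import measurable_realfun.

Set Implicit Arguments.
Unset Strict Implicit.
Unset Printing Implicit Defensive.
Import Order.TTheory GRing.Theory Num.Theory.
Import numFieldNormedType.Exports.
Local Open Scope classical_set_scope.
Local Open Scope ring_scope.

Notation borelType R n := (g_sigma_algebraType (@open 'rV[R]_n)).

Definition borel (R : realType) (n : nat) : set (set 'rV[R]_n) :=
  <<s (@open 'rV[R]_n) >>.

(* The [n]-fold product of the Lebesgue measure on the line, computed by slicing
   along the first coordinate; it is only meant to be used on Borel sets. *)
Fixpoint lebesgue_rV (R : realType) (n : nat) : set 'rV[R]_n -> \bar R :=
  match n with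
  | 0 => fun A => (\1_A (0 : 'rV[R]_0))%:E
  | m.+1 => fun A =>
      (\int[@lebesgue_measure R]_x
         lebesgue_rV [set v : 'rV[R]_m |
           A (row_mx (const_mx x : 'rV[R]_1) v : 'rV[R]_m.+1)])%E
  end.

Section Independence.
Context {dO : measure_display} {O : measurableType dO} {R : realType}.

Definition mutually_independent (P : probability O R) (I : choiceType)
    (F : I -> set (set O)) : Prop :=
  forall (J : {fset I}) (E : I -> set O),
    (forall i, i \in J -> F i (E i)) ->
    P (\bigcap_(i in [set` J]) E i) = (\prod_(i <- J) P (E i))%E.

End Independence.

Section Distances.
Context {R : realType} {n : nat}.
Implicit Types (B K C : set 'rV[R]_n) (x : 'rV[R]_n) (r : R).

Definition reflect_set B : set 'rV[R]_n := [set - x | x in B].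

Definition topological_boundary B : set 'rV[R]_n := closure B `\` B°.

Definition gauge_ball B x r : set 'rV[R]_n := [set x + r *: b | b in B].

Definition dist_B B x K : \bar R :=
  ereal_inf [set t%:E | t in [set t : R | 0 <= t /\
                                (gauge_ball B x t `&` K) !=set0]].

Definition contact_set B x K : set 'rV[R]_n :=
  gauge_ball B x (fine (dist_B B x K)) `&` K.

(* [u0] is also returned when the contact point is not unique; for the processes
   under consideration this is an event of probability zero. *)
Definition dir_B B (u0 : 'rV[R]_n) K x : 'rV[R]_n :=
  if `[< (0 < dist_B B x K < +oo)%E /\
         exists y, contact_set B x K = [set y] >]
  then (fine (dist_B B x K))^-1 *: (x - get (contact_set B x K))
  else u0.

End Distances.

Section PointProcesses.
Context {R : realType} {n : nat}.

Definition locally_finite (K : set 'rV[R]_n) : Prop :=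
  forall A : set 'rV[R]_n, bounded_set A -> finite_set (K `&` A).

Definition count_in (A K : set 'rV[R]_n) : \bar R := counting (K `&` A).

Definition configuration_sigma : set (set (set 'rV[R]_n)) :=
  <<s [set S | exists A (k : nat),
         borel A /\ S = [set K | count_in A K = k%:R%:E]] >>.

Definition unit_cube : set 'rV[R]_n :=
  [set v | forall i, 0 <= v ord0 i <= 1].

Section OnProbabilitySpace.
Context {dO : measure_display} {O : measurableType dO}.
Variable P : probability O R.
Implicit Types N L Pi : O -> set 'rV[R]_n.

(* Point processes are simple and identified with their supports. *)
Definition point_process N : Prop :=
  (forall w, locally_finite (N w)) /\
  (forall A, borel A -> measurable_fun setT (fun w => count_in A (N w))).

Definition finite_point_process L : Prop :=
  point_process L /\ forall w, finite_set (L w).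

Definition intensity N : \bar R := (\int[P]_w count_in unit_cube (N w))%E.

Definition stationary_poisson (lambda : R) Pi : Prop :=
  [/\ point_process Pi,
      (forall A, borel A -> (lebesgue_rV A < +oo)%E -> forall k : nat,
         let m := lambda * fine (lebesgue_rV A) in
         P [set w | count_in A (Pi w) = k%:R%:E] =
           (m ^+ k / k`!%:R * expR (- m))%:E) &
      (forall (m : nat) (A : 'I_m -> set 'rV[R]_n),
         (forall i, borel (A i)) -> trivIset setT A ->
         mutually_independent P (fun i =>
           preimage_set_system setT (fun w => count_in (A i) (Pi w))
             measurable))].

Definition difference_measure L (A : set 'rV[R]_n) : \bar R :=
  (\int[P]_w counting [set p : 'rV[R]_n * 'rV[R]_n |
     [/\ L w p.1, L w p.2, p.1 <> p.2 & A (p.1 - p.2)%R]])%E.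

Definition typical_cluster L : Prop :=
  [/\ finite_point_process L,
      (0 < \int[P]_w counting (L w) < +oo)%E &
      forall A, borel A -> lebesgue_rV A = 0%E -> difference_measure L A = 0%E].

Definition generated_sigma (X : nat -> O -> 'rV[R]_n) : set (set O) :=
  <<s \bigcup_k preimage_set_system setT (X k) (@borel R n) >>.

End OnProbabilitySpace.

Section ClusterProcesses.
Context {dO : measure_display} {O : measurableType dO} (P : probability O R).
Context {d1 : measure_display} {O1 : measurableType d1}.
Variable P1 : probability O1 R.
Implicit Types (N : O -> set 'rV[R]_n) (Ltyp : O1 -> set 'rV[R]_n).

(* The almost surely infinite Poisson process [Pi] is enumerated measurably and
   injectively as [X 0, X 1, ...]; the cluster [L k] is attached to [X k], so
   that conditionally on [Pi] the clusters are i.i.d. *)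
Definition poisson_cluster_process (lambda : R) N Ltyp : Prop :=
  [/\ 0 < lambda, typical_cluster P1 Ltyp, point_process N &
    exists (Pi : O -> set 'rV[R]_n) (X : nat -> O -> 'rV[R]_n)
           (L : nat -> O -> set 'rV[R]_n),
    [/\ [/\ stationary_poisson P lambda Pi,
            (forall k, measurable_fun setT (X k : O -> borelType R n)) &
            {ae P, forall w, injective (X ^~ w) /\ Pi w = range (X ^~ w)}],
        (forall k, finite_point_process (L k) /\
           forall S, configuration_sigma S ->
             P (L k @^-1` S) = P1 (Ltyp @^-1` S)),
        mutually_independent P (fun i : option nat =>
          if i is Some k
          then preimage_set_system setT (L k) configuration_sigma
          else generated_sigma X) &
        {ae P, forall w,
           N w = \bigcup_k [set X k w + y | y in L k w]}]].

(* [eta] is the cluster size: as a set, the cluster has almost surely [eta]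
   points, which rules out coincidences when [V] has atoms. *)
Definition neyman_scott_cluster (V : probability (borelType R n) R)
    (eta : O1 -> nat) Ltyp : Prop :=
  [/\ measurable_fun setT eta, (0 < \int[P1]_w (eta w)%:R%:E < +oo)%E,
      {ae P1, forall w, counting (Ltyp w) = (eta w)%:R%:E :> \bar R} &
    exists Y : forall m : nat, 'I_m -> O1 -> 'rV[R]_n,
    [/\ (forall m (i : 'I_m),
          measurable_fun setT (Y m i : O1 -> borelType R n) /\
          forall A, borel A -> P1 (Y m i @^-1` A) = V A),
        mutually_independent P1 (fun j : option {m : nat & 'I_m} =>
          if j is Some p
          then preimage_set_system setT (Y (tag p) (tagged p)) (@borel R n)
          else preimage_set_system setT eta measurable) &
        forall w, Ltyp w = range (fun i : 'I_(eta w) => Y (eta w) i w)]].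

Definition neyman_scott_process (V : probability (borelType R n) R)
    (eta : O1 -> nat) N : Prop :=
  exists (lambda : R) (Ltyp : O1 -> set 'rV[R]_n),
    neyman_scott_cluster V eta Ltyp /\ poisson_cluster_process lambda N Ltyp.

End ClusterProcesses.
End PointProcesses.

Section OrderLG.
Context {R : realType}.

(* The function s |-> E[eta]^-1 E[1{eta >= 1} eta s^(eta - 1)]. *)
Definition size_biased_gf {d1 : measure_display} {O1 : measurableType d1}
    (P1 : probability O1 R) (eta : O1 -> nat) (s : R) : R :=
  (fine 'E_P1[fun w => (eta w)%:R])^-1 *
  fine 'E_P1[fun w => \1_[set k : nat | (1 <= k)%N] (eta w) *
                      ((eta w)%:R * s ^+ (eta w).-1)].

Definition lg_order {d1 d2 : measure_display}
    {O1 : measurableType d1} {O2 : measurableType d2}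
    (P1 : probability O1 R) (eta1 : O1 -> nat)
    (P2 : probability O2 R) (eta2 : O2 -> nat) : Prop :=
  forall s : R, 0 <= s <= 1 ->
    size_biased_gf P2 eta2 s <= size_biased_gf P1 eta1 s.

End OrderLG.

Section EmptySpaceHazard.
Context {R : realType} {n : nat}.
Context {dO : measure_display} {O : measurableType dO} (P : probability O R).
Implicit Types (B C : set 'rV[R]_n) (Z : O -> set 'rV[R]_n).

Definition empty_space B (u0 : 'rV[R]_n) Z (t : R) C : R :=
  fine (P [set w | (dist_B B 0 (Z w) <= t%:E)%E /\ C (dir_B B u0 (Z w) 0)]).

(* The right-continuous version of the density, i.e. the right-hand derivative
   of the directed empty space function. *)
Definition empty_space_density B (u0 : 'rV[R]_n) Z (t : R) C : R :=
  lim ((empty_space B u0 Z (t + h) C - empty_space B u0 Z t C) / h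
         @[h --> 0^'+]).

Definition hazard B (u0 : 'rV[R]_n) Z (t : R) C : R :=
  empty_space_density B u0 Z t C / (1 - empty_space B u0 Z t setT).

End EmptySpaceHazard.

(* Main.v *)
Require Import Defs.
From HB Require Import structures.
From mathcomp Require Import all_boot all_order all_algebra finmap.
From mathcomp Require Import all_classical all_reals all_analysis.
From mathcomp Require Import measurable_realfun ring lra.

(* Let [G] be the generating function of the cluster size [eta]. The void
   probabilities of a Neyman-Scott process are explicit:
     P(N misses A) = exp(- lambda * integral of 1 - G(1 - V(A - x)) dx).
   Absolute continuity of the difference measure makes the probability of two
   points in a thin shell [(t + h)B \ tB] negligible with respect to [h], so that,
   up to o(h), the event "[t < d <= t + h] and direction in [C]" says that [tB] is
   empty and that the part of the shell in the cone over [C] is hit. Expanding the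
   void probabilities to first order gives
     hazard(t, C) = lambda * (right derivative of j at t),
     j(s) = integral over y in sB in the cone of
            integral of G'(1 - V{l : |y - z + l| <= |y|}) V(dz) dy,
   where [|y|] is the gauge of [B]. Since [|w + r y| <= |w + y| + (r - 1)|y|] and
   [G'] is nondecreasing, [j(rb) - j(ra) <= r^n (j(b) - j(a))] for [r >= 1], and this
   monotonicity is what makes [j] differentiable from the right at every [t].
   Finally [lambda * G'] is the intensity of [N] times the size-biased generating
   function; as the intensities agree, the order on the cluster sizes compares the
   functions [lambda * G'], hence the increments of [lambda * j]. *)

Set Implicit Arguments.
Unset Strict Implicit.
Unset Printing Implicit Defensive.
Import Order.TTheory GRing.Theory Num.Theory.
Import numFieldNormedType.Exports HBNNSimple.
Local Open Scope classical_set_scope.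
Local Open Scope ring_scope.

(** * Borel sets and Lebesgue measure on row vectors *)

(** [hazard] is defined by [lim], so the right derivative has to be shown to exist. No surface
    measure on the boundary of tB is involved: dilating shells and measuring increments against s ^
    n takes its place. The cluster size has only a first moment, so G' is continuous at 1 without
    any rate. Second-order errors are therefore split: near 1 the continuity of G' is used,
    elsewhere a multiple of the squared mass V(A - x)^2, whose integral is expressed by the law of
    the difference of two independent vectors with law V. Absolute continuity of that law can be
    read off the difference measure only if clusters with at least two points have positive
    probability; otherwise G' is constant and the error vanishes. The probability of two points in a
    thin shell is not computed directly: the mean number of points and the hitting probability agree
    to first order, and 1{N >= 2} + 1{N >= 1} <= N. The two bounds on the mean number, obtained from
    hitting probabilities of small grid cells, also identify the intensity with lambda times the
    mean cluster size. *)

Lemma measure_le {R : realType} d (T : measurableType d) (mu : {measure set T -> \bar R})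
    (A A' : set T) : measurable A -> measurable A' -> A `<=` A' -> (mu A <= mu A')%E.
Proof. by move=> mA mA' AA; apply: le_measure; rewrite ?inE. Qed.

(* [ge0_le_integral] without the measurability hypotheses. *)
Lemma ge0_le_integralT {R : realType} d (T : measurableType d) (mu : {measure set T -> \bar R})
    (f g : T -> \bar R) : (forall x, 0 <= f x)%E -> (forall x, f x <= g x)%E ->
  (\int[mu]_x f x <= \int[mu]_x g x)%E.
Proof.
move=> f0 fg; have g0 x : (0 <= g x)%E := le_trans (f0 x) (fg x).
rewrite !ge0_integralTE//; apply: ereal_sup_le => _ [h /= hf <-]; exists h => // x.
exact: le_trans (hf x) (fg x).
Qed.

Section borel_rV.
Context {R : realType}.
Implicit Types n : nat.

(** The rational centres and inverse integer radii form a countable index set, so measurability of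
    vector-valued maps reduces to that of their coordinates. *)
Lemma open_rV_rational_boxes n (U : set 'rV[R]_n) : open U ->
  U = \bigcup_(p in [set p : 'rV[rat]_n * nat |
        [set v : 'rV[R]_n | forall i, `|v ord0 i - ratr (p.1 ord0 i)| < p.2.+1%:R^-1] `<=` U])
      [set v : 'rV[R]_n | forall i, `|v ord0 i - ratr (p.1 ord0 i)| < p.2.+1%:R^-1].
Proof.
move=> oU; apply/seteqP; split => [v Uv|v [p /=]]; last exact.
have /nbhs_ballP[e /= e0 beU] : nbhs v U by exact: open_nbhs_nbhs.
(* Twice the radius of the box: one radius from [w] to the rational centre, one from there to
   [v]. *)
have [k ke] : exists k : nat, 2 / k.+1%:R < e.
  have [k] := ltr_add_invr (divr_gt0 e0 (@ltr0n R 2)).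
  rewrite add0r => H; exists k.
  by move: H; rewrite ltr_pdivlMr// mulrC.
have k0 : (0 : R) < k.+1%:R^-1 by rewrite invr_gt0.
have /choice[q hq] : forall i, exists q : rat, `|v ord0 i - ratr q| < k.+1%:R^-1.
  move=> i; have [|q] := @rat_in_itvoo R (v ord0 i - k.+1%:R^-1) (v ord0 i + k.+1%:R^-1).
    by rewrite ltrBlDr -addrA ltrDl addr_gt0.
  rewrite in_itv/= => /andP[q1 q2]; exists q.
  by rewrite distrC ltr_distl q1.
exists (\row_i q i, k) => /=; last by move=> i; rewrite mxE.
move=> w hw; apply: beU; split=> // i j.
rewrite (ord1 i) -ball_normE /ball_/=.
rewrite (le_lt_trans _ ke)// -(subrK (ratr (q j)) (v ord0 j)) -addrA.
rewrite (le_trans (ler_normD _ _))// mulr_natl mulr2n lerD ?(ltW (hq j))//.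
by have := hw j; rewrite mxE distrC => /ltW.
Qed.

Lemma measurable_rVP d (T : measurableType d) n (f : T -> borelType R n) :
  (forall i, measurable_fun setT (fun x => (f x : 'rV[R]_n) ord0 i)) -> measurable_fun setT f.
Proof.
move=> mf; apply: (@measurability _ _ T (borelType R n) setT f (@open 'rV[R]_n)) => // _ [U oU <-].
rewrite setTI (open_rV_rational_boxes oU) preimage_bigcup.
rewrite bigcup_mkcond; apply: countable_bigcupT_measurable => [|p].
  exact: countableP.
case: ifPn => // _.
rewrite [X in measurable X](_ : _ = \bigcap_(i in [set: 'I_n])
    ((fun x => (f x : 'rV[R]_n) ord0 i) @^-1` (@ball R R (ratr (p.1 ord0 i)) p.2.+1%:R^-1))); last first.
  apply/seteqP; split => x /=.
    by move=> + i _ /=; rewrite -ball_normE /ball_/= distrC; exact.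
  by move=> + i => /(_ i Logic.I) /=; rewrite -ball_normE /ball_/= distrC.
apply: fin_bigcap_measurable => // i _.
by rewrite -[X in measurable X]setTI; apply: mf => //; exact: measurable_ball.
Qed.

Lemma measurable_coord n (i : 'I_n) :
  measurable_fun setT (fun v : borelType R n => (v : 'rV[R]_n) ord0 i : R).
Proof.
apply: (measurability (RGenOpens.G (R:=R))).
  exact: RGenOpens.measurableE.
move=> _ [_ [a [b ->]] <-]; rewrite setTI.
apply: sub_sigma_algebra.
apply: (@open_comp 'rV[R]_n R); last exact: interval_open.
by move=> v _; exact: coord_continuous.
Qed.

Lemma measurable_rV_coord d (T : measurableType d) n (f : T -> borelType R n) i :
  measurable_fun setT f -> measurable_fun setT (fun x => (f x : 'rV[R]_n) ord0 i).
Proof. by move=> mf; exact: (measurableT_comp (measurable_coord i) mf). Qed.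

Lemma measurable_rVD d (T : measurableType d) n (f g : T -> borelType R n) :
  measurable_fun setT f -> measurable_fun setT g ->
  measurable_fun setT (fun x => f x + g x : borelType R n).
Proof.
move=> mf mg; apply: measurable_rVP => i.
under eq_fun do rewrite mxE.
by apply: measurable_funD; exact: measurable_rV_coord.
Qed.

Lemma measurable_rVN d (T : measurableType d) n (f : T -> borelType R n) :
  measurable_fun setT f ->
  measurable_fun setT (fun x => - f x : borelType R n).
Proof.
move=> mf; apply: measurable_rVP => i.
under eq_fun do rewrite mxE.
by apply: measurable_funN; exact: measurable_rV_coord.
Qed.

Lemma measurable_rVZ d (T : measurableType d) n (c : T -> R) (f : T -> borelType R n) :
  measurable_fun setT c -> measurable_fun setT f ->
  measurable_fun setT (fun x => c x *: (f x : 'rV[R]_n) : borelType R n).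
Proof.
move=> mc mf; apply: measurable_rVP => i.
under eq_fun do rewrite mxE.
by apply: measurable_funM => //; exact: measurable_rV_coord.
Qed.

Lemma measurable_row_mx d (T : measurableType d) n (c : T -> R) (f : T -> borelType R n) :
  measurable_fun setT c -> measurable_fun setT f ->
  measurable_fun setT (fun x => row_mx (const_mx (c x) : 'rV[R]_1) (f x : 'rV[R]_n)
     : borelType R n.+1).
Proof.
move=> mc mf; apply: measurable_rVP => i.
change 'I_(1 + n) in i; rewrite -(fintype.splitK i); case: (fintype.split i) => j /=.
  rewrite (_ : (fun x => _) = c)//.
  by apply/funext => x; rewrite (@row_mxEl _ 1 1 n) mxE.
under eq_fun do rewrite (@row_mxEr _ 1 1 n).
exact: measurable_rV_coord.
Qed.

Lemma preimage_borel d (T : measurableType d) n (f : T -> borelType R n)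
    (A : set 'rV[R]_n) :
  measurable_fun setT f -> borel A -> measurable (f @^-1` A).
Proof. by move=> mf bA; rewrite -[X in measurable X]setTI; exact: (mf measurableT). Qed.

Lemma borel_shift n (a : 'rV[R]_n) (A : set 'rV[R]_n) :
  borel A -> borel [set v | A (v + a)].
Proof.
have mf : measurable_fun setT (fun v : borelType R n => v + a : borelType R n).
  by apply: measurable_rVD => //; exact: measurable_id.
by move=> bA; exact: (preimage_borel mf bA).
Qed.

Lemma borel_scale n (c : R) (A : set 'rV[R]_n) :
  borel A -> borel [set v | A (c *: v)].
Proof.
have mf : measurable_fun setT (fun v : borelType R n => c *: (v : 'rV[R]_n) : borelType R n).
  by apply: measurable_rVZ => //; exact: measurable_id.
by move=> bA; exact: (preimage_borel mf bA).
Qed.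

Lemma closed_borel n (A : set 'rV[R]_n) : closed A -> borel A.
Proof.
move=> cA; rewrite -[A]setCK; apply: (@measurableC _ (borelType R n)).
by apply: sub_sigma_algebra; exact: closed_openC.
Qed.
End borel_rV.

Lemma borel0 (R : realType) n : borel (set0 : set 'rV[R]_n).
Proof. exact: (@measurable0 _ (borelType R n)). Qed.

Lemma borelU (R : realType) n (A A' : set 'rV[R]_n) : borel A -> borel A' -> borel (A `|` A').
Proof. exact: (@measurableU _ (borelType R n)). Qed.

Lemma borelI (R : realType) n (A A' : set 'rV[R]_n) : borel A -> borel A' -> borel (A `&` A').
Proof. exact: (@measurableI _ (borelType R n)). Qed.

Lemma borelD (R : realType) n (A A' : set 'rV[R]_n) : borel A -> borel A' -> borel (A `\` A').
Proof. exact: (@measurableD _ (borelType R n)). Qed.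

(* The pushforward with its measure structure made explicit: unification does not
   find that structure from [pushforward m f] alone. *)
Definition image_measure d d' (T1 : measurableType d) (T2 : measurableType d')
    (R : realType) (m : {measure set T1 -> \bar R}) (f : T1 -> T2)
    (mf : measurable_fun setT f) : {measure set T2 -> \bar R} :=
  measure_function_pushforward__canonical__measure_function_Measure m mf.

Lemma ge0_integral_image_measure d d' (T1 : measurableType d) (T2 : measurableType d')
    (R : realType) (m : {measure set T1 -> \bar R}) (f : T1 -> T2)
    (mf : measurable_fun setT f) (g : T2 -> \bar R) :
  measurable_fun setT g -> (forall x, 0 <= g x)%E ->
  (\int[image_measure m mf]_y g y = \int[m]_x g (f x))%E.
Proof.
move=> mg g0.
have := @ge0_integral_pushforward _ _ _ _ R _ mf m setT g measurableT mg (fun _ _ => g0 _).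
by rewrite preimage_setT.
Qed.

(** * Translations and dilations of the line *)

Section lebesgue_line.
Context {R : realType}.
Local Notation leb := (@lebesgue_measure R).

(** The image measure agrees with Lebesgue measure on half-open intervals, which determine it.
    Dilations below are treated in the same way. *)
Lemma lebesgue_measure_shift (a : R) (A : set R) : measurable A ->
  leb [set x | A (x + a)] = leb A.
Proof.
have ms : measurable_fun (setT : set (measurableTypeR R))
    (fun x : R => (x + a)%R : measurableTypeR R) by exact: measurable_funD.
move=> mA; have := @lebesgue_measure_unique R (image_measure leb ms) _ A mA.
move=> -> // _ [[x y] /= xy <-].
rewrite /= /pushforward lebesgue_measure_itv/=.
rewrite [X in leb X](_ : _ = `]x - a, y - a]%classic); last first.
  by apply/seteqP; split => z /=; rewrite !in_itv/= ltrBlDr lerBrDr.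
rewrite lebesgue_measure_itv/= !lte_fin ltrBlDr subrK.
by case: ifPn => // _; rewrite -!EFinB opprB addrA subrK.
Qed.

Lemma ge0_integral_shift (a : R) (f : R -> \bar R) : measurable_fun setT f ->
  (forall x, 0 <= f x)%E -> (\int[leb]_x f (x + a)%R = \int[leb]_x f x)%E.
Proof.
have ms : measurable_fun (setT : set (measurableTypeR R))
    (fun x : R => (x + a)%R : measurableTypeR R) by exact: measurable_funD.
move=> mf f0; rewrite -(ge0_integral_image_measure leb ms mf f0).
apply: (@eq_measure_integral _ (measurableTypeR R)) => A mA _.
exact: lebesgue_measure_shift.
Qed.

Lemma lebesgue_measure_scale (r : R) (A : set R) : 0 < r -> measurable A ->
  leb [set x | A (r^-1 * x)] = (r%:E * leb A)%E.
Proof.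
have ms : measurable_fun (setT : set (measurableTypeR R))
    (fun x : R => (r^-1 * x)%R : measurableTypeR R) by exact: measurable_funM.
move=> r0 mA.
have ri0 : 0 <= r^-1 by rewrite invr_ge0 ltW.
have := @lebesgue_measure_unique R (mscale (NngNum ri0) (image_measure leb ms)) _ A mA.
move=> H; rewrite H.
  rewrite /mscale/= muleA -EFinM divff ?mul1e// gt_eqF//.
move=> _ [[x y] /= xy <-].
rewrite /mscale/= /pushforward lebesgue_measure_itv/=.
rewrite [X in leb X](_ : _ = `]r * x, r * y]%classic); last first.
  by apply/seteqP; split => z /=; rewrite !in_itv/= ltr_pdivlMl// ler_pdivrMl.
rewrite lebesgue_measure_itv/= !lte_fin ltr_pM2l//.
case: ifPn => // _; last by rewrite mule0.
by rewrite -!EFinB -EFinM -mulrBr mulKf// gt_eqF.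
Qed.

Lemma ge0_integral_scale (r : R) (f : R -> \bar R) : 0 < r -> measurable_fun setT f ->
  (forall x, 0 <= f x)%E -> (\int[leb]_x f (r^-1 * x)%R = r%:E * \int[leb]_x f x)%E.
Proof.
have ms : measurable_fun (setT : set (measurableTypeR R))
    (fun x : R => (r^-1 * x)%R : measurableTypeR R) by exact: measurable_funM.
move=> r0 mf f0; rewrite -(ge0_integral_image_measure leb ms mf f0).
have := @ge0_integral_mscale _ (measurableTypeR R) R leb setT measurableT (NngNum (ltW r0)) f mf (fun _ _ => f0 _).
move=> /= <-.
apply: (@eq_measure_integral _ (measurableTypeR R)) => A mA _.
exact: lebesgue_measure_scale.
Qed.
End lebesgue_line.

Section sigma_finite_measure_pack.
Context d (T : measurableType d) (R : realType) (m : {measure set T -> \bar R}).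
Hypothesis sf : sigma_finite setT m.

(** Carrier on which the hypothesis [sf] is registered as a structure: product measures and Tonelli
    expect a bundled sigma-finite measure. *)
Definition sigma_finite_copy : set T -> \bar R := m.
HB.instance Definition _ := Measure.on sigma_finite_copy.
HB.instance Definition _ := Measure_isSigmaFinite.Build _ _ _ sigma_finite_copy sf.

Lemma sigma_finite_measure_pack :
  exists m' : {sigma_finite_measure set T -> \bar R}, (m' : set T -> \bar R) = m.
Proof. by exists sigma_finite_copy. Qed.
End sigma_finite_measure_pack.

(** * Lebesgue measure on row vectors as a sigma-finite measure *)

Definition centered_box {R : realType} {n} (k : R) : set 'rV[R]_n :=
  [set v | forall i, `|v ord0 i| <= k].

Section lebesgue_rV_measure.
Context {R : realType}.

Lemma measurable_centered_box n (k : R) :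
  measurable (centered_box k : set (borelType R n)).
Proof.
rewrite [X in measurable X](_ : _ = \bigcap_(i in [set: 'I_n])
  ((fun v : borelType R n => (v : 'rV[R]_n) ord0 i) @^-1` [set x | `|x| <= k])); last first.
  by apply/seteqP; split => v /= h i; [move=> _|]; exact: h.
apply: fin_bigcap_measurable => // i _.
rewrite -[X in measurable X]setTI; apply: measurable_coord => //.
rewrite [X in measurable X](_ : _ = `[- k, k]%classic); first exact: measurable_itv.
by apply/seteqP; split => x /=; rewrite in_itv/= ler_norml.
Qed.

Lemma centered_box_cover n : \bigcup_k centered_box k%:R = [set: 'rV[R]_n].
Proof.
apply/seteqP; split => // v _.
exists (Num.truncn `|v|).+1 => // i.
have /mapP[j Hj e] : `|v ord0 i| \in [seq `|v x.1 x.2| | x : 'I_1 * 'I_n].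
  by apply/mapP; exists (ord0, i) => //=; rewrite mem_enum.
have : `|v ord0 i| <= `|v|.
  rewrite e [leRHS]/Num.norm /= mx_normrE; apply/bigmax_geP; right => /=; by exists j.
by move/le_trans; apply; apply/ltW; exact: truncnS_gt.
Qed.

(** [lebesgue_rV] is an iterated integral defined on all sets. The image under [row_mx] of the
    product of the line with dimension n is a genuine measure agreeing with it on Borel sets. The
    properties are proved in one induction, since each is reduced to slices along the first
    coordinate, one dimension lower. *)
Lemma lebesgue_rV_measure n : exists mu : {sigma_finite_measure set (borelType R n) -> \bar R},
  [/\ (forall A, borel A -> mu A = lebesgue_rV A),
      (forall A x, borel A -> mu [set v | A (v + x)] = mu A),
      (forall A (r : R), 0 < r -> borel A ->
         mu [set v | A (r^-1 *: v)] = ((r ^+ n)%:E * mu A)%E) &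
      (forall k : R, mu (centered_box k) < +oo)%E].
Proof.
elim: n => [|n [mu [mE mS mZ mB]]].
  exists (@dirac _ (borelType R 0) (0 : 'rV[R]_0) R : {sigma_finite_measure set _ -> \bar R}); split => [A _|A x _|A r _ _|k] /=.
  - by rewrite /dirac/=.
  - by congr (dirac _ _); apply/funext => v /=; congr A; apply/rowP => -[].
  - by rewrite expr0 mul1e; congr (dirac _ _); apply/funext => v /=; congr A; apply/rowP => -[].
  - by rewrite /dirac/= ltry.
pose row (p : R * borelType R n) : borelType R n.+1 :=
  row_mx (const_mx p.1 : 'rV[R]_1) (p.2 : 'rV[R]_n).
have mrow : measurable_fun setT row by apply: measurable_row_mx.
pose nu := image_measure (@lebesgue_measure R \x mu)%E mrow.
have nuE (A : set 'rV[R]_n.+1) : borel A ->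
    nu A = (\int[@lebesgue_measure R]_x mu [set v | A (row (x, v))])%E.
  move=> bA; rewrite /nu/= /pushforward /product_measure1; apply: eq_integral => x _ /=.
  by congr (mu _); apply/seteqP; split => v /=; rewrite /xsection/= inE.
have bsec (A : set 'rV[R]_n.+1) x : borel A -> borel [set v : 'rV[R]_n | A (row (x, v))].
  move=> bA; rewrite -[X in borel X]setTI.
  by apply: (measurable_row_mx (measurable_cst x) (@measurable_id _ (borelType R n) setT)).
have msec (A : set 'rV[R]_n.+1) : borel A ->
    measurable_fun setT (fun x : R => mu [set v | A (row (x, v))]).
  move=> bA; have := @measurable_fun_xsection _ _ _ _ _ mu (row @^-1` A).
  rewrite (_ : (fun x => _) = mu \o xsection (row @^-1` A)); last first.
    by apply/funext => x /=; congr (mu _); apply/seteqP; split => v /=; rewrite /xsection/= inE.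
  by apply; rewrite -[X in measurable X]setTI; exact (mrow measurableT _ bA).
have nuB (k : R) : (nu (centered_box k) < +oo)%E.
  rewrite nuE; last exact: measurable_centered_box.
  (* The box lies over the interval from - k to k, and its slices lie in the box of dimension n. *)
  rewrite (@le_lt_trans _ _ (\int[@lebesgue_measure R]_x ((\1_(`[- k, k]%classic) x : R)%:E * mu (centered_box k)))%E)//.
    apply: ge0_le_integralT => // x; rewrite indicE; case: (boolP (x \in _)) => xk.
      have mbox := @measurable_centered_box n k.
      rewrite mul1e (measure_le _ _ mbox)//.
        by apply: bsec; exact: measurable_centered_box.
      move=> v hv i; have := hv (@rshift 1 n i).
      by rewrite /row/= (@row_mxEr _ 1 1 n).
    rewrite mul0e [X in mu X](_ : _ = set0) ?measure0//.
    apply/seteqP; split => // v /= hv.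
    move/negP: xk; apply; have := hv (@lshift 1 n ord0).
    by rewrite /row/= (@row_mxEl _ 1 1 n) mxE inE/= in_itv/= ler_norml.
  have mI : measurable_fun (setT : set (measurableTypeR R))
      (fun x : R => (\1_(`[- k, k]%classic) x : R)%:E).
    apply/(@measurable_EFinP _ (measurableTypeR R) R).
    exact: (@measurable_indic _ (measurableTypeR R)).
  rewrite (ge0_integralZr _ measurableT mI)//.
  pose I : set R := `[- k, k]%classic; rewrite -/I.
  have -> : (\int[@lebesgue_measure R]_x ((\1_I x : R)%:E) = @lebesgue_measure R I)%E.
    by rewrite -[in RHS](setIT I); exact: (@integral_indic _ (measurableTypeR R) R lebesgue_measure setT measurableT I (measurable_itv _)).
  rewrite /I lebesgue_measure_itv/=.
  case: ifPn => [|_]; last by rewrite mul0e.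
  rewrite lte_fin => h; rewrite -EFinB lte_mul_pinfty//.
  by rewrite lee_fin subr_ge0 ltW.
have sf : sigma_finite setT nu.
  exists (fun k => centered_box k%:R); first by rewrite centered_box_cover.
  by move=> k; split; [exact: measurable_centered_box|exact: nuB].
have [nu' nu'E] := sigma_finite_measure_pack sf.
exists nu'; rewrite nu'E; split => //.
- move=> A bA; rewrite nuE//; apply: eq_integral => x _.
  by rewrite mE//; exact: bsec.
- move=> A a bA.
  have bAa : borel [set v | A (v + a)] by exact: borel_shift.
  rewrite !nuE//.
  rewrite -(ge0_integral_shift (a ord0 (@lshift 1 n ord0)) (msec _ bA))//.
  apply: eq_integral => x _ /=.
  rewrite -[RHS](mS _ (rsubmx (a : 'rV[R]_(1 + n)))) //; last exact: bsec.
  congr (mu _); apply/funext => v /=; congr A.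
  rewrite /row/= -[in LHS](hsubmxK (a : 'rV[R]_(1 + n))) (@add_row_mx _ 1 1 n).
  congr (@row_mx R 1 1 n _ _); apply/rowP => i; rewrite !mxE (ord1 i).
  by congr (_ + a _ _); apply/val_inj.
- move=> A r r0 bA.
  have bAa : borel [set v | A (r^-1 *: v)] by exact: borel_scale.
  rewrite !nuE//.
  rewrite exprSr EFinM -muleA -(ge0_integral_scale r0 (msec _ bA))//.
  rewrite -ge0_integralZl//; last 2 first.
    - apply: (measurableT_comp (msec _ bA)); exact: measurable_funM.
    - by rewrite lee_fin exprn_ge0// ltW.
  apply: eq_integral => x _ /=.
  rewrite -mZ//; last exact: bsec.
  congr (mu _); apply/funext => v /=; congr A.
  rewrite /row/= (@scale_row_mx _ 1 1 n).
  congr (@row_mx R 1 1 n _ _).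
  by apply/rowP => i; rewrite !mxE.
Qed.
End lebesgue_rV_measure.

(** * Right derivatives of radially monotone functions *)

Section radial_right_derivative.
Context {R : realType}.
Variables (j : R -> R) (n : nat) (M : R).
Hypothesis n0 : (0 < n)%N.
Hypothesis j0 : j 0 = 0.
Hypothesis j_mono : forall a b : R, 0 <= a -> a <= b -> j a <= j b.
Hypothesis j_bound : forall a b : R, 0 <= a -> a <= b -> j b - j a <= M * (b ^+ n - a ^+ n).
Hypothesis j_radial : forall r a b : R, 1 <= r -> 0 <= a -> a <= b ->
  j (r * b) - j (r * a) <= r ^+ n * (j b - j a).

(** Increments of [j] are measured against those of s ^ n: [j_radial] then says that dilating an
    interval by r >= 1 does not raise the quotient. *)
Let D (t h : R) := (j (t + h) - j t) / ((t + h) ^+ n - t ^+ n).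

Let den_gt0 (t h : R) : 0 <= t -> 0 < h -> 0 < (t + h) ^+ n - t ^+ n.
Proof. by move=> t0 h0; rewrite subr_gt0 ltrXn2r ?nnegrE ?addr_ge0 ?(ltW h0)// -?lt0n// ltrDl. Qed.

Let D_bound (t h : R) : 0 <= t -> 0 < h -> D t h <= M.
Proof.
by move=> t0 h0; rewrite ler_pdivrMr ?den_gt0//; apply: j_bound => //; rewrite lerDl ltW.
Qed.

(** The dilation by r ^ i carries [t, r t] to the i-th interval and multiplies the increment of [j]
    by at most r ^ (n i); the geometric sum collects these factors. *)
Let j_geom (t r : R) k : 0 <= t -> 1 <= r ->
  j (r ^+ k * t) - j t <= (j (r * t) - j t) * \sum_(i < k) r ^+ n ^+ i.
Proof.
move=> t0 r1; have r0 : 0 <= r by rewrite (le_trans _ r1).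
elim: k => [|k IH]; first by rewrite expr0 mul1r subrr big_ord0 mulr0.
rewrite big_ord_recr/= mulrDr -(subrK (j (r ^+ k * t)) (j (r ^+ k.+1 * t))) -addrA.
rewrite addrC lerD// exprSr -mulrA -exprM mulnC exprM.
apply: (le_trans (j_radial _ _ _)) => //; first by rewrite exprn_ege1.
  by rewrite ler_peMl.
by rewrite mulrC -!exprM mulnC.
Qed.

(* For [t > 0] put [r h = 1 + h / t]: telescoping [j] along the radii
   [r h ^+ i * t] up to the first one beyond [t + h'] bounds [D t h'] by [D t h],
   up to an error that vanishes with [h]. *)
Let D_almost_mono (t h' e : R) : 0 <= t -> 0 < h' -> e < D t h' ->
  \forall h \near 0^'+, e < D t h.
Proof.
move=> t0 h'0 eD.
(* At t = 0 no telescoping occurs: [0, h'] is a dilate of [0, h]. *)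
move: t0; rewrite le_eqVlt => /predU1P[t0|t0].
  near=> h.
  have h0 : 0 < h by near: h; exact: nbhs_right_gt.
  have hh' : h <= h' by near: h; exact: nbhs_right_le.
  apply: (lt_le_trans eD); rewrite /D -t0 !add0r j0 !subr0 expr0n/=.
  rewrite (gtn_eqF n0) !subr0.
  have r1 : 1 <= h' / h by rewrite ler_pdivlMr// mul1r.
  have := j_radial r1 (lexx 0) (ltW h0).
  rewrite mulr0 j0 !subr0 divfK ?gt_eqF// expr_div_n => H.
  by rewrite ler_pdivrMr ?exprn_gt0// mulrAC -mulrA mulrC.
have r'1 : 1 < 1 + h' / t by rewrite ltrDl divr_gt0.
pose r h := 1 + h / t; rewrite -/(r h') in r'1.
have trE h : r h * t = t + h by rewrite /r mulrDl mul1r divfK ?gt_eqF.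
have denE h : (t + h) ^+ n - t ^+ n = t ^+ n * (r h ^+ n - 1).
  by rewrite -trE exprMn mulrBr mulr1 mulrC.
(* [(r h * r h') ^+ n - 1] accounts for the overshoot of the telescoping. As h tends to 0 the margin
   tends to [D t h' - e] times [r h' ^+ n - 1], which is positive. *)
have : {for 0, continuous (fun h => D t h' * (r h' ^+ n - 1) - e * ((r h * r h') ^+ n - 1))}.
  move=> /=; apply: cvgB; first exact: cvg_cst.
  apply: cvgM; first exact: cvg_cst.
  apply: cvgB; last exact: cvg_cst.
  apply: (@continuous_comp _ _ _ (fun h => r h * r h') (fun x => x ^+ n)); last exact: exprn_continuous.
  apply: cvgM; last exact: cvg_cst.
  apply: cvgD; first exact: cvg_cst.
  by apply: cvgM; [exact: cvg_id|exact: cvg_cst].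
have P0 : 0 < D t h' * (r h' ^+ n - 1) - e * ((r 0 * r h') ^+ n - 1).
  rewrite /r mul0r addr0 mul1r -mulrBl mulr_gt0// subr_gt0//.
  by rewrite exprn_egt1// -lt0n.
move=> Hc; have Hn := cvgr_gt _ Hc _ P0.
near=> h.
have h0 : 0 < h by near: h; exact: nbhs_right_gt.
have hh' : h <= h' by near: h; exact: nbhs_right_le.
have r1 : 1 < r h by rewrite ltrDl divr_gt0.
have /= Ph : 0 < D t h' * (r h' ^+ n - 1) - e * ((r h * r h') ^+ n - 1).
  by near: h; apply: cvg_within; exact: Hn.
(* The first power of [r h] beyond [r h'] exceeds it by at most one factor [r h]. *)
have [k [k1 k2]] : exists k, r h' <= r h ^+ k /\ r h ^+ k <= r h * r h'.
  have ex : exists k, r h' <= r h ^+ k.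
    have hr : 0 < r h - 1 by rewrite subr_gt0.
    (* This exponent suffices by Bernoulli's inequality. *)
    exists (Num.truncn ((r h' - 1) / (r h - 1))).+1.
    rewrite -(lerD2r (-1)).
    have := ltW (truncnS_gt ((r h' - 1) / (r h - 1))).
    rewrite ler_pdivrMr// => /le_trans; apply.
    set k := _.+1.
    elim: k => [|k IH]; first by rewrite mul0r expr0 subrr.
    rewrite -natr1 mulrDl mul1r exprSr (le_trans (lerD IH (lexx _)))//.
    have : 1 <= r h ^+ k by rewrite exprn_ege1// ltW.
    by move: (r h ^+ k) => x x1; nra.
  case: (ex_minnP ex) => k kP kmin; exists k; split=> //.
  case: k kP kmin => [|k] kP kmin.
    by rewrite expr0; have := ltW r1; have := ltW r'1; nra.
  rewrite exprS ler_pM2l; last by rewrite (lt_trans _ r1).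
  rewrite leNgt; apply/negP => /ltW /kmin.
  by rewrite ltnn.
have gt1 : 0 < (r h * r h') ^+ n - 1.
  rewrite subr_gt0 exprn_egt1// -?lt0n//.
  by move: r1 r'1; nra.
rewrite -(ltr_pM2r gt1).
move: Ph; rewrite subr_gt0 => /lt_le_trans; apply.
have tn0 : 0 < t ^+ n by rewrite exprn_gt0.
rewrite -(ler_pM2r tn0).
have -> : D t h' * (r h' ^+ n - 1) * t ^+ n = j (t + h') - j t.
  by rewrite -mulrA [X in _ * X]mulrC -denE divfK// gt_eqF// den_gt0// ltW.
rewrite -trE.
apply: (@le_trans _ _ (j (r h ^+ k * t) - j t)).
  rewrite lerB// j_mono// ?ler_pM2r// mulr_ge0 ?(ltW t0)//.
  by rewrite (le_trans _ (ltW r'1)).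
apply: (le_trans (j_geom k (ltW t0) (ltW r1))).
have rn1 : 0 < r h ^+ n - 1 by rewrite subr_gt0 exprn_egt1// -lt0n.
have -> : j (r h * t) - j t = D t h * (t ^+ n * (r h ^+ n - 1)).
  by rewrite -denE trE divfK// gt_eqF// den_gt0// ltW.
have D0 : 0 <= D t h.
  rewrite divr_ge0// ?subr_ge0; first by rewrite j_mono ?(ltW t0)// lerDl ltW.
  by rewrite -subr_ge0 ltW// den_gt0// ltW.
rewrite -mulrA -[leRHS]mulrA; apply: ler_wpM2l => //.
rewrite -mulrA [leRHS]mulrC; apply: ler_wpM2l; first exact: ltW.
rewrite -subrX1 lerD2r.
rewrite -exprM mulnC exprM lerXn2r// ?nnegrE ?exprn_ge0 ?mulr_ge0//;
  by rewrite ltW// (lt_trans ltr01).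
Unshelve. all: by end_near. Qed.

(** The quotients against s ^ n are bounded by [M] and, by almost monotonicity, eventually exceed
    every value below their supremum, so they converge to it. The factor [q] converts them into
    quotients against h. *)
Lemma radial_right_derivative (t : R) : 0 <= t ->
  exists l : R, (j (t + h) - j t) / h @[h --> 0^'+] --> l.
Proof.
move=> t0.
pose S := [set D t h | h in [set h | 0 < h]].
have S0 : has_sup S.
  split; first by exists (D t 1); exists 1 => //=.
  by exists M => _ [h h0 <-]; exact: D_bound.
have DL : D t h @[h --> 0^'+] --> sup S.
  apply/cvgrPdist_le => e e0.
  have [_ [h' h'0 <-] /(D_almost_mono t0 h'0) Hh] := sup_adherent e0 S0.
  near=> h.
  have h0 : 0 < h by near: h; exact: nbhs_right_gt.
  have eD : sup S - e < D t h by near: h.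
  rewrite ger0_norm ?subr_ge0; last by apply: ub_le_sup; [exact: S0.2|exists h].
  by rewrite lerBlDr -lerBlDl ltW.
(* Slope of s ^ n on [t, t + h], written as a polynomial in h so that its limit is its value at
   0. *)
pose q (h : R) := \sum_(i < n) (t + h) ^+ (n.-1 - i) * t ^+ i.
have qc : q h @[h --> 0^'+] --> q 0.
  apply: cvg_at_right_filter; apply: cvg_big => [|i _]; first exact: add_continuous.
  apply: cvgM; last exact: cvg_cst.
  apply: (@continuous_comp _ _ _ (fun h => t + h) (fun x => x ^+ (n.-1 - i))); last exact: exprn_continuous.
  by apply: cvgD; [exact: cvg_cst|exact: cvg_id].
exists (sup S * q 0).
apply: cvg_trans (cvgM DL qc).
apply: near_eq_cvg; near=> h.
have h0 : 0 < h by near: h; exact: nbhs_right_gt.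
have qE : q h = ((t + h) ^+ n - t ^+ n) / h.
  rewrite subrXX addrAC subrr add0r mulrAC divff ?gt_eqF// mul1r.
  by apply: eq_bigr => i _; rewrite -subn1 -subnDA add1n.
rewrite /= qE /D mulrA divfK// gt_eqF// den_gt0//.
Unshelve. all: by end_near. Qed.
End radial_right_derivative.

(** * Generating functions of the cluster size *)

Lemma measurable_comp_nondecreasing01 {R : realType} d (T : measurableType d)
    (g : R -> R) (f : T -> R) :
  (forall a b, 0 <= a -> a <= b -> b <= 1 -> g a <= g b) ->
  measurable_fun setT f -> (forall x, 0 <= f x <= 1) ->
  measurable_fun setT (fun x => g (f x)).
Proof.
(* [g] is monotone on [0, 1] only; clamping the argument gives a function that is monotone on the
   whole line. *)
move=> gle mf f01; pose g' (s : R) := g (Num.max 0 (Num.min 1 s)).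
have mg : measurable_fun setT g'.
  apply: nondecreasing_measurable => // x y xy; apply: gle.
  - by rewrite le_max lexx.
  - rewrite ge_max le_max lexx/= le_max; apply/orP; right.
    by rewrite le_min !ge_min lexx/= xy orbT.
  - by rewrite ge_max ler01 ge_min lexx.
rewrite (_ : (fun x => g (f x)) = g' \o f); first exact: measurableT_comp.
apply/funext => x; rewrite /g'/=; have /andP[f0 f1] := f01 x.
by rewrite min_r// max_r.
Qed.

Section size_gf.
Context {R : realType} {d : measure_display} {O : measurableType d}.
Variables (P : probability O R) (eta : O -> nat).
Hypothesis meta : measurable_fun setT eta.
Hypothesis eta_fin : (\int[P]_w (eta w)%:R%:E < +oo)%E.
Hypothesis eta_gt0 : (0 < \int[P]_w (eta w)%:R%:E)%E.

Definition size_mean (f : nat -> R) : R := Rintegral P setT (f \o eta).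
Local Notation E := size_mean.
(** Domination by 1 + k, which is integrable because [eta] has finite mean; it covers s ^ k and k *
    s ^ k.-1 for s in [0, 1]. *)
Definition linearly_bounded (f : nat -> R) := forall k, `|f k| <= 1 + k%:R.

Lemma measurable_size (f : nat -> R) : measurable_fun setT (f \o eta).
Proof. exact: (@measurableT_comp _ _ _ _ _ _ f). Qed.

Lemma size_integrable (f : nat -> R) : linearly_bounded f ->
  P.-integrable setT (EFin \o (f \o eta)).
Proof.
move=> fb; apply: (@le_integrable _ _ _ P setT measurableT _ (fun w => (1%:E + (eta w)%:R%:E)%E)).
- by apply/measurable_EFinP; exact: measurable_size.
- move=> w _ /=; rewrite lee_fin [leRHS]ger0_norm ?addr_ge0//.
- apply: integrableD => //; first exact: finite_measure_integrable_cst.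
  apply/integrableP; split.
    by apply/measurable_EFinP; exact: (measurable_size (fun k => k%:R)).
  rewrite (eq_integral (fun w => (eta w)%:R%:E))// => w _.
  by rewrite /= ger0_norm.
Qed.

Lemma size_mean_le f g : linearly_bounded f -> linearly_bounded g ->
  (forall k, f k <= g k) -> E f <= E g.
Proof.
move=> bf bg fg; apply: le_Rintegral => //; try exact: size_integrable.
Qed.

Lemma size_meanB f g : linearly_bounded f -> linearly_bounded g ->
  E (fun k => f k - g k) = E f - E g.
Proof. by move=> bf bg; rewrite /E -RintegralB//; exact: size_integrable. Qed.

Lemma size_meanZ c f : linearly_bounded f -> E (fun k => c * f k) = c * E f.
Proof. by move=> bf; rewrite /E -RintegralZl//; exact: size_integrable. Qed.

Definition pgf (s : R) := E (fun k => s ^+ k).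
Definition size_mu := E (fun k => k%:R).
(** Formally the derivative of [pgf]; the two are linked by the secant bounds of [pgf_diff]. *)
Definition dpgf (s : R) := E (fun k => k%:R * s ^+ k.-1).

Lemma lb_pow (s : R) : 0 <= s <= 1 -> linearly_bounded (fun k => s ^+ k).
Proof.
move=> /andP[s0 s1] k; rewrite ger0_norm ?exprn_ge0//.
by rewrite (le_trans (exprn_ile1 _ s0 s1))// lerDl.
Qed.

Lemma lb_dpow (s : R) : 0 <= s <= 1 -> linearly_bounded (fun k => k%:R * s ^+ k.-1).
Proof.
move=> /andP[s0 s1] k; rewrite ger0_norm ?mulr_ge0 ?exprn_ge0//.
rewrite (@le_trans _ _ k%:R) ?lerDr//.
by rewrite ler_piMr// exprn_ile1.
Qed.

Lemma lb_id : linearly_bounded (fun k => k%:R).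
Proof. by move=> k; rewrite ger0_norm// lerDr. Qed.
Hint Resolve lb_pow lb_dpow lb_id : core.

Lemma size_muE : size_mu%:E = (\int[P]_w (eta w)%:R%:E)%E.
Proof.
rewrite /size_mu /E /Rintegral fineK// ge0_fin_numE//.
by apply: integral_ge0 => w _; rewrite lee_fin.
Qed.

Lemma size_mu_gt0 : 0 < size_mu.
Proof. by rewrite -lte_fin size_muE. Qed.

Lemma size_biased_gfE s : size_biased_gf P eta s = size_mu^-1 * dpgf s.
Proof.
rewrite /size_biased_gf unlock /size_mu /dpgf /E /Rintegral; congr (_ * fine _).
apply: eq_integral => w _; rewrite /= indicE/= mem_setE/=.
by case: (eta w) => [|k]/=; rewrite ?mul0r ?mul1r.
Qed.

Lemma dpgf1 : dpgf 1 = size_mu.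
Proof. by rewrite /dpgf /size_mu; congr E; apply/funext => k; rewrite expr1n mulr1. Qed.

Lemma dpgf_ge0 s : 0 <= s <= 1 -> 0 <= dpgf s.
Proof.
move=> /andP[s0 s1]; apply: Rintegral_ge0 => w _ /=.
by rewrite mulr_ge0 ?exprn_ge0.
Qed.

Lemma dpgf_le a b : 0 <= a -> a <= b -> b <= 1 -> dpgf a <= dpgf b.
Proof.
move=> a0 ab b1; apply: size_mean_le; [apply: lb_dpow|apply: lb_dpow|move=> k].
- by rewrite a0 (le_trans ab).
- by rewrite b1 (le_trans a0).
by rewrite ler_wpM2l// lerXn2r// nnegrE// (le_trans a0).
Qed.

Lemma pow_diff_bounds (a b : R) k : 0 <= a -> a <= b ->
  (b - a) * (k%:R * a ^+ k.-1) <= b ^+ k - a ^+ k <= (b - a) * (k%:R * b ^+ k.-1).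
Proof.
move=> a0 ab; have b0 := le_trans a0 ab.
case: k => [|k]; first by rewrite !mul0r !mulr0 !expr0 subrr lexx.
have ba0 : 0 <= b - a by rewrite subr_ge0.
rewrite subrXX/= !mulr_natl; apply/andP; split; apply: ler_wpM2l => //.
  rewrite -[k.+1 in leLHS]card_ord -sumr_const ler_sum// => i _.
  rewrite -{1}(subnK (ltn_ord i : (i <= k)%N)) exprD ler_wpM2r ?exprn_ge0//.
  by rewrite lerXn2r ?nnegrE.
rewrite -[k.+1 in leRHS]card_ord -sumr_const ler_sum// => i _.
have -> : b ^+ k = b ^+ (k - i) * b ^+ i by rewrite -exprD subnK// -ltnS.
rewrite ler_wpM2l ?exprn_ge0//.
by rewrite lerXn2r ?nnegrE.
Qed.

(** By convexity, an increment of x ^ k over an interval of given length is largest when the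
    interval ends at 1. *)
Lemma pow_pred_diff (a b : R) k : 0 <= a -> a <= b -> b <= 1 ->
  b ^+ k - a ^+ k <= 1 - (1 - (b - a)) ^+ k.
Proof.
move=> a0 ab b1; have b0 := le_trans a0 ab.
have ba0 : 0 <= b - a by rewrite subr_ge0.
have -> : 1 - (1 - (b - a)) ^+ k = (b - a) * \sum_(i < k) 1 ^+ (k.-1 - i) * (1 - (b - a)) ^+ i.
  by rewrite -{1}(expr1n _ k) subrXX; congr (_ * _); ring.
rewrite subrXX.
apply: ler_wpM2l => //; rewrite ler_sum// => i _.
rewrite expr1n mul1r (@le_trans _ _ (a ^+ i)) ?ler_piMl ?exprn_ge0 ?exprn_ile1//.
by rewrite lerXn2r// ?nnegrE; move: a0 ab b1 ba0; lra.
Qed.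

Lemma pgf_diff a b : 0 <= a -> a <= b -> b <= 1 ->
  (b - a) * dpgf a <= pgf b - pgf a <= (b - a) * dpgf b.
Proof.
move=> a0 ab b1.
have a01 : 0 <= a <= 1 by rewrite a0 (le_trans ab).
have b01 : 0 <= b <= 1 by rewrite b1 (le_trans a0).
have b0 := le_trans a0 ab.
have lbB : linearly_bounded (fun k => b ^+ k - a ^+ k).
  move=> k; have /andP[+ _] := pow_diff_bounds k a0 ab.
  have h : 0 <= (b - a) * (k%:R * a ^+ k.-1) by rewrite !mulr_ge0 ?subr_ge0 ?exprn_ge0.
  move=> /(le_trans h) ?; rewrite ger0_norm// (@le_trans _ _ 1) ?lerDl//.
  by rewrite lerBlDr (le_trans (exprn_ile1 _ b0 b1))// lerDl exprn_ge0.
have lbZ s : 0 <= s <= 1 -> linearly_bounded (fun k => (b - a) * (k%:R * s ^+ k.-1)).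
  move=> s01 k; rewrite normrM (le_trans _ (lb_dpow s01 k))// ler_piMl//.
  by rewrite ger0_norm ?subr_ge0//; move: a0 b1; lra.
rewrite -!size_meanZ -?size_meanB; try exact: lb_dpow; try exact: lb_pow.
by apply/andP; split; apply: size_mean_le; rewrite //; try exact: lbZ;
  move=> k; have /andP[] := pow_diff_bounds k a0 ab.
Qed.

(** The bound of [pow_pred_diff], term by term: the modulus of continuity of [dpgf] at 1 serves
    everywhere on [0, 1]. *)
Lemma dpgf_diff a b : 0 <= a -> a <= b -> b <= 1 ->
  dpgf b - dpgf a <= size_mu - dpgf (1 - (b - a)).
Proof.
move=> a0 ab b1.
have a01 : 0 <= a <= 1 by rewrite a0 (le_trans ab).
have b01 : 0 <= b <= 1 by rewrite b1 (le_trans a0).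
have c01 : 0 <= 1 - (b - a) <= 1 by move: a0 ab b1; lra.
have lbB s s' : 0 <= s <= 1 -> 0 <= s' <= 1 -> s' <= s ->
    linearly_bounded (fun k => k%:R * s ^+ k.-1 - k%:R * s' ^+ k.-1).
  move=> s01 s'01 ss k; rewrite -mulrBr normrM (ger0_norm (ler0n _ _)).
  rewrite (@le_trans _ _ k%:R) ?lerDr// ler_piMr//.
  move: s01 s'01 => /andP[s0 s1] /andP[s'0 s'1].
  rewrite ger0_norm ?subr_ge0 ?lerXn2r ?nnegrE//.
  by rewrite lerBlDr (le_trans (exprn_ile1 _ s0 s1))// lerDl exprn_ge0.
rewrite -dpgf1 -!size_meanB; try by apply: lb_dpow; rewrite ?ler01 ?lexx.
have l01 : 0 <= (1 : R) <= 1 by rewrite ler01/=.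
apply: size_mean_le; [exact: lbB|apply: lbB => //; by case/andP: c01|move=> k].
by rewrite -!mulrBr ler_wpM2l// expr1n pow_pred_diff.
Qed.

(** Dominated convergence along s = 1 - 1 / (m + 1), with [eta] itself as the dominating
    function. *)
Lemma dpgf_cvg1 e : 0 < e -> exists u, [/\ 0 < u, u <= 1 & size_mu - dpgf (1 - u) <= e].
Proof.
move=> e0.
pose s (m : nat) : R := 1 - m.+1%:R^-1.
have s01 m : 0 <= s m <= 1.
  rewrite subr_ge0 gerBl invr_ge0 ler0n andbT invf_le1 ?ltr0n//.
  by rewrite ler1n.
have H : (\int[P]_w ((eta w)%:R * s m ^+ (eta w).-1)%:E)%E @[m --> \oo] -->
    (\int[P]_w (eta w)%:R%:E)%E.
  apply: (@dominated_cvg _ _ _ P setT measurableT _ _ (fun w => (eta w)%:R%:E)).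
  - by move=> m; apply/measurable_EFinP; exact: (measurable_size (fun k => k%:R * s m ^+ k.-1)).
  - move=> w _; apply: cvg_EFin; first by near=> m.
    suff : (eta w)%:R * s m ^+ (eta w).-1 @[m --> \oo] --> ((eta w)%:R * 1 ^+ (eta w).-1 : R).
      by rewrite expr1n mulr1.
    apply: cvgM; first exact: cvg_cst.
    apply: (@cvg_comp _ _ _ s (fun x : R => x ^+ (eta w).-1) \oo (nbhs (1 : R))); last exact: exprn_continuous.
    have -> : 1 = 1 - 0 :> R by rewrite subr0.
    apply: cvgB; first exact: cvg_cst.
    exact: cvg_harmonic.
  - by [].
  - exact: (size_integrable lb_id).
  - move=> m w _; rewrite abse_EFin lee_fin; have /andP[s0 s1] := s01 m.
    rewrite ger0_norm ?mulr_ge0 ?exprn_ge0// ler_piMr// exprn_ile1//.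
have Hf : dpgf (s m) @[m --> \oo] --> size_mu.
  apply: (@cvg_comp _ _ _ _ fine _ _ _ H).
  rewrite -size_muE; exact: fine_cvg.
have /cvgrPdist_le/(_ _ e0)[m _ /(_ m (leqnn _))] := Hf.
move=> /= He; exists m.+1%:R^-1; split.
- by rewrite invr_gt0.
- by rewrite invf_le1 ?ltr0n// ler1n.
- by rewrite (le_trans _ He)// ler_norm.
Unshelve. all: by end_near. Qed.

(** For k <= 1 the term k * s ^ k.-1 does not depend on s. In this case the difference measure
    carries no information about the point distribution. *)
Lemma dpgf_cst s : P [set w | (2 <= eta w)%N] = 0%E -> 0 <= s <= 1 -> dpgf s = size_mu.
Proof.
move=> H s01; rewrite -dpgf1 /dpgf /E /Rintegral; congr fine.
apply: ae_eq_integral => //.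
- by apply/measurable_EFinP; exact: measurable_size.
- by apply/measurable_EFinP; exact: measurable_size.
- exists [set w | (2 <= eta w)%N]; split => //.
    rewrite [X in measurable X](_ : _ = eta @^-1` [set k | (2 <= k)%N])//.
    by rewrite -[X in measurable X]setTI; exact: meta.
  move=> w /= Hw; rewrite leqNgt; apply/negP => hw; apply: Hw => _.
  by move: hw; case: (eta w) => [|[|k]]//= _; rewrite !expr0.
Qed.

Lemma measurable_dpgf d' (T' : measurableType d') (f : T' -> R) :
  measurable_fun setT f -> (forall x, 0 <= f x <= 1) ->
  measurable_fun setT (fun x => dpgf (f x)).
Proof. exact: measurable_comp_nondecreasing01 dpgf_le. Qed.

Lemma pgf_le a b : 0 <= a -> a <= b -> b <= 1 -> pgf a <= pgf b.
Proof.
move=> a0 ab b1; apply: size_mean_le.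
- by apply: lb_pow; rewrite a0 (le_trans ab).
- by apply: lb_pow; rewrite b1 (le_trans a0).
- by move=> k; rewrite lerXn2r// nnegrE// (le_trans a0).
Qed.

Lemma pgf1 : pgf 1 = 1.
Proof.
rewrite /pgf /E /Rintegral.
rewrite (eq_integral (cst 1%E)); last by move=> w _ /=; rewrite expr1n.
have H := integral_cst P measurableT 1%E; rewrite mul1e in H.
by rewrite (etrans H (probability_setT P)).
Qed.

Lemma measurable_pgf d' (T' : measurableType d') (f : T' -> R) :
  measurable_fun setT f -> (forall x, 0 <= f x <= 1) ->
  measurable_fun setT (fun x => pgf (f x)).
Proof. exact: measurable_comp_nondecreasing01 pgf_le. Qed.

End size_gf.

(** * Counting measure *)

Section counting_facts.
Context {R : realType} {T : pointedType}.
Implicit Types A B : set T.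
Local Notation cnt := (@counting T R).

(** Giving [T] the sigma-algebra generated by all subsets makes [counting] a measure for which every
    set is measurable. *)
Let all_measurable A : measurable (A : set (g_sigma_algebraType (@setT (set T)))).
Proof. exact: sub_sigma_algebra. Qed.

Lemma counting_ge0 A : (0 <= cnt A)%E.
Proof. by rewrite /counting; case: ifPn => // _; rewrite lee_fin. Qed.

Lemma counting0 : cnt set0 = 0%E.
Proof. by rewrite /counting asboolT// fset_set0. Qed.

Lemma le_counting A B : A `<=` B -> (cnt A <= cnt B)%E.
Proof.
move=> AB.
exact (@le_measure _ R (g_sigma_algebraType (@setT (set T)))
  (@counting (g_sigma_algebraType (@setT (set T))) R)
  A B (mem_set (all_measurable A)) (mem_set (all_measurable B)) AB).
Qed.

Lemma counting_bigcup (F : nat -> set T) : trivIset setT F ->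
  cnt (\bigcup_k F k) = (\sum_(0 <= k <oo) cnt (F k))%E.
Proof.
move=> tF; transitivity (\sum_(0 <= k <oo | k \in [set: nat]) cnt (F k))%E; last first.
  by apply: eq_eseriesl => k; rewrite in_setT.
exact (@measure_bigcup _ R (g_sigma_algebraType (@setT (set T)))
  (@counting (g_sigma_algebraType (@setT (set T))) R) setT F (fun i _ => all_measurable (F i)) tF).
Qed.

Lemma counting_setD A B : finite_set A ->
  cnt (A `\` B) = (cnt A - cnt (A `&` B))%E.
Proof.
move=> fA.
have := @measureD _ (g_sigma_algebraType (@setT (set T))) R
  (@counting (g_sigma_algebraType (@setT (set T))) R) A B (all_measurable A) (all_measurable B).
apply.
have cA : (cnt A < +oo)%E by rewrite /counting asboolT// ltry.
exact cA.
Qed.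

Lemma counting_fin A : finite_set A -> cnt A = (#|` fset_set A|%:R)%:E.
Proof. by move=> fA; rewrite /counting asboolT. Qed.

Lemma counting_eq0 A : cnt A = 0%E <-> A = set0.
Proof.
split=> [|->]; last exact: counting0.
rewrite /counting; case: ifPn => [/asboolP fA [/eqP]|//].
by rewrite pnatr_eq0 cardfs_eq0 => /eqP /fset_set_set0; exact.
Qed.

Lemma counting_set1 x : cnt [set x] = 1%E.
Proof. by rewrite counting_fin// fset_set1 cardfs1. Qed.

Lemma counting_ge1 A : (1 <= cnt A)%E <-> A !=set0.
Proof.
split=> [h|[x Ax]].
  apply/set0P/negP => /eqP A0; move: h; rewrite A0 counting0.
  by rewrite lee_fin ler10.
by rewrite -(counting_set1 x); apply: le_counting => y ->.
Qed.

Lemma counting_set2 x y : x <> y -> cnt [set x; y] = 2%:R%:E.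
Proof.
move=> /eqP xy; rewrite counting_fin ?finite_setU// fset_setU// !fset_set1 cardfs2.
by rewrite xy.
Qed.

Lemma counting_ge2 A x y : A x -> A y -> x <> y -> (2%:R%:E <= cnt A)%E.
Proof.
move=> Ax Ay xy; rewrite -(counting_set2 xy); apply: le_counting => z [->|->]//.
Qed.

Lemma counting_eq1 A x : A x -> (cnt A < 2%:R%:E)%E -> A = [set x].
Proof.
move=> Ax A2; apply/seteqP; split => [y Ay|y ->//].
apply: contrapT => /= xy; move: A2; rewrite ltNge => /negP; apply.
exact: counting_ge2 Ay Ax xy.
Qed.
End counting_facts.

Section joint_count.
Context {R : realType} {n : nat} {d : measure_display} {T : measurableType d}.
Variable L : T -> set 'rV[R]_n.
Hypothesis finL : forall w, finite_set (L w).
Hypothesis mL : forall A, borel A -> measurable_fun setT (fun w => count_in A (L w)).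

(** Dynkin induction from rectangles, where the count is an indicator times a count in a fixed set.
    Complements subtract counts, hence the finiteness of [L]. *)
Lemma measurable_joint_count d' (X : measurableType d') (U : set (X * borelType R n)) :
  measurable U ->
  measurable_fun setT (fun p : X * T =>
    @counting _ R (L p.2 `&` [set l | U (p.1, l)])).
Proof.
move=> mU.
have msnd (f : T -> \bar R) : measurable_fun setT f ->
    measurable_fun setT (fun p : X * T => f p.2).
  by move=> mf; exact: (measurableT_comp mf measurable_snd).
pose Q (V : set (X * borelType R n)) := measurable_fun setT (fun p : X * T =>
    @counting _ R (L p.2 `&` [set l | V (p.1, l)])).
apply: (@dynkin_induction _ (X * borelType R n)%type
  [set A `*` B | A in measurable & B in measurable] Q) => //.
- exact: measurable_prod_measurableType.
- move=> _ _ [A mA [B mB <-]] [A' mA' [B' mB' <-]].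
  exists (A `&` A'); first exact: measurableI.
  exists (B `&` B'); first exact: measurableI.
  by rewrite setXI.
- rewrite /Q; under eq_fun do rewrite (_ : [set l | _] = setT)//.
  apply: (@msnd (fun w => @counting _ R (L w `&` setT))).
  by apply: mL; exact: (@measurableT _ (borelType R n)).
- move=> _ [A mA [B mB <-]]; rewrite /Q.
  rewrite (_ : (fun p => _) = (fun p : X * T => (\1_A p.1)%:E * count_in B (L p.2))%E).
    apply: emeasurable_funM; last by apply: (@msnd (fun w => count_in B (L w))); exact: mL.
    apply/measurable_EFinP; apply: (measurableT_comp _ measurable_fst).
    exact: measurable_indic.
  apply/funext => -[x w] /=; rewrite indicE; case: (boolP (x \in A)) => xA.
    rewrite mul1e /count_in; congr counting; apply/seteqP; split => l /= [Ll].
      by case.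
    by move=> Bl; split => //; split => //; exact: set_mem.
  rewrite mul0e; apply/counting_eq0/seteqP; split => // l /= [_ []].
  by move/mem_set; rewrite (negPf xA).
- move=> S mS QS; rewrite /Q.
  rewrite (_ : (fun p => _) = (fun p : X * T =>
      @counting _ R (L p.2 `&` setT) - @counting _ R (L p.2 `&` [set l | S (p.1, l)]))%E).
    apply: emeasurable_funB => //; apply: (@msnd (fun w => @counting _ R (L w `&` setT))).
    by apply: mL; exact: (@measurableT _ (borelType R n)).
  apply/funext => -[x w] /=; rewrite setIT -counting_setD//.
- move=> F mF tF QF; rewrite /Q.
  rewrite (_ : (fun p => _) = (fun p : X * T =>
      (\sum_(0 <= k <oo) @counting _ R (L p.2 `&` [set l | F k (p.1, l)]))%E)).
    apply: (@ge0_emeasurable_sum _ _ R setT (fun k (p : X * T) =>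
        @counting _ R (L p.2 `&` [set l | F k (p.1, l)])) xpredT) => [k p _ _|k _].
      exact: counting_ge0.
    exact: QF.
  apply/funext => -[x w] /=; rewrite -counting_bigcup; last first.
    apply/trivIsetP => i j _ _ ij; apply/seteqP; split => // l /= [[_ Fi] [_ Fj]].
    by move/trivIsetP: tF => /(_ i j Logic.I Logic.I ij)/seteqP[+ _] => /(_ (x, l)); apply.
  congr counting; apply/seteqP; split => l /=.
    by move=> [Ll [k _ Fk]]; exists k.
  by move=> [k _ [Ll Fk]]; split => //; exists k.
- by rewrite -measurable_prod_measurableType.
Qed.
End joint_count.

(** * Freezing one of two independent arguments *)

Section law.
Context {R : realType} {d d' : measure_display} {T : measurableType d} {T' : measurableType d'}.
Variables (P : probability T R) (f : T -> T').
Hypothesis mf : measurable_fun setT f.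

Definition law : set T' -> \bar R := image_measure P mf.
HB.instance Definition _ := Measure.on law.
Let law_setT : law setT = 1%E.
Proof. by rewrite /law/= /pushforward preimage_setT probability_setT. Qed.
HB.instance Definition _ := Measure_isProbability.Build _ _ _ law law_setT.

Lemma integral_law (g : T' -> \bar R) : measurable_fun setT g ->
  (forall x, 0 <= g x)%E -> (\int[law]_y g y = \int[P]_x g (f x))%E.
Proof. exact: ge0_integral_image_measure. Qed.
End law.

Section freezing.
Context {R : realType} {d d1 d2 : measure_display} {T : measurableType d}
  {T1 : measurableType d1} {T2 : measurableType d2}.
Variables (P : probability T R) (f1 : T -> T1) (f2 : T -> T2).
Hypothesis mf1 : measurable_fun setT f1.
Hypothesis mf2 : measurable_fun setT f2.
Hypothesis indep : forall A B, measurable A -> measurable B ->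
  P (f1 @^-1` A `&` f2 @^-1` B) = (P (f1 @^-1` A) * P (f2 @^-1` B))%E.

(** By uniqueness of product measures the joint law of [f1] and [f2] is the product of their laws;
    Tonelli then separates the two arguments. *)
Lemma freezing (phi : T1 * T2 -> \bar R) : measurable_fun setT phi ->
  (forall p, 0 <= phi p)%E ->
  (\int[P]_w phi (f1 w, f2 w) = \int[P]_w \int[P]_w' phi (f1 w, f2 w'))%E.
Proof.
move=> mphi phi0.
have mf : measurable_fun setT (fun w => (f1 w, f2 w)) by exact: measurable_fun_pair.
rewrite -(integral_law P mf mphi phi0).
transitivity (\int[law P mf1 \x law P mf2]_p phi p)%E.
  apply: eq_measure_integral => A mA _; apply/esym.
  apply: product_measure_unique => [B C mB mC|//].
  exact (indep mB mC).
rewrite fubini_tonelli1// /fubini_F integral_law//; last 2 first.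
- exact: measurable_fun_fubini_tonelli_F.
- by move=> x; apply: integral_ge0.
apply: eq_integral => w _; rewrite integral_law//.
by apply: (measurableT_comp mphi); exact: measurable_fun_pair.
Qed.
End freezing.

Section sub_sigma_algebra.
Context {d : measure_display} {O : measurableType d}.

Lemma sub_sigma_measurable (G : set (set O)) : G `<=` measurable -> <<s G >> `<=` measurable.
Proof.
apply: smallest_sub.
by split; [exact: measurable0|move=> ? ?; exact: measurableD|move=> ? ?; exact: bigcupT_measurable].
Qed.

(** A sub-sigma-algebra is represented as another measurable type on the same points; through the
    identity map, [freezing] applies to sigma-algebras as well as to random elements. *)
Lemma measurable_id_sub (G : set (set O)) : G `<=` measurable ->
  measurable_fun setT (id : O -> g_sigma_algebraType G).
Proof.
move=> mG _ C mC; rewrite setTI preimage_id.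
exact: (sub_sigma_measurable mG).
Qed.

End sub_sigma_algebra.

Section mutual_independence.
Context {R : realType} {d : measure_display} {O : measurableType d} (P : probability O R).
Variables (I : choiceType) (F : I -> set (set O)).
Hypothesis FI : mutually_independent P F.
Hypothesis mF : forall i, F i `<=` measurable.
Hypothesis FT : forall i, F i setT.
Hypothesis Fcap : forall i, setI_closed (F i).

(** A pi-system generating the joint sigma-algebra of the indices in [J]. *)
Definition joint_system (J : {fset I}) : set (set O) :=
  [set A | exists2 E : I -> set O, (forall i, F i (E i)) & A = \bigcap_(i in [set` J]) E i].

Lemma joint_system_setI J : setI_closed (joint_system J).
Proof.
move=> _ _ [E FE ->] [E' FE' ->]; exists (fun i => E i `&` E' i).
  by move=> i; exact: Fcap.
by rewrite bigcapI.
Qed.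

Lemma joint_system_setT J : joint_system J setT.
Proof. by exists (fun=> setT) => //; rewrite bigcapT. Qed.

Lemma joint_system_sub J i : i \in J -> F i `<=` joint_system J.
Proof.
move=> iJ A FA; exists (fun k => if k == i then A else setT).
  by move=> k; case: eqP => [->|].
apply/seteqP; split => [x Ax k /= kJ|x].
  by case: eqP.
by move=> /(_ i iJ); rewrite eqxx.
Qed.

Lemma joint_system_measurable J : joint_system J `<=` measurable.
Proof.
move=> _ [E FE ->]; apply: fin_bigcap_measurable => // i _.
exact/mF/FE.
Qed.

Let prob_joint J j A B : j \notin J -> joint_system J A -> F j B ->
  P (A `&` B) = (P A * P B)%E.
Proof.
move=> jJ [E FE ->] FB.
pose E' i := if i == j then B else E i.
have E'E i : i \in J -> E' i = E i.
  by rewrite /E'; case: eqP => // ->; rewrite (negPf jJ).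
have FE' i : F i (E' i) by rewrite /E'; case: eqP => [->|].
have -> : \bigcap_(i in [set` J]) E i `&` B = \bigcap_(i in [set` (j |` J)%fset]) E' i.
  rewrite set_fsetU1 bigcap_setU1 {1}/E' eqxx setIC; congr (_ `&` _).
  by apply: eq_bigcapr => i /= iJ; rewrite E'E.
rewrite FI; last by move=> i _; exact: FE'.
rewrite big_fsetU1//= {1}/E' eqxx muleC; congr (_ * _)%E.
rewrite FI; last by move=> i _; exact: FE.
by apply: eq_big_seq => i iJ; rewrite E'E.
Qed.

(** Pi-lambda argument: for fixed B, the intersection with B and the multiplication by P(B) define
    two finite measures that agree on the pi-system [G]. *)
Let indep_ext (G H : set (set O)) : G `<=` measurable -> H `<=` measurable ->
  setI_closed G -> G setT ->
  (forall A B, G A -> H B -> P (A `&` B) = P A * P B)%E ->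
  forall A B, <<s G >> A -> H B -> P (A `&` B) = (P A * P B)%E.
Proof.
move=> mG mH Gcap GT GH A B sA HB.
have mid := measurable_id_sub mG.
have mB := mH _ HB.
pose m1 := image_measure (mrestr P mB) mid.
have PB0 : 0 <= fine (P B) by exact: fine_ge0.
pose m2 := mscale (NngNum PB0) (image_measure P mid).
have m2E C : m2 C = (P C * P B)%E.
  transitivity ((fine (P B))%:E * P C)%E; first by [].
  by rewrite [(fine _)%:E]fineK ?fin_num_measure// muleC.
have := @measure_unique _ R (g_sigma_algebraType G) G (fun=> setT) erefl Gcap (fun=> GT) _ m1 m2.
move=> /(_ _ _ _ A sA) H'.
have -> : P (A `&` B) = m1 A by [].
rewrite H'.
- exact: m2E.
- by rewrite bigcup_const//; exists 0%N.
- move=> C GC.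
  apply: (etrans (GH C B GC HB)); apply/esym; exact: m2E.
- move=> _; rewrite [X in (X < _)%E](_ : _ = P (setT `&` B))//.
  by rewrite (le_lt_trans (probability_le1 _ _)) ?ltry// setTI.
Qed.

(** Two applications of [indep_ext], one for each factor. *)
Lemma mutually_independent_split J j A B : j \notin J ->
  <<s joint_system J >> A -> <<s F j >> B -> P (A `&` B) = (P A * P B)%E.
Proof.
move=> jJ sA sB; rewrite setIC muleC.
have sJm := sub_sigma_measurable (@joint_system_measurable J).
have X := indep_ext (@mF j) sJm (@Fcap j) (FT j).
refine (X _ _ _ sB sA) => C D FC sD.
rewrite setIC muleC.
refine (indep_ext (@joint_system_measurable J) (@mF j) (@joint_system_setI J) (joint_system_setT J) _ sD FC).
by move=> ? ? ? ?; exact: prob_joint jJ _ _.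
Qed.

Lemma mutually_independent_freezing J j
  (phi : g_sigma_algebraType (joint_system J) * g_sigma_algebraType (F j) -> \bar R) :
  j \notin J -> measurable_fun setT phi -> (forall p, 0 <= phi p)%E ->
  (\int[P]_w phi (w, w) = \int[P]_w \int[P]_w' phi (w, w'))%E.
Proof.
move=> jJ mphi phi0.
refine (freezing (measurable_id_sub (@joint_system_measurable J))
  (measurable_id_sub (@mF j)) _ mphi phi0) => A B mA mB.
rewrite !preimage_id; exact: mutually_independent_split jJ _ _.
Qed.
End mutual_independence.

(** * Void probabilities of finitely many clusters *)

Lemma measurable_fun_finer {d' : measure_display} {T : pointedType} {T' : measurableType d'}
    (G H : set (set T)) (f : T -> T') : G `<=` <<s H >> ->
  measurable_fun (setT : set (g_sigma_algebraType G)) (f : g_sigma_algebraType G -> T') ->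
  measurable_fun (setT : set (g_sigma_algebraType H)) (f : g_sigma_algebraType H -> T').
Proof.
move=> GH mf _ Y mY.
have GHs : <<s G >> `<=` <<s H >> by apply: smallest_sub => //; exact: smallest_sigma_algebra.
exact (GHs _ (mf measurableT Y mY)).
Qed.

Section product_expectation.
Context {R : realType} {d : measure_display} {O : measurableType d} (P : probability O R).
Variables (I : choiceType) (F : I -> set (set O)).
Hypothesis FI : mutually_independent P F.
Hypothesis mF : forall i, F i `<=` measurable.
Hypothesis FT : forall i, F i setT.
Hypothesis Fcap : forall i, setI_closed (F i).

(** Induction on the list: freezing pulls out the head factor, since the others depend only on the
    events of the remaining indices. *)
Lemma expectation_prod (s : seq I) (g : I -> O -> R) : uniq s ->
  (forall i, measurable_fun (setT : set (g_sigma_algebraType (F i)))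
     (g i : g_sigma_algebraType (F i) -> R)) ->
  (forall i w, 0 <= g i w) ->
  (\int[P]_w (\prod_(i <- s) g i w)%:E = \prod_(i <- s) \int[P]_w (g i w)%:E)%E.
Proof.
move=> us mg g0.
have mgO i : measurable_fun setT (g i).
  by apply: (measurableT_comp (mg i)); exact: (measurable_id_sub (@mF i)).
elim: s us => [_|j s IH /= /andP[js us]].
  rewrite big_nil; under eq_integral do rewrite big_nil.
  by rewrite integral_cst// mul1e; exact: probability_setT.
rewrite big_cons -IH//.
pose J := [fset i in s]%fset.
have jJ : j \notin J by rewrite inE.
pose phi (p : g_sigma_algebraType (joint_system F J) * g_sigma_algebraType (F j)) :=
  (g j p.2 * \prod_(i <- s) g i p.1)%:E.
have mphi : measurable_fun setT phi.
  apply/measurable_EFinP; apply: measurable_funM.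
    exact: (measurableT_comp (mg j) measurable_snd).
  rewrite (_ : (fun p => _) = (fun w => \prod_(i <- s) g i w) \o fst)//.
  apply: (measurableT_comp _ measurable_fst).
  rewrite (_ : (fun w => _) = (fun w => \prod_(i <- s) (if i \in J then g i w else 1))); last first.
    by apply/funext => w; apply: eq_big_seq => i si; rewrite inE si.
  apply: measurable_prod => i _.
  have [iJ|iJ] := boolP (i \in J); last exact: measurable_cst.
  apply: (measurable_fun_finer _ (mg i)) => A FA.
  apply: sub_sigma_algebra; exact: joint_system_sub FA.
have := mutually_independent_freezing FI mF FT Fcap jJ mphi.
rewrite /phi /= => H.
under eq_integral do rewrite big_cons.
rewrite H; last first.
  by move=> p; rewrite lee_fin mulr_ge0// prodr_ge0.
rewrite -ge0_integralZl//; last 3 first.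
- by apply/measurable_EFinP; exact: measurable_prod.
- by move=> w _; rewrite lee_fin prodr_ge0.
- by apply: integral_ge0 => w _; rewrite lee_fin.
apply: eq_integral => w _.
rewrite -ge0_integralZr//.
- by apply/measurable_EFinP; exact: mgO.
- by move=> w' _; rewrite lee_fin.
- by rewrite lee_fin prodr_ge0.
Qed.
End product_expectation.

Section cluster_freezing.
Context {R : realType} {n : nat}.
Context {d d1 : measure_display} {O : measurableType d} {O1 : measurableType d1}.
Variables (P : probability O R) (P1 : probability O1 R).
Variables (Ltyp : O1 -> set 'rV[R]_n) (X : nat -> O -> 'rV[R]_n) (L : nat -> O -> set 'rV[R]_n).
Hypothesis mX : forall k, measurable_fun setT (X k : O -> borelType R n).
Hypothesis HL : forall k, finite_point_process (L k) /\
  forall S, configuration_sigma S -> P (L k @^-1` S) = P1 (Ltyp @^-1` S).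
Let F (i : option nat) : set (set O) :=
  if i is Some k then preimage_set_system setT (L k) configuration_sigma
  else generated_sigma X.
Hypothesis FI : mutually_independent P F.
Variable U : set (borelType R n * borelType R n).
Hypothesis mU : measurable U.

(** [U] relates a cluster centre to the displacements that its points must avoid; the intended
    instance is the relation [A (x + l)]. *)
Definition translate_section (x : 'rV[R]_n) : set 'rV[R]_n := [set l | U (x, l)].
Lemma borel_translate_section x : borel (translate_section x).
Proof.
have := @measurable_xsection _ _ _ _ U x mU.
rewrite (_ : xsection U x = translate_section x)//.
by apply/seteqP; split => l; rewrite /xsection/= inE.
Qed.

Definition void_event x (A : set 'rV[R]_n) : Prop := A `&` translate_section x = set0.
Definition cluster_void_prob (x : 'rV[R]_n) : \bar R :=
  P1 [set w | Ltyp w `&` translate_section x = set0].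

(** Counts of a finite configuration are natural numbers, so every count event is a countable union
    of the generating events. *)
Lemma count_borel_preimage k A : borel A -> forall Y : set (\bar R), measurable Y ->
  <<s F (Some k) >> ((fun w => count_in A (L k w)) @^-1` Y).
Proof.
move=> bA Y mY.
have fL w : finite_set (L k w `&` A) by apply: finite_setIl; case: (HL k) => -[_ +] _; exact.
rewrite (_ : _ @^-1` Y = \bigcup_(j in [set j : nat | Y j%:R%:E])
   (setT `&` L k @^-1` [set K | count_in A K = j%:R%:E])); last first.
  apply/seteqP; split => w /=.
    rewrite /count_in counting_fin// => Yw.
    by exists (#|` fset_set (L k w `&` A)|) => //; split => //; rewrite /= /count_in counting_fin.
  by move=> [j /= Yj [_ ->]].
apply: (@bigcup_measurable _ (g_sigma_algebraType (F (Some k)))) => j _.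
apply: sub_sigma_algebra; exists [set K | count_in A K = j%:R%:E] => //.
by apply: sub_sigma_algebra; exists A, j.
Qed.

Lemma config_measurable k S : configuration_sigma S -> measurable (L k @^-1` S).
Proof.
apply: (@smallest_sub _ _ _ (fun S => measurable (L k @^-1` S))).
  split=> [|A mA|A mA]; first by rewrite preimage_set0.
    by rewrite setTD preimage_setC; exact: measurableC.
  by rewrite preimage_bigcup; exact: bigcupT_measurable.
move=> _ [A [j [bA ->]]].
have [[[_ mL] _] _] := HL k.
by rewrite -[X in measurable X]setTI; apply: (mL A bA measurableT [set j%:R%:E]); exact: emeasurable_set1.
Qed.

Lemma cluster_system_measurable i : F i `<=` measurable.
Proof.
case: i => [k|] /=.
  by move=> _ [S cS <-]; rewrite setTI; exact: config_measurable.
apply: sub_sigma_measurable.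
by move=> _ [k _ [A bA <-]]; exact: (mX k measurableT bA).
Qed.

Lemma cluster_system_setT i : F i setT.
Proof.
case: i => [k|] /=; last exact: (@measurableT _ (g_sigma_algebraType (\bigcup_k preimage_set_system setT (X k) (@borel R n)))).
exists setT; last by rewrite setTI preimage_setT.
exact: (@measurableT _ (g_sigma_algebraType _)).
Qed.

Lemma cluster_system_setI i : setI_closed (F i).
Proof.
case: i => [k|] /=; last first.
  by move=> A B; exact: (@measurableI _ (g_sigma_algebraType (\bigcup_k preimage_set_system setT (X k) (@borel R n)))).
move=> _ _ [S cS <-] [S' cS' <-]; exists (S `&` S'); last by rewrite !setTI preimage_setI.
exact: (@measurableI _ (g_sigma_algebraType _)).
Qed.

Let one0 (c : \bar R) : R := \1_[set 0%E] c.

Let measurable_one0 : measurable_fun setT one0.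
Proof. by apply: measurable_indic; exact: emeasurable_set1. Qed.

(** The centre is read at [w] and the cluster at [w'], so that independence can act on the two
    arguments separately. *)
Let miss k (w w' : O) : R := one0 (@counting _ R (L k w' `&` translate_section (X k w))).

Let missE k w w' : miss k w w' = \1_[set w' | L k w' `&` translate_section (X k w) = set0] w'.
Proof.
rewrite /miss /one0 !indicE; congr (_ : bool)%:R.
by apply/idP/idP; rewrite !inE/= => /counting_eq0.
Qed.

Let measurable_miss k (H : set (set O)) :
  (forall A, borel A -> <<s H >> (X k @^-1` A)) ->
  measurable_fun (setT : set (g_sigma_algebraType H * g_sigma_algebraType (F (Some k))))
   (fun p => miss k p.1 p.2).
Proof.
move=> mXH; apply: (measurableT_comp measurable_one0).
pose U' : set (g_sigma_algebraType H * borelType R n) := [set p | U (X k p.1, p.2)].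
have mU' : measurable U'.
  have mf : measurable_fun setT (fun p : g_sigma_algebraType H * borelType R n =>
      (X k p.1 : borelType R n, p.2)).
    apply: measurable_fun_pair; last exact: measurable_snd.
    apply: (measurableT_comp _ measurable_fst) => _ A mA.
    by rewrite setTI; exact: mXH.
  have := mf measurableT U mU.
  by rewrite setTI.
have fL w : finite_set (L k w) by case: (HL k) => -[_ +] _; exact.
apply: (@measurable_joint_count R n _ (g_sigma_algebraType (F (Some k))) (L k) fL _
  _ (g_sigma_algebraType H) U' mU').
by move=> A bA _ Y mY; rewrite setTI; exact: count_borel_preimage.
Qed.

Let measurable_X_generated k A : borel A -> generated_sigma X (X k @^-1` A).
Proof.
move=> bA; apply: sub_sigma_algebra; exists k => //; exists A => //.
by rewrite setTI.
Qed.

Let missP k x : (\int[P]_w' (one0 (@counting _ R (L k w' `&` translate_section x)))%:E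
  = cluster_void_prob x)%E.
Proof.
have bU := borel_translate_section x.
have cS : configuration_sigma [set K | K `&` translate_section x = set0].
  apply: sub_sigma_algebra; exists (translate_section x), 0%N; split => //.
  by apply/seteqP; split => K /=; rewrite /count_in => /(@counting_eq0 R).
have [_ /(_ _ cS) H] := HL k.
rewrite /cluster_void_prob -[RHS]H.
rewrite -[in RHS](setIT (L k @^-1` _)) -integral_indic//; last exact: config_measurable.
apply: eq_integral => w _; congr EFin; rewrite /one0 !indicE; congr (_ : bool)%:R.
by apply/idP/idP; rewrite !inE/= => /counting_eq0.
Qed.

Lemma cluster_void_prob_ge0 x : (0 <= cluster_void_prob x)%E.
Proof. by rewrite -(missP 0); apply: integral_ge0 => w _; rewrite lee_fin /one0 indicE. Qed.

Let measurable_one0_count k x :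
  measurable_fun setT (fun w' => one0 (@counting _ R (L k w' `&` translate_section x))).
Proof.
have fL w : finite_set (L k w) by case: (HL k) => -[_ +] _; exact.
apply: (measurableT_comp measurable_one0).
have bU := borel_translate_section x.
have [[[_ mL] _] _] := HL k.
exact: mL.
Qed.

Lemma cluster_void_prob_le1 x : (cluster_void_prob x <= 1)%E.
Proof.
rewrite -(missP 0); apply: (@le_trans _ _ (\int[P]_w cst 1 w)%E).
  by apply: ge0_le_integralT => w; rewrite lee_fin /one0 indicE// lern1 leq_b1.
by rewrite integral_cst// mul1e; apply: probability_le1.
Qed.

Lemma cluster_void_prob_fin x : cluster_void_prob x \is a fin_num.
Proof.
rewrite ge0_fin_numE ?cluster_void_prob_ge0//.
by rewrite (le_lt_trans (cluster_void_prob_le1 x))// ltry.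
Qed.

Lemma measurable_cluster_void_prob :
  measurable_fun setT (cluster_void_prob : borelType R n -> \bar R).
Proof.
have [[[_ mL] fL] _] := HL 0.
rewrite (_ : (cluster_void_prob : borelType R n -> \bar R) =
  fubini_F P (fun p : borelType R n * O => (one0 (@counting _ R (L 0 p.2 `&` translate_section p.1)))%:E)).
  apply: measurable_fun_fubini_tonelli_F; last by move=> p; rewrite lee_fin /one0 indicE.
  apply/measurable_EFinP; apply: (measurableT_comp measurable_one0).
  exact: (measurable_joint_count fL mL mU).
by apply/funext => x; rewrite -(missP 0).
Qed.

Let pv (x : borelType R n) : R := fine (cluster_void_prob x).

Let pv_ge0 x : 0 <= pv x.
Proof. by rewrite fine_ge0// cluster_void_prob_ge0. Qed.

Let measurable_pv : measurable_fun setT pv.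
Proof. exact: (measurableT_comp (@fine_measurable R setT measurableT) measurable_cluster_void_prob). Qed.

(* The clusters are integrated out one at a time, starting from the last one;
   [psi] collects the factors of those already integrated out. *)
Let cluster_freezing_gen m (psi : g_sigma_algebraType (generated_sigma X) -> R) :
  measurable_fun setT psi -> (forall w, 0 <= psi w) ->
  (\int[P]_w (psi w * \prod_(k < m) miss k w w)%:E =
   \int[P]_w (psi w * \prod_(k < m) pv (X k w))%:E)%E.
Proof.
elim: m psi => [|m IH] psi mpsi psi0.
  by apply: eq_integral => w _; rewrite !big_ord0.
(* [None] stands for the centres and [Some k] for the k-th cluster: all that [psi] and the first m
   factors depend on. *)
pose J := [fset i in None :: [seq Some k | k <- iota 0 m]]%fset.
have JS k : (Some k \in J) = (k < m)%N.
  by rewrite !inE/= mem_map ?mem_iota//; move=> ? ? [].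
have jJ : Some m \notin J by rewrite JS ltnn.
have JN : None \in J by rewrite !inE.
have XJ k A : borel A -> <<s joint_system F J >> (X k @^-1` A).
  move=> bA; apply: sub_sigma_algebra; apply: (joint_system_sub cluster_system_setT JN).
  exact: measurable_X_generated.
pose phi (p : g_sigma_algebraType (joint_system F J) * g_sigma_algebraType (F (Some m))) :=
  ((psi p.1 * \prod_(k < m) miss k p.1 p.1) * miss m p.1 p.2)%:E.
have miss0 k w w' : 0 <= miss k w w' by rewrite /miss /one0 indicE.
have mphi1 : measurable_fun (setT : set (g_sigma_algebraType (joint_system F J)))
    (fun w => psi w * \prod_(k < m) miss k w w).
  apply: measurable_funM.
    apply: (measurable_fun_finer _ mpsi) => A GA; apply: sub_sigma_algebra.
    exact: (joint_system_sub cluster_system_setT JN).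
  apply: measurable_prod => k _.
  have Jk : Some (nat_of_ord k) \in J by rewrite JS.
  pose dia (w : g_sigma_algebraType (joint_system F J)) :
    g_sigma_algebraType (joint_system F J) * g_sigma_algebraType (F (Some (nat_of_ord k))) := (w, w).
  have mdia : measurable_fun setT dia.
    apply: measurable_fun_pair; first exact: measurable_id.
    move=> _ A mA; rewrite setTI preimage_id.
    move: mA; apply: sub_sigma_algebra2.
    exact: (joint_system_sub cluster_system_setT Jk).
  exact: (measurableT_comp (@measurable_miss k (joint_system F J) (XJ k)) mdia).
have mphi : measurable_fun setT phi.
  apply/measurable_EFinP; apply: measurable_funM; last exact (@measurable_miss m (joint_system F J) (XJ m)).
  exact: (measurableT_comp mphi1 measurable_fst).
have := mutually_independent_freezing FI cluster_system_measurable cluster_system_setT cluster_system_setI jJ mphi.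
rewrite /phi/= => H.
transitivity (\int[P]_w ((psi w * \prod_(k < m) miss k w w) * miss m w w)%:E)%E.
  by apply: eq_integral => w _; rewrite big_ord_recr/= mulrA.
rewrite H; last by move=> p; rewrite lee_fin !mulr_ge0// prodr_ge0.
transitivity (\int[P]_w ((psi w * pv (X m w)) * \prod_(k < m) miss k w w)%:E)%E.
  apply: eq_integral => w _.
  under eq_integral do rewrite EFinM.
  rewrite ge0_integralZl//; last 3 first.
  - by apply/measurable_EFinP; exact: measurable_one0_count.
  - by move=> w' _; rewrite lee_fin.
  - by rewrite lee_fin mulr_ge0// prodr_ge0.
  rewrite missP -[X in (_ * X)%E]fineK ?cluster_void_prob_fin// -EFinM.
  by congr EFin; rewrite mulrAC.
rewrite (IH (fun w => psi w * pv (X m w))).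
- by apply: eq_integral => w _; rewrite big_ord_recr/= [in RHS](mulrC (\prod_(i < m) _)) mulrA.
- apply: measurable_funM => //.
  apply: (measurableT_comp measurable_pv) => _ A mA; rewrite setTI.
  apply: sub_sigma_algebra; exact: measurable_X_generated.
- by move=> w; rewrite mulr_ge0.
Qed.

Lemma measurable_cluster_miss k :
  measurable [set w | void_event (X k w) (L k w)].
Proof.
have [[[_ mL] fL] _] := HL k.
have mcount : measurable_fun setT (fun w => @counting _ R (L k w `&` translate_section (X k w))).
  have := measurable_joint_count fL mL mU => mj.
  exact: (measurableT_comp mj (measurable_fun_pair (mX k) (@measurable_id _ O setT))).
rewrite (_ : [set w | _] = (fun w => @counting _ R (L k w `&` translate_section (X k w))) @^-1` [set 0%E]).
  by rewrite -[X in measurable X]setTI; apply: mcount => //; exact: emeasurable_set1.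
by apply/seteqP; split => w /=; rewrite /void_event; move/counting_eq0.
Qed.

Lemma cluster_void_finite m :
  (P (\bigcap_(k in `I_m) [set w | void_event (X k w) (L k w)]) =
   \int[P]_w (\prod_(k < m) fine (cluster_void_prob (X k w)))%:E)%E.
Proof.
have := @cluster_freezing_gen m (cst 1) (measurable_cst _) (fun _ => ler01).
under [in RHS]eq_integral do rewrite mul1r.
move=> <-.
have mI : measurable (\bigcap_(k in `I_m) [set w | void_event (X k w) (L k w)]).
  by apply: fin_bigcap_measurable => [|k _]; [exact: finite_II|exact: measurable_cluster_miss].
rewrite -[X in P X]setIT -integral_indic//; apply: eq_integral => w _.
rewrite mul1r; congr EFin.
rewrite indicE; case: (boolP (_ \in _)) => [/set_mem h|/negP h].
  rewrite big1// => k _; rewrite missE indicE mem_set//.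
  exact: (h k (ltn_ord k)).
suff [k km hk] : exists2 k, (k < m)%N & ~ void_event (X k w) (L k w).
  rewrite (bigD1 (Ordinal km))//= missE indicE memNset ?mul0r//.
apply: contrapT => hn; apply: h; apply/mem_set => k /= km.
by apply: contrapT => hk; apply: hn; exists k.
Qed.
End cluster_freezing.

(** * Void probabilities of thinned Poisson processes *)

Definition finite_card {T : choiceType} (A : set T) : nat := #|` fset_set A|.

(** Only finitely many indices are sent into [A]; once all of them are below m the product no longer
    changes. *)
Lemma prod_enumeration {R : realType} {T : choiceType} (x : nat -> T) (A : set T) (s : R) :
  injective x -> finite_set (range x `&` A) ->
  \forall m \near \oo, \prod_(k < m) (if x k \in A then s else 1) =
     s ^+ finite_card (range x `&` A).
Proof.
move=> xinj fA.
pose S := [set k | A (x k)].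
have xS : range x `&` A = x @` S.
  apply/seteqP; split => [_ [[k _ <-] Ax]|_ [k Ak <-]]; first by exists k.
  by split => //; exists k.
have fS : finite_set S.
  rewrite (_ : S = x @^-1` (range x `&` A)).
    by apply: finite_preimage => // i j _ _; exact: xinj.
  by apply/seteqP; split => k /=; [move=> Ak; split => //; exists k|case].
have -> : finite_card (range x `&` A) = finite_card S.
  rewrite /finite_card xS fset_set_image// card_in_imfset//= => i j _ _; exact: xinj.
pose M := (\max_(i <- fset_set S) i).+1.
have SM k : S k -> (k < M)%N.
  move=> Sk; rewrite ltnS.
  have kS : k \in fset_set S by rewrite in_fset_set// inE.
  by rewrite (big_rem k)//= leq_maxl.
exists M => // m /= Mm.
transitivity (\prod_(k <- fset_set S) s); last first.
  by rewrite big_const_seq count_predT /finite_card iter_mulr_1.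
rewrite -(big_mkord xpredT (fun k => if x k \in A then s else 1)).
rewrite -big_mkcond/= -big_filter; apply: perm_big.
apply: uniq_perm; [exact/filter_uniq/iota_uniq|exact: fset_uniq|move=> k].
rewrite mem_filter mem_index_iota/= in_fset_set//.
apply/andP/idP => [[]|/set_mem Sk]; first by rewrite !inE.
by split; [rewrite inE|rewrite (leq_trans (SM _ Sk))].
Qed.

Section poisson_functional.
Context {R : realType} {n : nat} {d : measure_display} {O : measurableType d}.
Variables (P : probability O R) (lambda : R) (Pi : O -> set 'rV[R]_n) (X : nat -> O -> 'rV[R]_n).
Variable mu : {sigma_finite_measure set (borelType R n) -> \bar R}.
Hypothesis muE : forall A, borel A -> mu A = lebesgue_rV A.
Hypothesis mu_box : forall k : R, (mu (centered_box k) < +oo)%E.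
Hypothesis lambda0 : 0 < lambda.
Hypothesis HPi : stationary_poisson P lambda Pi.
Hypothesis mX : forall k, measurable_fun setT (X k : O -> borelType R n).
Hypothesis HX : {ae P, forall w, injective (X ^~ w) /\ Pi w = range (X ^~ w)}.

Lemma bounded_centered_box (A : set 'rV[R]_n) (k : R) : A `<=` centered_box k -> bounded_set A.
Proof.
move=> Ak; exists `|k|; split => // M kM v /= /Ak vk.
rewrite [leLHS]/Num.norm/= mx_normrE; apply/bigmax_leP; split => [|[i j] _ /=].
  by rewrite (le_trans (normr_ge0 k))// ltW.
by rewrite (ord1 i) (le_trans (vk j))// (le_trans (ler_norm k))// ltW.
Qed.

Lemma finite_poisson_box A (k : R) w : A `<=` centered_box k -> finite_set (Pi w `&` A).
Proof. by move=> Ak; have [[+ _] _ _] := HPi; apply; exact: bounded_centered_box Ak. Qed.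

(** The power as a function of the extended real count, because independence of the Poisson process
    is stated for the sigma-algebras of its counts. *)
Let gpow (s : R) (y : \bar R) : R := s ^+ Num.truncn (fine y).

Let gpowE s A k w : A `<=` centered_box k ->
  gpow s (count_in A (Pi w)) = s ^+ finite_card (Pi w `&` A).
Proof.
move=> Ak; rewrite /gpow /count_in counting_fin; last exact: finite_poisson_box Ak.
by rewrite /= natrK.
Qed.

Let measurable_gpow s : 0 <= s <= 1 -> measurable_fun setT (gpow s).
Proof.
move=> /andP[s0 s1].
pose h (r : R) : R := s ^+ Num.truncn r.
have mh : measurable_fun setT h.
  apply: nonincreasing_measurable => // x y xy.
  by apply: ler_wiXn2l => //; exact: le_truncn.
exact: (measurableT_comp mh (@fine_measurable R setT measurableT)).
Qed.

(** Generating function of a Poisson variable with mean m: the terms exp(- m) (s m)^j / j! sum to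
    exp(- (1 - s) m). *)
Lemma poisson_void_power A k s : borel A -> A `<=` centered_box k -> 0 <= s <= 1 ->
  (\int[P]_w (s ^+ finite_card (Pi w `&` A))%:E =
   (expR (- (lambda * ((1 - s) * fine (mu A)))))%:E)%E.
Proof.
move=> bA Ak s01; have /andP[s0 s1] := s01.
have [[_ mcnt] Hcnt _] := HPi.
have muA : (mu A < +oo)%E.
  apply: (le_lt_trans _ (mu_box k)); apply: le_measure; rewrite ?inE//.
  exact: (@measurable_centered_box R n k).
pose F j := [set w | count_in A (Pi w) = j%:R%:E].
have mF j : measurable (F j).
  rewrite -[X in measurable X]setTI.
  by apply: (mcnt A bA measurableT [set j%:R%:E]); exact: emeasurable_set1.
have FT : \bigcup_j F j = setT.
  apply/seteqP; split => // w _; exists (finite_card (Pi w `&` A)) => //=.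
  by rewrite /F/= /count_in counting_fin//; exact: finite_poisson_box Ak.
have mg : measurable_fun setT (fun w => gpow s (count_in A (Pi w))).
  exact: (measurableT_comp (measurable_gpow s01) (mcnt A bA)).
rewrite (eq_integral (fun w => (gpow s (count_in A (Pi w)))%:E)); last first.
  by move=> w _; rewrite (gpowE _ _ Ak).
rewrite -FT ge0_integral_bigcup//; last 3 first.
- by rewrite FT; apply/measurable_EFinP.
- by move=> w _; rewrite lee_fin exprn_ge0.
- apply/trivIsetP => i j _ _ ij; apply/seteqP; split => // w /= [].
  rewrite /F/= => -> [] /eqP; rewrite eqr_nat => /eqP ji.
  by move: ij; rewrite ji eqxx.
set m := lambda * fine (mu A).
transitivity (\sum_(0 <= j <oo) (expR (- m) * exp_coeff (s * m) j)%:E)%E.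
  apply: eq_eseriesr => j _.
  rewrite (eq_integral (fun=> (s ^+ j)%:E)); last first.
    by move=> w; rewrite inE /F/= => Hw; rewrite /gpow Hw/= natrK.
  rewrite integral_cst//.
  have := Hcnt A bA; rewrite -muE// => /(_ muA j) /= Hj.
  rewrite [P _]Hj -EFinM; congr EFin.
  have -> : lambda * fine (mu A) = m by [].
  rewrite /exp_coeff/= (exprMn _ s).
  move: (expR (- m)) (j`!%:R^-1 : R) (m ^+ j) (s ^+ j) => x1 x2 x3 x4; ring.
have m0 : 0 <= m by rewrite mulr_ge0 ?fine_ge0 ?(ltW lambda0).
rewrite (eq_eseriesr (fun j _ => EFinM _ _)) nneseriesZl; last first.
  by move=> j _; rewrite lee_fin exp_coeff_ge0// mulr_ge0.
transitivity ((expR (- m))%:E * (expR (s * m))%:E)%E.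
  congr (_ * _)%E; rewrite /expR -EFin_lim; last exact: is_cvg_series_exp_coeff.
  by apply/congr_lim/funext => j; rewrite /= /series/= -sumEFin.
by rewrite -EFinM -expRD; congr (expR _)%:E; rewrite /m; ring.
Qed.

Lemma poisson_void_power_prod r (A : 'I_r -> set 'rV[R]_n) k (s : 'I_r -> R) :
  (forall i, borel (A i)) -> trivIset setT A -> (forall i, A i `<=` centered_box k) ->
  (forall i, 0 <= s i <= 1) ->
  (\int[P]_w (\prod_(i < r) s i ^+ finite_card (Pi w `&` A i))%:E =
   (expR (- (lambda * \sum_(i < r) (1 - s i) * fine (mu (A i)))))%:E)%E.
Proof.
move=> bA tA Ak s01; have [[_ mcnt] _ Hind] := HPi.
pose F i := preimage_set_system setT (fun w => count_in (A i) (Pi w)) measurable.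
have mF i : F i `<=` measurable.
  by move=> _ [Y mY <-]; exact: (mcnt (A i) (bA i) measurableT Y mY).
have FT i : F i setT by exists setT => //; rewrite setTI preimage_setT.
have Fcap i : setI_closed (F i).
  move=> _ _ [Y mY <-] [Y' mY' <-]; exists (Y `&` Y'); first exact: measurableI.
  by rewrite !setTI preimage_setI.
have FI : mutually_independent P F by exact: Hind.
have := @expectation_prod R d O P _ F FI mF FT Fcap (index_enum _)
  (fun i w => gpow (s i) (count_in (A i) (Pi w))) (index_enum_uniq _).
move=> H.
rewrite (eq_integral (fun w => (\prod_(i < r) gpow (s i) (count_in (A i) (Pi w)))%:E)); last first.
  by move=> w _; congr EFin; apply: eq_bigr => i _; rewrite (gpowE _ _ (@Ak i)).
rewrite H; last 2 first.
- move=> i; apply: (measurableT_comp (measurable_gpow (s01 i))).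
  move=> _ Y mY; apply: sub_sigma_algebra; exists Y => //.
- by move=> i w; rewrite exprn_ge0//; case/andP: (s01 i).
rewrite mulr_sumr -sumrN expR_sum -prodEFin; apply: eq_bigr => i _.
rewrite -(poisson_void_power (bA i) (@Ak i) (s01 i)).
by apply: eq_integral => w _; rewrite (gpowE _ _ (@Ak i)).
Qed.

Let mprod (q : borelType R n -> R) m : measurable_fun setT q ->
  measurable_fun setT (fun w => \prod_(k < m) (1 - q (X k w))).
Proof.
move=> mq; apply: measurable_prod => k _; apply: measurable_funB => //.
exact: (measurableT_comp mq).
Qed.

Let prod01 (q : borelType R n -> R) m w : (forall x, 0 <= q x <= 1) ->
  0 <= \prod_(k < m) (1 - q (X k w)) <= 1.
Proof.
move=> q01; rewrite prodr_ge0 => [|k _]; last by rewrite subr_ge0; case/andP: (q01 (X k w)).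
rewrite prodr_ile1// => k _; have /andP[q0 q1] := q01 (X k w).
by rewrite subr_ge0 q1 gerBl.
Qed.

(** Expected product over the first m Poisson points; its limit is the generating functional of the
    process at 1 - q. *)
Definition void_mean (q : borelType R n -> R) m : R :=
  \int[P]_w \prod_(k < m) (1 - q (X k w)).

Let void_meanE (q : borelType R n -> R) m : measurable_fun setT q -> (forall x, 0 <= q x <= 1) ->
  (void_mean q m)%:E = (\int[P]_w (\prod_(k < m) (1 - q (X k w)))%:E)%E.
Proof.
move=> mq q01; rewrite /void_mean /Rintegral fineK// ge0_fin_numE.
  apply: (@le_lt_trans _ _ (\int[P]_w cst 1 w)%E).
    by apply: ge0_le_integralT => w; rewrite lee_fin; case/andP: (prod01 m w q01).
  by rewrite integral_cst// mul1e; apply: (le_lt_trans (probability_le1 _ _)); rewrite ?ltry.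
by apply: integral_ge0 => w _; rewrite lee_fin; case/andP: (prod01 m w q01).
Qed.

Let cvg_dominated1 (f : nat -> O -> R) (g : O -> R) :
  (forall m, measurable_fun setT (f m)) -> measurable_fun setT g ->
  (forall m w, 0 <= f m w <= 1) ->
  {ae P, forall w, f m w @[m --> \oo] --> g w} ->
  (\int[P]_w (f m w)%:E)%E @[m --> \oo] --> (\int[P]_w (g w)%:E)%E.
Proof.
move=> mf mg f01 fg.
have := @dominated_convergence _ O R P setT measurableT (fun m w => (f m w)%:E) (fun w => (g w)%:E) (cst 1%E).
move=> [].
- by move=> m; apply/measurable_EFinP.
- by apply/measurable_EFinP.
- apply: filterS fg => w + _ => /= fgw.
  by apply: cvg_EFin => //; near=> m.
- exact: finite_measure_integrable_cst.
- apply: aeW => w m _ /=; rewrite lee_fin ger0_norm; by case/andP: (f01 m w).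
- by [].
Unshelve. all: by end_near. Qed.

(** The product over the points regroups into powers of [1 - c i] with the counts of the disjoint
    sets as exponents, and these are independent Poisson variables. *)
Let void_mean_simple r (A : 'I_r -> set 'rV[R]_n) k (c : 'I_r -> R) (q : borelType R n -> R) :
  (forall i, borel (A i)) -> trivIset setT A -> (forall i, A i `<=` centered_box k) ->
  (forall i, 0 <= c i <= 1) -> measurable_fun setT q -> (forall x, 0 <= q x <= 1) ->
  (forall x, 1 - q x = \prod_(i < r) (if x \in A i then 1 - c i else 1)) ->
  void_mean q m @[m --> \oo] --> expR (- (lambda * \sum_(i < r) c i * fine (mu (A i)))).
Proof.
move=> bA tA Ak c01 mq q01 qE.
have mG : measurable_fun setT (fun w => \prod_(i < r) (1 - c i) ^+ finite_card (Pi w `&` A i)).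
  apply: measurable_prod => i _.
  rewrite (_ : (fun w => _) = (fun w => gpow (1 - c i) (count_in (A i) (Pi w)))).
    have [[_ mcnt] _ _] := HPi.
    apply: (measurableT_comp (measurable_gpow _)); last exact: mcnt.
    by have /andP[c0 c1] := c01 i; rewrite subr_ge0 c1 gerBl.
  by apply/funext => w; rewrite (gpowE _ _ (@Ak i)).
have H : (\int[P]_w (\prod_(k < m) (1 - q (X k w)))%:E)%E @[m --> \oo] -->
    (\int[P]_w (\prod_(i < r) (1 - c i) ^+ finite_card (Pi w `&` A i))%:E)%E.
  apply: cvg_dominated1 => //; first by move=> m; exact: mprod.
    by move=> m w; exact: prod01.
  apply: filterS HX => w [Xinj PiX].
  have : \forall m \near \oo, forall i : 'I_r,
     \prod_(k < m) (if X k w \in A i then 1 - c i else 1) = (1 - c i) ^+ finite_card (Pi w `&` A i).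
    apply: filter_forall => i; rewrite PiX; apply: prod_enumeration => //.
    by rewrite -PiX; exact: finite_poisson_box (@Ak i).
  move=> Hn; apply: cvg_near_cst.
  apply: filterS Hn => m Hm.
  under eq_bigr do rewrite qE.
  by rewrite exchange_big/=; apply: eq_bigr => i _; exact: Hm.
have c01' i : 0 <= 1 - c i <= 1.
  by have /andP[c0 c1] := c01 i; rewrite subr_ge0 c1 gerBl.
rewrite (poisson_void_power_prod bA tA Ak c01') in H.
under eq_bigr do rewrite -{1}[c _](subKr 1).
exact: (fine_cvg H).
Qed.

Let void_mean_le (q q' : borelType R n -> R) m m' :
  measurable_fun setT q -> measurable_fun setT q' ->
  (forall x, 0 <= q x <= 1) -> (forall x, 0 <= q' x <= 1) ->
  (forall x, q x <= q' x) -> (m <= m')%N -> void_mean q' m' <= void_mean q m.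
Proof.
move=> mq mq' q01 q'01 qq' mm'; rewrite -lee_fin !void_meanE//.
apply: ge0_le_integralT => w.
  by rewrite lee_fin; case/andP: (prod01 m' w q'01).
rewrite lee_fin -(subnKC mm') big_split_ord/=.
rewrite (@le_trans _ _ (\prod_(k < m) (1 - q' (X k w))))//.
  rewrite ler_piMr//; first by case/andP: (prod01 m w q'01).
  apply: prodr_ile1 => k _; have /andP[q0 q1] := q'01 (X (m + k) w).
  by rewrite subr_ge0 q1 gerBl.
apply: ler_prod => k _; rewrite subr_ge0; have /andP[_ ->/=] := q'01 (X k w).
by rewrite lerB.
Qed.

(* The probability generating functional of the Poisson process. Simple functions
   [qj j <= q] of bounded support are handled by independence; letting [j] tend to
   infinity gives the lower bound for every [m], and [void_mean q <= void_mean (qj j)]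
   gives the upper one. *)
Lemma void_mean_cvg (q : borelType R n -> R) : measurable_fun setT q ->
  (forall x, 0 <= q x <= 1) -> (\int[mu]_x (q x)%:E < +oo)%E ->
  void_mean q m @[m --> \oo] --> expR (- (lambda * fine (\int[mu]_x (q x)%:E)%E)).
Proof.
move=> mq q01 qfin.
have q0 x : 0 <= q x by case/andP: (q01 x).
have mqE : measurable_fun setT (EFin \o q) by apply/measurable_EFinP.
have q0E x : [set: borelType R n] x -> (0 <= (EFin \o q) x)%E by move=> _ /=; rewrite lee_fin.
pose g j := nnsfun_approx measurableT mqE j.
(* Simple approximation cut off to a box, so that its level sets contain finitely many Poisson
   points. *)
pose qj j (x : borelType R n) : R := g j x * \1_(centered_box j%:R : set (borelType R n)) x.
have g0 j x : 0 <= g j x by [].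
have gq j x : g j x <= q x.
  rewrite -lee_fin; have := @le_approx _ _ _ setT (EFin \o q) j x q0E Logic.I.
  by rewrite /g nnsfun_approxE.
have gnd i j x : (i <= j)%N -> g i x <= g j x.
  move=> ij; have /lefP := @nd_nnsfun_approx _ _ _ _ measurableT _ mqE i j ij.
  exact.
have gcvg x : g j x @[j --> \oo] --> q x.
  have := @cvg_nnsfun_approx _ _ _ _ measurableT _ mqE q0E x Logic.I.
  by move/fine_cvg.
have ind0 j x : 0 <= (\1_(centered_box j%:R : set (borelType R n)) x : R) <= 1.
  by rewrite indicE ler0n lern1 leq_b1.
have qj0 j x : 0 <= qj j x by rewrite mulr_ge0//; case/andP: (ind0 j x).
have qjq j x : qj j x <= q x.
  by rewrite (le_trans _ (gq j x))// ler_piMr//; case/andP: (ind0 j x).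
have qj01 j x : 0 <= qj j x <= 1.
  by rewrite qj0 (le_trans (qjq j x))//; case/andP: (q01 x).
have mqj j : measurable_fun setT (qj j).
  apply: measurable_funM => //; apply: measurable_indic.
  exact: (@measurable_centered_box R n j%:R).
have qjnd i j x : (i <= j)%N -> qj i x <= qj j x.
  move=> ij; apply: ler_pM; [exact: g0|by case/andP: (ind0 i x)|exact: gnd|].
  rewrite !indicE; case: (boolP (x \in _)) => // /set_mem xi.
  rewrite mem_set// => l; rewrite (le_trans (xi l))// ler_nat//.
have qjcvg x : qj j x @[j --> \oo] --> q x.
  have [k _ kx] : (\bigcup_k centered_box k%:R : set 'rV[R]_n) x by rewrite centered_box_cover.
  apply: cvg_trans (gcvg x); apply: near_eq_cvg; near=> j.
  rewrite /qj indicE mem_set ?mulr1// => l.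
  by rewrite (le_trans (kx l))// ler_nat; near: j; exists k.
have Ifin j : (\int[mu]_x (qj j x)%:E <= \int[mu]_x (q x)%:E)%E.
  by apply: ge0_le_integralT => x; rewrite lee_fin.
have Ij j : void_mean (qj j) m @[m --> \oo] -->
    expR (- (lambda * fine (\int[mu]_x (qj j x)%:E)%E)).
  (* The finitely many values of [g j] index disjoint level sets inside the box. *)
  pose s : seq R := fset_set (range (g j)).
  have fr : finite_set (range (g j)) by exact: fimfunP.
  have sP y : y \in s = (y \in range (g j)) by rewrite /s in_fset_set.
  pose c (i : 'I_(size s)) : R := s`_i.
  pose A (i : 'I_(size s)) : set 'rV[R]_n := centered_box j%:R `&` (g j @^-1` [set c i]).
  have bA i : borel (A i).
    apply: borelI; first exact: measurable_centered_box.
    have mgj : measurable_fun (setT : set (borelType R n)) (g j : borelType R n -> R) by [].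
    by rewrite -[X in borel X]setTI; exact: (mgj measurableT [set c i] (measurable_set1 _)).
  have tA : trivIset setT A.
    apply/trivIsetP => i1 i2 _ _ i12; apply/seteqP; split => // x [[_ /= g1] [_ /= g2]].
    move/eqP: i12; apply; apply/val_inj/eqP.
    by rewrite -(@nth_uniq _ 0 s) ?fset_uniq//= -/(c i1) -/(c i2) -g1 -g2.
  have Ak i : A i `<=` centered_box j%:R by move=> x [].
  have c01 i : 0 <= c i <= 1.
    have : c i \in s by rewrite mem_nth.
    rewrite sP => /set_mem [x _ <-]; rewrite g0 (le_trans (gq j x))//.
    by case/andP: (q01 x).
  have cover x : exists i, c i = g j x.
    have gs : g j x \in s by rewrite sP; apply/mem_set; exists x.
    have := gs; rewrite -index_mem => lt.
    by exists (Ordinal lt); rewrite /c/= nth_index.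
  have Acover x i : c i = g j x -> forall i', (x \in A i') = (x \in (centered_box j%:R : set 'rV[R]_n)) && (i' == i).
    move=> ci i'; apply/idP/andP => [/set_mem[xk /= xi']|[/set_mem xk /eqP ->]].
      split; first exact/mem_set.
      by rewrite -val_eqE/= -(@nth_uniq _ 0 s) ?fset_uniq//= -/(c i') -/(c i) ci xi'.
    by apply/mem_set; split.
  have -> : fine (\int[mu]_x (qj j x)%:E)%E = \sum_(i < size s) c i * fine (mu (A i)).
    have muA i : mu (A i) \is a fin_num.
      rewrite ge0_fin_numE// (le_lt_trans _ (mu_box j%:R))// le_measure ?inE//.
        exact: (bA i).
      exact: (@measurable_centered_box R n j%:R).
    rewrite (eq_integral (fun x => \sum_(i < size s) (c i * \1_(A i : set (borelType R n)) x)%:E)%E); last first.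
      move=> x _; rewrite sumEFin; congr EFin.
      have [i ci] := cover x.
      rewrite (bigD1 i)//= big1 => [|i' i'i].
        by rewrite addr0 /qj !indicE (Acover _ _ ci) eqxx andbT ci.
      by rewrite indicE (Acover _ _ ci) (negPf i'i) andbF mulr0.
    rewrite ge0_integral_sum//; last 2 first.
    - move=> i; apply/measurable_EFinP; apply: measurable_funM => //.
      by apply: measurable_indic; exact: bA.
    - by move=> i x _; rewrite lee_fin mulr_ge0//; case/andP: (c01 i).
    have IA i : (\int[mu]_x (c i * \1_(A i : set (borelType R n)) x)%:E = (c i)%:E * mu (A i))%E.
      have /andP[c0 _] := c01 i.
      under eq_integral do rewrite EFinM.
      have mI : measurable_fun setT (fun x => (\1_(A i : set (borelType R n)) x : R)%:E).
        by apply/measurable_EFinP; apply: measurable_indic; exact: bA.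
      rewrite (ge0_integralZl_EFin _ _ _ mI)//.
      by rewrite integral_indic// ?setIT//; exact: (bA i).
    rewrite -sum_fine//; last by move=> i _; rewrite IA fin_numM.
    by apply: eq_bigr => i _; rewrite IA fineM.
  apply: (void_mean_simple bA tA Ak c01 (mqj j) (qj01 j)) => x.
  have [i ci] := cover x.
  rewrite (bigD1 i)//= big1 => [|i' i'i]; last first.
    by rewrite (Acover _ _ ci) (negPf i'i) andbF.
  rewrite mulr1 /qj indicE (Acover _ _ ci) eqxx andbT ci.
  by case: ifP => _; rewrite ?mulr1 ?mulr0 ?subr0.
have Icvg : fine (\int[mu]_x (qj j x)%:E)%E @[j --> \oo] --> fine (\int[mu]_x (q x)%:E)%E.
  have mE j : measurable_fun setT (fun x => (qj j x)%:E) by apply/measurable_EFinP.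
  have H := @cvg_monotone_convergence _ _ _ mu setT measurableT (fun j x => (qj j x)%:E)
    mE (fun j x _ => qj0 j x) (fun x _ i j ij => qjnd i j x ij).
  have E : (\int[mu]_x (fun x0 => limn (fun j => (qj j x0)%:E)) x = \int[mu]_x (q x)%:E)%E.
    apply: eq_integral => x _; apply: cvg_lim => //; apply: cvg_EFin; first by near=> j.
    exact: qjcvg.
  rewrite E in H.
  apply: (fine_cvg (f := fun j => (\int[mu]_x (qj j x)%:E)%E)).
  rewrite fineK//.
  by rewrite ge0_fin_numE//; apply: integral_ge0 => x _; rewrite lee_fin.
pose e j := expR (- (lambda * fine (\int[mu]_x (qj j x)%:E)%E)).
have ecvg : e j @[j --> \oo] --> expR (- (lambda * fine (\int[mu]_x (q x)%:E)%E)).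
  apply: (@cvg_comp _ _ _ (fun j => - (lambda * fine (\int[mu]_x (qj j x)%:E)%E)) expR
    \oo (nbhs (- (lambda * fine (\int[mu]_x (q x)%:E)%E) : R))).
    by apply: cvgN; apply: cvgM => //; exact: cvg_cst.
  exact: continuous_expR.
have qcvg m : void_mean (qj j) m @[j --> \oo] --> void_mean q m.
  have H : (\int[P]_w (\prod_(k < m) (1 - qj j (X k w)))%:E)%E @[j --> \oo] -->
    (\int[P]_w (\prod_(k < m) (1 - q (X k w)))%:E)%E.
    apply: cvg_dominated1 => //.
    - by move=> j; exact: mprod.
    - exact: mprod.
    - by move=> j w; exact: prod01.
    apply: aeW => w; apply: cvg_big => [|k _]; first exact: mul_continuous.
    by apply: cvgB; [exact: cvg_cst|exact: qjcvg].
  rewrite -(void_meanE m mq q01) in H.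
  exact: (fine_cvg H).
have lower m : expR (- (lambda * fine (\int[mu]_x (q x)%:E)%E)) <= void_mean q m.
  apply: (ler_cvg_to ecvg (qcvg m)); near=> j.
  rewrite /e -(cvg_lim _ (Ij j))//; apply: nonincreasing_cvgn_ge.
    by move=> m1 m2 m12; exact: void_mean_le.
  by apply/cvg_ex; eexists; exact: (Ij j).
apply/cvgrPdist_le => eps eps0.
have e20 : 0 < eps / 2 by rewrite divr_gt0.
have /cvgrPdist_le/(_ _ e20)[j _ /(_ j (leqnn j)) /= ej] := ecvg.
have /cvgrPdist_le/(_ _ e20)[M _ HM] := Ij j.
exists M => // m /HM /= wm.
have := void_mean_le (mqj j) mq (qj01 j) q01 (qjq j) (leqnn m).
have := lower m.
move: ej wm; rewrite /e ler_norml ler_distlC => /andP[h1 _] /andP[_ h2] h3 h4; rewrite ler_norml.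
apply/andP; split; move: h1 h2 h3 h4; set a := expR _; set b := expR _; lra.
Unshelve. all: by end_near. Qed.
End poisson_functional.

(** * Void probabilities of Neyman-Scott processes *)

Lemma probability_ae_eq {R : realType} d (T : measurableType d) (P : probability T R) (A B : set T) :
  measurable A -> measurable B -> {ae P, forall w, A w <-> B w} -> P A = P B.
Proof.
move=> mA mB AB.
rewrite -[A]setIT -[B]setIT -!integral_indic//.
apply: ae_eq_integral => //.
- by apply/measurable_EFinP; exact: measurable_indic.
- by apply/measurable_EFinP; exact: measurable_indic.
apply: filterS AB => w AB _; congr EFin; rewrite !indicE.
by congr (_ : bool)%:R; apply/idP/idP; rewrite !inE => /AB.
Qed.

Section cluster_process_avoidance.
Context {R : realType} {n : nat}.
Context {d d1 : measure_display} {O : measurableType d} {O1 : measurableType d1}.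
Variables (P : probability O R) (P1 : probability O1 R) (lambda : R).
Variables (N : O -> set 'rV[R]_n) (Ltyp : O1 -> set 'rV[R]_n).
Variable mu : {sigma_finite_measure set (borelType R n) -> \bar R}.
Hypothesis muE : forall A, borel A -> mu A = lebesgue_rV A.
Hypothesis mu_box : forall k : R, (mu (centered_box k) < +oo)%E.
Hypothesis HN : poisson_cluster_process P P1 lambda N Ltyp.

Lemma measurable_avoid A : borel A -> measurable [set w | N w `&` A = set0].
Proof.
have [_ _ [_ mN] _] := HN.
move=> bA; rewrite (_ : [set w | _] = (fun w => count_in A (N w)) @^-1` [set 0%E]).
  rewrite -[X in measurable X]setTI; exact: (mN A bA measurableT [set 0%E] (emeasurable_set1 _)).
by apply/seteqP; split => w /=; rewrite /count_in => /(@counting_eq0 R).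
Qed.

Lemma measurable_translation_relation A : borel A ->
  measurable ([set p | A (p.1 + p.2)] : set (borelType R n * borelType R n)).
Proof.
move=> bA.
have mD : measurable_fun setT (fun p : borelType R n * borelType R n => p.1 + p.2 : borelType R n).
  by apply: measurable_rVD.
exact: (preimage_borel mD bA).
Qed.

(** The event is almost surely the decreasing limit of the events that the first m clusters avoid
    [A], whose probabilities are [void_mean] at q = 1 - v; the generating functional gives the
    limit. *)
Lemma cluster_process_avoidance A (v : 'rV[R]_n -> R) : borel A ->
  (forall x, P1 [set w | Ltyp w `&` [set l | A (x + l)] = set0] = (v x)%:E) ->
  (\int[mu]_x (1 - v x)%:E < +oo)%E ->
  P [set w | N w `&` A = set0] = (expR (- (lambda * fine (\int[mu]_x (1 - v x)%:E))))%:E.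
Proof.
move=> bA vE vfin.
have [l0 _ _ [Pi [X [L [[HPi mX HX] HL FI NE]]]]] := HN.
pose U : set (borelType R n * borelType R n) := [set p | A (p.1 + p.2)].
have mU : measurable U by exact: measurable_translation_relation.
have cE x : cluster_void_prob P1 Ltyp U x = (v x)%:E by rewrite -vE.
have mv : measurable_fun setT (v : borelType R n -> R).
  have := measurable_cluster_void_prob HL mU.
  rewrite (_ : (cluster_void_prob _ _ _ : borelType R n -> _) = EFin \o v).
    by move/measurable_EFinP.
  by apply/funext => x; rewrite cE.
have v01 x : 0 <= 1 - v x <= 1.
  have := cluster_void_prob_ge0 HL mU x; rewrite cE lee_fin => v0.
  have := cluster_void_prob_le1 HL mU x; rewrite cE lee_fin => v1.
  by rewrite subr_ge0 v1 gerBl.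
have mq : measurable_fun setT (fun x : borelType R n => 1 - v x) by exact: measurable_funB.
have H := void_mean_cvg muE mu_box l0 HPi mX HX mq v01 vfin.
pose miss k := [set w | void_event U (X k w) (L k w)].
have mm k : measurable (miss k) by exact: measurable_cluster_miss.
pose Am m := \bigcap_(k in `I_m) miss k.
have mAm m : measurable (Am m) by apply: fin_bigcap_measurable => //; exact: finite_II.
have -> : P [set w | N w `&` A = set0] = P (\bigcap_m Am m).
  apply: probability_ae_eq; [exact: measurable_avoid|exact: bigcapT_measurable|].
  apply: filterS NE => w NEw /=; rewrite NEw; split => [h m _ k _|h].
    apply/seteqP; split => // l [Ll /= UA].
    have : set0 (X k w + l) by rewrite -h; split => //; exists k => //; exists l.
    by [].
  apply/seteqP; split => // _ [[k _ [l Ll <-]] AX].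
  have := h k.+1 Logic.I k (ltnSn k).
  by move=> /seteqP[+ _] => /(_ l); apply.
have AmE m : P (Am m) = (void_mean P X (fun x => 1 - v x) m)%:E.
  rewrite [LHS](cluster_void_finite mX HL FI mU m).
  rewrite /void_mean /Rintegral fineK; last first.
    rewrite ge0_fin_numE; last first.
      apply: integral_ge0 => w _; rewrite lee_fin prodr_ge0// => k _.
      by have /andP[_] := v01 (X k w); rewrite gerBl subKr.
    rewrite (_ : (\int[_]_w _)%E = P (Am m)); last first.
      rewrite [RHS](cluster_void_finite mX HL FI mU m); apply: eq_integral => w _.
      by congr EFin; apply: eq_bigr => k _; rewrite subKr cE.
    by rewrite (le_lt_trans (probability_le1 _ _))// ltry.
  apply: eq_integral => w _; congr EFin; apply: eq_bigr => k _.
  by rewrite subKr cE.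
have Pcvg : P (Am m) @[m --> \oo] --> P (\bigcap_m Am m).
  apply: nonincreasing_cvg_mu => //.
  - by rewrite (le_lt_trans (probability_le1 _ _))// ltry.
  - exact: bigcapT_measurable.
  - move=> i j ij; apply/subsetPset => w h k /= ki; apply: h; exact: leq_trans ki ij.
have Ecvg : P (Am m) @[m --> \oo] --> (expR (- (lambda * fine (\int[mu]_x (1 - v x)%:E))))%:E.
  under eq_fun do rewrite AmE.
  by apply: cvg_EFin => //; near=> m.
exact: (cvg_unique _ Pcvg Ecvg).
Unshelve. all: by end_near. Qed.
End cluster_process_avoidance.

Section neyman_scott_void.
Context {R : realType} {n : nat} {d1 : measure_display} {O1 : measurableType d1}.
Variables (P1 : probability O1 R) (V : probability (borelType R n) R) (eta : O1 -> nat)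
  (Ltyp : O1 -> set 'rV[R]_n).
Hypothesis HL : neyman_scott_cluster P1 V eta Ltyp.

Lemma ns_eta_measurable : measurable_fun setT eta. Proof. by case: HL. Qed.
Lemma ns_eta_fin : (\int[P1]_w (eta w)%:R%:E < +oo)%E.
Proof. by case: HL => _ /andP[]. Qed.
Lemma ns_eta_gt0 : (0 < \int[P1]_w (eta w)%:R%:E)%E.
Proof. by case: HL => _ /andP[]. Qed.

Let mlevel m : measurable [set w | eta w = m].
Proof.
rewrite -[X in measurable X]setTI.
by apply: (ns_eta_measurable measurableT (Y := [set m])).
Qed.

Let level_cover : \bigcup_m [set w | eta w = m] = setT.
Proof. by apply/seteqP; split => // w _; exists (eta w). Qed.

Let level_triv (B : nat -> set O1) : trivIset setT (fun m => [set w | eta w = m] `&` B m).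
Proof.
apply/trivIsetP => i j _ _ ij; apply/seteqP; split => // w [[/= -> _] [/= ji _]].
by move: ij; rewrite ji eqxx.
Qed.

Lemma pgf_series s : 0 <= s <= 1 ->
  (pgf P1 eta s)%:E = (\sum_(0 <= m <oo) (s ^+ m)%:E * P1 [set w | eta w = m])%E.
Proof.
move=> s01; have /andP[s0 s1] := s01.
rewrite /pgf /size_mean /Rintegral fineK; last first.
  have := size_integrable ns_eta_measurable ns_eta_fin (lb_pow s01).
  by move/integrable_fin_num; exact.
rewrite -level_cover ge0_integral_bigcup//.
- apply: eq_eseriesr => m _.
  rewrite (eq_integral (fun=> (s ^+ m)%:E)); last by move=> w; rewrite inE/= => ->.
  by rewrite integral_cst//; exact: mlevel.
- by rewrite level_cover; apply/measurable_EFinP; exact: (measurable_size ns_eta_measurable).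
- by move=> w _; rewrite lee_fin exprn_ge0.
- rewrite (_ : (fun k => _) = (fun k => [set w | eta w = k] `&` setT)).
    exact: level_triv.
  by apply/funext => k; rewrite setIT.
Qed.

(** On eta = m, independence of the size and the points gives the factor (1 - V(S))^m; summing over
    m produces [pgf]. *)
Lemma neyman_scott_void S : borel S ->
  P1 [set w | Ltyp w `&` S = set0] = (pgf P1 eta (1 - fine (V S)))%:E.
Proof.
move=> bS; have [_ _ _ [Y [mY FI LE]]] := HL.
have VS1 : fine (V S) <= 1.
  by rewrite -lee_fin fineK ?fin_num_measure//; exact: probability_le1.
have s01 : 0 <= 1 - fine (V S) <= 1 by rewrite subr_ge0 VS1 gerBl fine_ge0.
rewrite pgf_series//.
pose B m := [set w | forall i : 'I_m, ~ S (Y m i w)].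
have BE m : B m = \bigcap_(i in [set: 'I_m]) (Y m i @^-1` (~` S)).
  by apply/seteqP; split => w h i; [move=> _; exact: h|exact: (h i Logic.I)].
have bSC : borel (~` S) by exact: (@measurableC _ (borelType R n)).
have mYC m i : measurable (Y m i @^-1` (~` S)).
  by have [mYi _] := mY m i; exact: (preimage_borel mYi bSC).
have mB m : measurable (B m).
  by rewrite BE; apply: fin_bigcap_measurable => // i _; exact: mYC.
rewrite (_ : [set w | _] = \bigcup_m ([set w | eta w = m] `&` B m)); last first.
  apply/seteqP; split => w /=.
    move=> h; exists (eta w) => //; split => // i SY.
    have : set0 (Y (eta w) i w) by rewrite -h; split => //; rewrite LE; exists i.
    by [].
  move=> [m _ [/= em]]; subst m => Bw.
  apply/seteqP; split => // y; rewrite LE => -[[i _ <-] SY]; exact: Bw SY.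
rewrite measure_bigcup//; last by move=> m _; apply: measurableI; [exact: mlevel|exact: mB].
transitivity (\sum_(0 <= m <oo) P1 ([set w | eta w = m] `&` B m))%E.
  by apply: eq_eseriesl => m; rewrite in_setT.
apply: eq_eseriesr => m _.
(* The indices involved on eta = m: [None] for the size and the m points of the m-th family. *)
pose J : seq (option {m : nat & 'I_m}) :=
  None :: [seq Some (existT (fun m => 'I_m) m i) | i <- enum 'I_m].
have uJ : uniq J.
  rewrite /= map_inj_uniq ?enum_uniq ?andbT.
    by apply/mapP => -[].
  by move=> i i' [] /eqP; rewrite -tag_eqE /tag_eq/= eqxx/= tagged_asE => /eqP.
pose E (j : option {m : nat & 'I_m}) : set O1 :=
  if j is Some p then Y (tag p) (tagged p) @^-1` (~` S) else [set w | eta w = m].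
have := FI [fset j in J]%fset E _.
move=> /(_ _) H.
have -> : [set w | eta w = m] `&` B m = \bigcap_(j in [set` [fset j in J]%fset]) E j.
  apply/seteqP; split => w /=.
    move=> [em Bw] j /=; rewrite !inE => /orP[/eqP ->//|/mapP[i _ ->]] /=; exact: Bw.
  move=> h; split; first by apply: (h None); rewrite /= !inE.
  move=> i; apply: (h (Some (existT (fun m => 'I_m) m i))).
  by rewrite /= !inE/= map_f ?orbT// mem_enum.
rewrite H; last first.
  move=> [p|] _ /=; [exists (~` S) => //; by rewrite setTI|].
  exists [set m] => //; by rewrite setTI.
have -> : (\prod_(j <- [fset j in J]%fset) P1 (E j) = \prod_(j <- J) P1 (E j))%E.
  apply: perm_big; apply: uniq_perm => // j; by rewrite !inE.
rewrite big_cons/= muleC; congr (_ * _)%E; rewrite big_map/=.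
rewrite (eq_bigr (fun=> (1 - fine (V S))%:E)); last first.
  move=> i _; have [_ ->//] := mY m i.
  by rewrite probability_setC// EFinB fineK// fin_num_measure.
by rewrite prodEFin big_const_seq count_predT -cardE card_ord iter_mulr_1.
Qed.
End neyman_scott_void.

(** * Absolute continuity in epsilon-delta form and exchange of centre and point *)

(** Borel-Cantelli: if sets of [mu]-measure below 2 ^ -(k + 1) kept [D]-mass at least e, their upper
    limit would be [mu]-null and, [D] being finite, would still have [D]-mass at least e. *)
Lemma dominates_epsilon_delta {R : realType} d (T : measurableType d)
    (mu D : {measure set T -> \bar R}) : (D setT < +oo)%E ->
  (forall A, measurable A -> mu A = 0%E -> D A = 0%E) ->
  forall e : R, 0 < e -> exists2 de : R, 0 < de &
    forall A, measurable A -> (mu A < de%:E)%E -> (D A < e%:E)%E.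
Proof.
move=> Dfin Dmu e e0; apply: contrapT => H.
have /choice[A HA] : forall k : nat, exists A,
    [/\ measurable A, (mu A < (1 / (2 ^ k.+1)%:R)%:E)%E & (e%:E <= D A)%E].
  move=> k; apply: contrapT => Hk; apply: H; exists (1 / (2 ^ k.+1)%:R).
    by rewrite divr_gt0// ltr0n expn_gt0.
  move=> A mA muA.
  by rewrite ltNge; apply/negP => DA; apply: Hk; exists A.
have mA k : measurable (A k) by case: (HA k).
have mU k : measurable (\bigcup_(j in [set j | (k <= j)%N]) A j) by apply: bigcup_measurable => j _.
have mL : measurable (lim_sup_set A) by exact: bigcapT_measurable.
have mu0 : mu (lim_sup_set A) = 0%E.
  apply: lim_sup_set_cvg0 => //.
  apply: (@le_lt_trans _ _ (\sum_(0 <= k <oo) ((1 / (2 ^ k.+1)%:R)%:E : \bar R))%E).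
    by apply: lee_nneseries => // k _; apply/ltW; have [_ + _] := HA k.
  by apply: (le_lt_trans (epsilon_trick0 _ _)); rewrite ?ltry.
have D0 := Dmu _ mL mu0.
have Dle X : measurable X -> (D X < +oo)%E.
  move=> mX; apply: le_lt_trans Dfin; apply: le_measure; rewrite ?inE//.
have Dcvg := @lim_sup_set_cvg _ _ _ D A mA (Dle _ (mU 0%N)).
have : (e%:E <= D (lim_sup_set A))%E.
  apply: (cvge_ge _ Dcvg); near=> k.
  have [_ _ /le_trans] := HA k; apply.
  apply: (le_measure _ (mem_set (mA k)) (mem_set (mU k))) => x Ax.
  by exists k => //=.
by rewrite D0 lee_fin leNgt e0.
Unshelve. all: by end_near. Qed.

Section translation_fubini.
Context {R : realType} {n : nat}.
Variable mu : {sigma_finite_measure set (borelType R n) -> \bar R}.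
Hypothesis mu_shift : forall A x, borel A -> mu [set v | A (v + x)] = mu A.
Variable V : probability (borelType R n) R.

Lemma ge0_integral_translate (a : 'rV[R]_n) (f : borelType R n -> \bar R) :
  measurable_fun setT f -> (forall x, 0 <= f x)%E ->
  (\int[mu]_x f (x + a)%R = \int[mu]_x f x)%E.
Proof.
move=> mf f0.
have ms : measurable_fun setT (fun x : borelType R n => (x + a)%R : borelType R n).
  by apply: measurable_rVD => //; exact: measurable_id.
rewrite -(ge0_integral_image_measure mu ms mf f0).
by apply: eq_measure_integral => A mA _; exact: mu_shift.
Qed.

(** For fixed z the substitution y = x + z preserves [mu]; Tonelli makes z the outer variable and
    back. *)
Lemma translation_fubini (f : borelType R n * borelType R n -> \bar R) :
  measurable_fun setT f -> (forall p, 0 <= f p)%E ->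
  (\int[mu]_x \int[V]_z f (x + z, z)%R = \int[mu]_y \int[V]_z f (y, z))%E.
Proof.
move=> mf f0.
have mg : measurable_fun setT (fun p : borelType R n * borelType R n => f ((p.1 + p.2)%R, p.2)).
  apply: (measurableT_comp mf); apply: measurable_fun_pair => //.
  by apply: measurable_rVD.
rewrite (fubini_tonelli (fun p : borelType R n * borelType R n => f ((p.1 + p.2)%R, p.2)) mg)//.
rewrite (fubini_tonelli f mf f0).
apply: eq_integral => z _.
rewrite (@ge0_integral_translate z (fun y => f (y, z)))//.
apply: (measurableT_comp mf); apply: measurable_fun_pair => //.
Qed.

Lemma measurable_translated_mass d (T : measurableType d) (S : set (T * borelType R n)) :
  measurable S -> measurable_fun setT (fun x => fine (V [set l | S (x, l)])).
Proof.
move=> mS.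
have := @measurable_fun_xsection _ _ _ _ _ V S mS => H.
have -> : (fun x => fine (V [set l | S (x, l)])) = fine \o (V \o xsection S).
  apply/funext => x /=; congr (fine (V _)).
  by apply/seteqP; split => l; rewrite /xsection/= inE.
exact: (measurableT_comp (@fine_measurable R setT measurableT) H).
Qed.
End translation_fubini.

Section mass.
Context {R : realType} d (T : measurableType d) (V : probability T R).

Definition mass (S : set T) : R := fine (V S).

Lemma mass01 S : measurable S -> 0 <= mass S <= 1.
Proof.
move=> mS; rewrite fine_ge0//= -lee_fin fineK ?fin_num_measure//.
exact: probability_le1.
Qed.

Lemma massE S : measurable S -> (mass S)%:E = V S.
Proof. by move=> mS; rewrite /mass fineK// fin_num_measure. Qed.

Lemma le_mass S S' : measurable S -> measurable S' -> S `<=` S' -> mass S <= mass S'.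
Proof.
move=> mS mS' SS; rewrite -lee_fin !massE//.
by apply: le_measure => //; rewrite inE.
Qed.

Lemma massU S S' : measurable S -> measurable S' -> S `&` S' = set0 ->
  mass (S `|` S') = mass S + mass S'.
Proof.
move=> mS mS' SS; apply/EFin_inj; rewrite EFinD !massE//; last exact: measurableU.
by rewrite measureU.
Qed.

End mass.

(** * Absolute continuity of differences of cluster points *)

(** The integral is a supremum over simple functions below [f], and the indicator of [G] is one of
    them. This covers integrands such as that of [difference_measure], whose measurability is not at
    hand. *)
Lemma le_integral_indic {R : realType} d (T : measurableType d) (P : {measure set T -> \bar R})
    (f : T -> \bar R) (G : set T) : measurable G -> (forall w, 0 <= f w)%E ->
  (forall w, G w -> 1 <= f w)%E -> (P G <= \int[P]_w f w)%E.
Proof.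
move=> mG f0 fG; rewrite (ge0_integralTE _ f0).
apply: ereal_sup_ubound; exists (indic_nnsfun R mG) => /=.
  move=> w; rewrite mindicE; have [/set_mem Gw|_] := boolP (w \in G); last exact: f0.
  exact: fG.
rewrite -integralT_nnsfun.
under eq_integral do rewrite /=.
by rewrite integral_indic// setIT.
Qed.

Lemma counting_range_lt {R : realType} {T : pointedType} m (f : 'I_m -> T) (i j : 'I_m) :
  i != j -> f i = f j -> (counting (range f) < m%:R%:E :> \bar R)%E.
Proof.
move=> ij fij; pose s := [seq f k | k <- enum (predC1 i)].
have sE : range f `<=` [set` [fset x in s]%fset].
  move=> _ [k _ <-] /=; rewrite inE/=; have [->|ki] := eqVneq k i.
    by rewrite fij map_f// mem_enum inE eq_sym.
  by rewrite map_f// mem_enum inE.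
apply: (@le_lt_trans _ _ _ _ _ (@le_counting R _ _ _ sE)); rewrite counting_fin//.
rewrite set_fsetK lte_fin ltr_nat card_fseq (leq_ltn_trans (size_undup _))//.
rewrite size_map -cardE cardC1 card_ord.
by case: m i {f j ij fij s sE} => // -[].
Qed.

Section difference_measure.
Context {R : realType} {n : nat} {d1 : measure_display} {O1 : measurableType d1}.
Variables (P1 : probability O1 R) (V : probability (borelType R n) R) (eta : O1 -> nat)
  (Ltyp : O1 -> set 'rV[R]_n).
Hypothesis HL : neyman_scott_cluster P1 V eta Ltyp.
Hypothesis Hdiff : forall A, borel A -> lebesgue_rV A = 0%E -> difference_measure P1 Ltyp A = 0%E.
Local Notation rV2 := (borelType R n * borelType R n)%type.

Definition rV_difference (p : rV2) : borelType R n := p.2 - p.1.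

Lemma measurable_rV_difference : measurable_fun setT rV_difference.
Proof.
rewrite /rV_difference; apply: measurable_rVD => //.
by apply: measurable_rVN.
Qed.

Definition difference_law := image_measure (V \x V)%E measurable_rV_difference.

Lemma difference_law_fin : (difference_law setT < +oo)%E.
Proof.
rewrite /difference_law /image_measure/= /pushforward preimage_setT.
rewrite (_ : setT = setT `*` setT :> set rV2); last by rewrite setXTT.
have -> : ((V \x V) (setT `*` setT) = V setT * V setT)%E by exact: product_measure1E.
by rewrite probability_setT mule1 ltry.
Qed.

(** Some m >= 2 has P(eta = m) > 0. Given eta = m, two of the points are independent with law [V],
    and their difference lies in [A] with probability at most the difference measure of [A] divided
    by P(eta = m). *)
Lemma difference_law_eq0 A : P1 [set w | (2 <= eta w)%N] <> 0%E ->
  borel A -> lebesgue_rV A = 0%E -> difference_law A = 0%E.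
Proof.
move=> H2 bA A0; have [meta _ Leta [Y [mY FI LE]]] := HL.
have mlev m : measurable [set w | eta w = m].
  rewrite -[X in measurable X]setTI.
  by apply: (meta measurableT [set m]).
have [m m2 Pm] : exists2 m, (2 <= m)%N & P1 [set w | eta w = m] <> 0%E.
  apply: contrapT => H; apply: H2.
  rewrite (_ : [set w | _] = \bigcup_(m in [set m | (2 <= m)%N]) [set w | eta w = m]); last first.
    apply/seteqP; split => [w /= hw|w [m /= hm em]]; first by exists (eta w).
    by rewrite /= em.
  rewrite measure_bigcup//.
    rewrite eseries0// => m _ hm; rewrite inE in hm; apply: contrapT => ?; apply: H.
    by exists m.
  by move=> i j _ _ [w [/= <-]].
have [i0 [i1 i01]] : exists i0 i1 : 'I_m, i0 != i1.
  case: m m2 {Pm} => [|[|m]]// _; exists ord0, (lift ord0 ord0); exact: neq_lift.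
pose T2 := {m : nat & 'I_m}.
pose p0 : T2 := existT (fun m => 'I_m) m i0; pose p1 : T2 := existT (fun m => 'I_m) m i1.
have p01 : p0 != p1.
  apply/negP => /eqP; rewrite /p0 /p1 => /eqP; rewrite -tag_eqE /tag_eq/= eqxx/= tagged_asE/=.
  exact/negP.
have mY0 := (mY m i0).1; have mY1 := (mY m i1).1.
pose YY (w : O1) : rV2 := (Y m i0 w, Y m i1 w).
have mYY : measurable_fun setT YY by exact: measurable_fun_pair.
have Cfin : P1 [set w | eta w = m] \is a fin_num by exact: fin_num_measure.
pose c := fine (P1 [set w | eta w = m]).
have c0 : 0 < c.
  by rewrite /c fine_gt0// lt0e measure_ge0 andbT ltey_eq Cfin andbT; apply/eqP.
have cinv0 : 0 <= c^-1 by rewrite invr_ge0 ltW.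
(* Conditional law of the pair given eta = m; on rectangles it equals the product of [V] with
   itself. *)
pose m' := mscale (NngNum cinv0) (image_measure (mrestr P1 (mlev m)) mYY).
have m'E X : m' X = ((c^-1)%:E * P1 ((YY @^-1` X) `&` [set w | eta w = m]))%E by [].
have H1 A1 A2 : measurable A1 -> measurable A2 -> m' (A1 `*` A2) = (V A1 * V A2)%E.
  move=> mA1 mA2; rewrite m'E.
  pose E (j : option T2) : set O1 :=
    if j is Some p then (if p == p0 then Y m i0 @^-1` A1 else if p == p1 then Y m i1 @^-1` A2 else setT)
    else [set w | eta w = m].
  have -> : YY @^-1` (A1 `*` A2) `&` [set w | eta w = m] =
     \bigcap_(j in [set` [fset None; Some p0; Some p1]%fset]) E j.
    apply/seteqP; split => w /=.
      move=> [[YA1 YA2] em] j /=; rewrite !inE => /orP[/orP[/eqP ->//|/eqP ->]|/eqP ->] /=.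
        by rewrite eqxx.
      by rewrite eq_sym (negPf p01) eqxx.
    move=> h; split; last by apply: (h None); rewrite /= !inE.
    split.
      by have := h (Some p0); rewrite /= !inE/= !eqxx; apply.
    by have := h (Some p1); rewrite /= !inE/= !eqxx (eq_sym p1) (negPf p01) orbT; apply.
  rewrite FI; last first.
    move=> [p|] /=; last by move=> _; exists [set m] => //; rewrite setTI.
    rewrite !inE/= => /orP[/eqP[->]|/eqP[->]].
      by rewrite eqxx; exists A1 => //; rewrite setTI.
    by rewrite eq_sym (negPf p01) eqxx; exists A2 => //; rewrite setTI.
  have n01 : (Some p0 == Some p1 :> option T2) = false by apply/negP => /eqP[]/eqP; exact/negP.
  rewrite -fsetUA big_fsetU1/=; last by rewrite !inE.
  rewrite big_fsetU1/=; last by rewrite !inE n01.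
  rewrite big_seq_fset1/= !eqxx eq_sym (negPf p01).
  rewrite (mY m i0).2// (mY m i1).2//.
  rewrite /E -[P1 [set w | _]]fineK// -/c !muleA -EFinM mulVf ?gt_eqF// mul1e//.
have mA' : measurable (rV_difference @^-1` (A : set (borelType R n))).
  exact: (preimage_borel measurable_rV_difference bA).
rewrite /difference_law /image_measure/= /pushforward.
have DE : ((V \x V) (rV_difference @^-1` A) = m' (rV_difference @^-1` A))%E.
  exact (product_measure_unique H1 mA').
apply: (etrans DE); rewrite m'E.
suff -> : P1 (YY @^-1` (rV_difference @^-1` A) `&` [set w | eta w = m]) = 0%E by rewrite mule0.
(* Almost surely the cluster has [eta] points; on [eta = m] this forces
   [Y m i0 <> Y m i1], so this pair is counted by the difference measure. *)
have [Z [mZ PZ ZL]] := Leta.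
pose G := YY @^-1` (rV_difference @^-1` A) `&` [set w | eta w = m].
have mG : measurable G.
  apply: measurableI => //; rewrite -[X in measurable X]setTI; exact (mYY measurableT _ mA').
have -> : P1 G = P1 (G `\` Z).
  apply/eqP; rewrite eq_le; apply/andP; split; last first.
    exact: (measure_le _ (measurableD mG mZ) mG (@subDsetl _ _ _)).
  rewrite -[leRHS]adde0 -PZ (le_trans _ (measureU2 _ _ _))//; last exact: measurableD.
  apply: measure_le => //; first by apply: measurableU => //; exact: measurableD.
  move=> w Gw; have [Zw|Zw] := pselect (Z w); by [right|left].
apply/eqP; rewrite eq_le measure_ge0 andbT -(Hdiff bA A0) /difference_measure.
apply: le_integral_indic; first exact: measurableD.
  by move=> w; exact: counting_ge0.
move=> w [[/= YA em] Zw]; apply/counting_ge1; exists (Y m i1 w, Y m i0 w) => /=.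
have Lw : Ltyp w = range (fun i : 'I_m => Y m i w) by rewrite LE em.
split; [by rewrite Lw; exists i1|by rewrite Lw; exists i0| |exact: YA].
move=> Y01; apply: Zw; apply: ZL => /= H.
have : (counting (Ltyp w) < (eta w)%:R%:E :> \bar R)%E.
  rewrite Lw em; exact: counting_range_lt i01 (esym Y01).
by rewrite H ltxx.
Qed.
End difference_measure.

(** * Masses of translates of a set *)

Section translated_mass.
Context {R : realType} {n : nat}.
Variable mu : {sigma_finite_measure set (borelType R n) -> \bar R}.
Hypothesis mu_shift : forall A x, borel A -> mu [set v | A (v + x)] = mu A.
Variable V : probability (borelType R n) R.
Implicit Types A K : set 'rV[R]_n.

(** Probability that a given point of a cluster centred at x falls in [A]. *)
Definition tmass A (x : 'rV[R]_n) : R := mass V [set l | A (x + l)].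

Lemma borel_translate A x : borel A -> borel [set l | A (x + l)].
Proof.
move=> bA; rewrite (_ : [set l | _] = [set l | A (l + x)]); first exact: borel_shift.
by apply/funext => l /=; rewrite addrC.
Qed.

Lemma tmassE A x : borel A -> (tmass A x)%:E = V [set l | A (x + l)].
Proof. by move=> bA; apply: massE; exact: borel_translate. Qed.

Lemma tmass01 A x : borel A -> 0 <= tmass A x <= 1.
Proof. by move=> bA; apply: mass01; exact: borel_translate. Qed.

Lemma tmass_ge0 A x : borel A -> 0 <= tmass A x.
Proof. by move=> /(tmass01 x)/andP[]. Qed.

Lemma le_tmass A A' x : borel A -> borel A' -> A `<=` A' -> tmass A x <= tmass A' x.
Proof.
move=> bA bA' AA; apply: le_mass; [exact: borel_translate|exact: borel_translate|].
by move=> l; exact: AA.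
Qed.

Lemma tmassU A A' x : borel A -> borel A' -> A `&` A' = set0 ->
  tmass (A `|` A') x = tmass A x + tmass A' x.
Proof.
move=> bA bA' AA; apply: massU; [exact: borel_translate|exact: borel_translate|].
by apply/seteqP; split => // l [Al A'l]; rewrite -[set0 _]/(set0 (x + l)) -AA.
Qed.

Lemma measurable_tmass A : borel A -> measurable_fun setT (tmass A : borelType R n -> R).
Proof.
move=> bA; apply: (@measurable_translated_mass R n V _ (borelType R n) [set p | A (p.1 + p.2)]).
exact: measurable_translation_relation.
Qed.

Lemma tmass_integral A x : borel A ->
  (tmass A x)%:E = (\int[V]_z (\1_A (x + z)%R : R)%:E)%E.
Proof.
move=> bA; rewrite tmassE//.
have := integral_indic V measurableT (borel_translate x bA).
by rewrite setIT => <-.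
Qed.

(** The integration variable passes from the centre x to the position y = x + z of a point of its
    cluster. *)
Lemma integral_tmassM A (g : borelType R n * borelType R n -> \bar R) : borel A ->
  measurable_fun setT g -> (forall p, 0 <= g p)%E ->
  (\int[mu]_x \int[V]_z (((\1_A (x + z)%R : R)%:E) * g ((x + z)%R, z)) =
   \int[mu]_y ((\1_A y : R)%:E * \int[V]_z g (y, z)))%E.
Proof.
move=> bA mg g0.
rewrite (@translation_fubini R n mu mu_shift V (fun p => ((\1_A p.1 : R)%:E * g p)%E)).
- apply: eq_integral => y _; rewrite -ge0_integralZl//.
  by apply: (measurableT_comp mg); exact: measurable_fun_pair.
- apply: emeasurable_funM => //; apply/measurable_EFinP.
  apply: (measurableT_comp _ (measurable_fst)).
  by apply: measurable_indic; exact: bA.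
- by move=> p; rewrite mule_ge0.
Qed.

Lemma integral_tmass A : borel A -> (\int[mu]_x (tmass A x)%:E = mu A)%E.
Proof.
move=> bA; transitivity (\int[mu]_x \int[V]_z (((\1_A (x + z)%R : R)%:E) * 1))%E.
  apply: eq_integral => x _; rewrite tmass_integral//.
  by apply: eq_integral => z _; rewrite mule1.
rewrite (@integral_tmassM A (cst 1%E))//.
have := integral_indic mu measurableT bA; rewrite setIT => <-.
apply: eq_integral => y _.
under eq_integral do rewrite /=.
have -> : (\int[V]__ 1 = 1)%E; last by rewrite mule1.
have := integral_cst V measurableT 1%E; rewrite mul1e => H; apply: (etrans H); exact: probability_setT.
Qed.

(** The squared mass is the probability that two independent points of one cluster fall in [A]. With
    the first at y, the second is at y plus their difference, and the centre is integrated out. *)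
Lemma integral_tmass_sqr A : borel A -> (\int[mu]_x (tmass A x * tmass A x)%:E =
  \int[mu]_y ((\1_A y : R)%:E * difference_law V [set w | A (y + w)]%R))%E.
Proof.
move=> bA.
have mU : measurable ([set q | A (q.1.1 - q.1.2 + q.2)] :
    set ((borelType R n * borelType R n) * borelType R n)).
  have mD : measurable_fun setT (fun q : (borelType R n * borelType R n) * borelType R n =>
      q.1.1 - q.1.2 + q.2 : borelType R n).
    apply: measurable_rVD => //; apply: measurable_rVD; first exact: measurableT_comp.
    by apply: measurable_rVN; exact: measurableT_comp.
  exact: (preimage_borel mD bA).
have mg : measurable_fun setT (fun p : borelType R n * borelType R n => (tmass A (p.1 - p.2))%:E).
  by apply/measurable_EFinP; exact: (measurable_translated_mass V mU).
transitivity (\int[mu]_x \int[V]_z (((\1_A (x + z)%R : R)%:E) * (tmass A (x + z - z)%R)%:E))%E.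
  apply: eq_integral => x _; under eq_integral do rewrite addrK.
  rewrite ge0_integralZr ?lee_fin ?tmass_ge0//.
    rewrite EFinM; congr (_ * _)%E.
    exact: tmass_integral.
  apply/measurable_EFinP.
  by apply: measurable_indic; exact: borel_translate.
refine (etrans (integral_tmassM bA mg _) _); first by move=> p; rewrite lee_fin tmass_ge0.
apply: eq_integral => y _; congr (_ * _)%E.
rewrite /difference_law /image_measure/= /pushforward/= /product_measure1/=.
apply: eq_integral => z _; rewrite tmassE//; congr (V _).
apply/seteqP; split => l; rewrite /xsection/= inE/= /rV_difference/= addrA addrAC//.
Qed.
End translated_mass.

(** * Second-order error of the void exponent *)

Section thinning_error.
Context {R : realType} {n : nat}.
Variable mu : {sigma_finite_measure set (borelType R n) -> \bar R}.
Hypothesis muE : forall A, borel A -> mu A = lebesgue_rV A.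
Hypothesis mu_shift : forall A x, borel A -> mu [set v | A (v + x)] = mu A.
Context {d1 : measure_display} {O1 : measurableType d1}.
Variables (P1 : probability O1 R) (V : probability (borelType R n) R) (eta : O1 -> nat)
  (Ltyp : O1 -> set 'rV[R]_n).
Hypothesis HL : neyman_scott_cluster P1 V eta Ltyp.
Hypothesis Hdiff : forall A, borel A -> lebesgue_rV A = 0%E -> difference_measure P1 Ltyp A = 0%E.
Local Notation dG := (dpgf P1 eta).
Local Notation G := (pgf P1 eta).
Local Notation m1 := (size_mu P1 eta).
Implicit Types A K : set 'rV[R]_n.

Let meta := ns_eta_measurable HL.
Let efin := ns_eta_fin HL.
Let egt0 := ns_eta_gt0 HL.

(* Bounds the amount by which the mean number of points in [A] exceeds the void
   exponent of [A], both divided by the Poisson intensity. *)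
Definition thinning_error A : \bar R :=
  (\int[mu]_x (tmass V A x * (m1 - dG (1 - tmass V A x)))%:E)%E.

Lemma compl01 (u : R) : 0 <= u <= 1 -> 0 <= 1 - u <= 1.
Proof. lra. Qed.

Lemma dpgf_le_size_mu s : 0 <= s <= 1 -> 0 <= m1 - dG s.
Proof.
by move=> /andP[s0 s1]; rewrite subr_ge0 -(dpgf1 P1 eta); apply: dpgf_le.
Qed.

Lemma measurable_tmass_dpgf (f : borelType R n -> R) A : borel A -> measurable_fun setT f ->
  (forall x, 0 <= f x <= 1) ->
  measurable_fun setT (fun x : borelType R n => (tmass V A x * dG (1 - f x))%:E).
Proof.
move=> bA mf f01; apply/measurable_EFinP; apply: measurable_funM; first exact: measurable_tmass.
apply: measurable_dpgf => //; first exact: measurable_funB.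
by move=> x; exact: compl01.
Qed.

(** Up to a threshold [u0], continuity at 1 gives the bound e; beyond it the trivial bound [m1] is
    at most [m1 / u0 * u]. *)
Lemma dpgf_linear_bound e : 0 < e -> exists2 c, 0 < c &
  forall u, 0 <= u <= 1 -> m1 - dG (1 - u) <= e + c * u.
Proof.
move=> e0; have m0 : 0 < m1 by exact: size_mu_gt0.
have [u0 [u00 u01 Hu0]] := dpgf_cvg1 meta efin e0.
exists (m1 / u0); first by rewrite divr_gt0.
move=> u /andP[ua ub]; have [uu|uu] := leP u u0.
  rewrite (@le_trans _ _ e)//.
    rewrite (le_trans _ Hu0)// lerD2l lerN2; apply: dpgf_le => //; lra.
  by rewrite lerDl mulr_ge0// divr_ge0// ltW.
have d0 : 0 <= dG (1 - u) by apply: dpgf_ge0 => //; apply: compl01; rewrite ua.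
have : m1 <= m1 / u0 * u.
  by rewrite mulrAC ler_pdivlMr// ler_pM2l// ltW.
move: d0; lra.
Qed.

(** By the linear bound the error is at most e / 2 times the integral of the mass, which is [mu A],
    plus c times the integral of its square. The latter integrates over y in [A] the difference law
    of a translate of [A], which is small because all translates have the same small volume. *)
Lemma thinning_error_small e : 0 < e -> exists2 de, 0 < de &
  forall A, borel A -> (mu A < de%:E)%E -> (thinning_error A <= e%:E * mu A)%E.
Proof.
move=> e0; have m0 : 0 < m1 by exact: size_mu_gt0.
(* With at most one point per cluster [dG] is constant and the error is zero. *)
have [P2|/eqP P2] := eqVneq (P1 [set w | (2 <= eta w)%N]) 0%E.
  exists 1 => // A bA _; rewrite /thinning_error integral0_eq.
    by rewrite mule_ge0// lee_fin ltW.
  move=> x _; rewrite (dpgf_cst meta P2) ?subrr ?mulr0//.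
  exact/compl01/tmass01.
have e20 : 0 < e / 2 by rewrite divr_gt0.
have [c c0 Hc] := dpgf_linear_bound e20.
have ec : 0 < e / 2 / c by rewrite divr_gt0.
have [de de0 Hde] := @dominates_epsilon_delta _ _ _ mu (difference_law V)
  (difference_law_fin V) (fun A bA muA => difference_law_eq0 HL Hdiff P2 bA (etrans (esym (muE bA)) muA)) _ ec.
exists de => // A bA muA.
have mt := measurable_tmass V bA.
have t0 x := tmass_ge0 V x bA.
have mtE : measurable_fun setT (fun x : borelType R n => (tmass V A x)%:E) by exact/measurable_EFinP.
have mt2 : measurable_fun setT (fun x : borelType R n => (tmass V A x * tmass V A x)%:E).
  by apply/measurable_EFinP; exact: measurable_funM.
apply: (@le_trans _ _ (\int[mu]_x ((e / 2)%:E * (tmass V A x)%:E + c%:E * (tmass V A x * tmass V A x)%:E))%E).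
  apply: ge0_le_integralT => x.
    by rewrite lee_fin mulr_ge0//; apply: dpgf_le_size_mu; exact/compl01/tmass01.
  rewrite -!EFinM -EFinD lee_fin.
  rewrite [leRHS](_ : _ = tmass V A x * (e / 2 + c * tmass V A x)); last by ring.
  by rewrite ler_wpM2l// Hc// tmass01.
rewrite ge0_integralD//; last 4 first.
- by move=> x _; rewrite mule_ge0 ?lee_fin// ltW.
- exact: measurable_funeM.
- by move=> x _; rewrite mule_ge0 ?lee_fin ?mulr_ge0// ltW.
- exact: measurable_funeM.
rewrite !ge0_integralZl//; last 4 first.
- by move=> x _; rewrite lee_fin ?mulr_ge0.
- by rewrite lee_fin ltW.
- by move=> x _; rewrite lee_fin ?mulr_ge0.
- by rewrite lee_fin ltW.
rewrite (integral_tmass mu_shift)// (integral_tmass_sqr mu_shift)//.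
apply: (@le_trans _ _ ((e / 2)%:E * mu A + c%:E * ((e / 2 / c)%:E * mu A))%E); last first.
  rewrite muleA -EFinM (mulrC c) divfK ?gt_eqF// -ge0_muleDl.
  - by rewrite -EFinD -splitr.
  - by rewrite lee_fin ltW.
  - by rewrite lee_fin ltW.
apply: leeD => //; apply: lee_wpmul2l; first by rewrite lee_fin ltW.
have := integral_indic mu measurableT bA; rewrite setIT => <-.
rewrite -ge0_integralZl//; last 2 first.
- by apply/measurable_EFinP; apply: measurable_indic; exact: bA.
- by rewrite lee_fin ltW.
apply: ge0_le_integralT => y; first by rewrite mule_ge0.
rewrite muleC; apply: lee_wpmul2r => //; apply/ltW/Hde.
  exact: borel_translate.
rewrite (_ : [set w | _] = [set w | A (w + y)]); last first.
  by apply/funext => w /=; rewrite addrC.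
have H := mu_shift y bA; apply: le_lt_trans muA; rewrite -H; exact: lexx.
Qed.
End thinning_error.

(** * First order expansion of the void exponent *)

Section void_exponent.
Context {R : realType} {n : nat}.
Variable mu : {sigma_finite_measure set (borelType R n) -> \bar R}.
Hypothesis mu_shift : forall A x, borel A -> mu [set v | A (v + x)] = mu A.
Context {d1 : measure_display} {O1 : measurableType d1}.
Variables (P1 : probability O1 R) (V : probability (borelType R n) R) (eta : O1 -> nat)
  (Ltyp : O1 -> set 'rV[R]_n).
Hypothesis HL : neyman_scott_cluster P1 V eta Ltyp.
Local Notation dG := (dpgf P1 eta).
Local Notation G := (pgf P1 eta).
Local Notation m1 := (size_mu P1 eta).
Local Notation w A x := (tmass V A x).
Implicit Types A K : set 'rV[R]_n.

Let meta := ns_eta_measurable HL.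
Let efin := ns_eta_fin HL.
Let egt0 := ns_eta_gt0 HL.

Definition void_increment K A : \bar R :=
  (\int[mu]_x (G (1 - w K x) - G (1 - w (K `|` A) x))%:E)%E.

Definition void_exponent A : R := fine (\int[mu]_x (1 - G (1 - w A x))%:E).

(** First-order form of [void_increment]: the mass of [A] times the slope of the generating function
    at the void probability of [K] for one cluster point. *)
Definition tangent_mass K A : \bar R := (\int[mu]_x (w A x * dG (1 - w K x))%:E)%E.

Let w01 A x (bA : borel A) := tmass01 V x bA.

Let c01 A x : borel A -> 0 <= 1 - w A x <= 1.
Proof. by move=> bA; apply/compl01/w01. Qed.

Let m1_ge0 : 0 <= m1. Proof. by apply/ltW/size_mu_gt0. Qed.

Let dG_le A x : borel A -> dG (1 - w A x) <= m1.
Proof.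
by move=> /(c01 x)/andP[a b]; rewrite -(dpgf1 P1 eta); apply: dpgf_le.
Qed.

Lemma tangent_mass_le K A : borel K -> borel A -> (tangent_mass K A <= m1%:E * mu A)%E.
Proof.
move=> bK bA; rewrite -(integral_tmass mu_shift V bA) -ge0_integralZl//; last 2 first.
- by apply/measurable_EFinP; exact: measurable_tmass.
- by move=> x _; rewrite lee_fin tmass_ge0.
apply: ge0_le_integralT => x; first by rewrite lee_fin mulr_ge0 ?tmass_ge0// dpgf_ge0// c01.
by rewrite -EFinM lee_fin mulrC ler_wpM2r ?tmass_ge0// dG_le.
Qed.

Lemma pgf_increment_bounds K A x : borel K -> borel A -> K `&` A = set0 ->
  w A x * dG (1 - w (K `|` A) x) <= G (1 - w K x) - G (1 - w (K `|` A) x) <=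
  w A x * dG (1 - w K x).
Proof.
move=> bK bA KA; have bKA : borel (K `|` A) by exact: borelU.
have wE : w A x = (1 - w K x) - (1 - w (K `|` A) x) by rewrite tmassU//; ring.
have /andP[a0 a1] := c01 x bKA; have /andP[b0 b1] := c01 x bK.
have w0 := tmass_ge0 V x bA.
by rewrite {1 2}wE; apply: pgf_diff => //; rewrite tmassU//; lra.
Qed.

Let pgf_increment_ge0 K A x : borel K -> borel A -> K `&` A = set0 ->
  0 <= G (1 - w K x) - G (1 - w (K `|` A) x).
Proof.
move=> bK bA KA; have bKA : borel (K `|` A) by exact: borelU.
have /andP[+ _] := pgf_increment_bounds x bK bA KA; apply: le_trans.
by rewrite mulr_ge0 ?tmass_ge0// dpgf_ge0// c01.
Qed.

Lemma void_increment_le K A : borel K -> borel A -> K `&` A = set0 ->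
  (void_increment K A <= tangent_mass K A)%E.
Proof.
move=> bK bA KA; apply: ge0_le_integralT => x.
  by rewrite lee_fin pgf_increment_ge0.
by have /andP[_] := pgf_increment_bounds x bK bA KA.
Qed.

(** The slope is evaluated at the union with a larger [A']. With [A] a sector and [A'] its whole
    shell, the error to be controlled no longer depends on the cone. *)
Lemma void_increment_ge K A A' : borel K -> borel A -> borel A' -> K `&` A = set0 ->
  A `<=` A' -> (tangent_mass (K `|` A') A <= void_increment K A)%E.
Proof.
move=> bK bA bA' KA AA'; have bKA : borel (K `|` A) by exact: borelU.
have bKA' : borel (K `|` A') by exact: borelU.
apply: ge0_le_integralT => x.
  by rewrite lee_fin mulr_ge0 ?tmass_ge0// dpgf_ge0// c01.
rewrite lee_fin; have /andP[+ _] := pgf_increment_bounds x bK bA KA; apply: le_trans.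
rewrite ler_wpM2l ?tmass_ge0//.
have /andP[a0 a1] := c01 x bKA; have /andP[b0 b1] := c01 x bKA'.
by apply: dpgf_le => //; rewrite lerD2l lerN2 le_tmass//; exact: setUS.
Qed.

(** Adding [A'] lowers the argument of [dG] by [w A' x], so [dpgf_diff] bounds the change of slope
    by [m1 - dG (1 - w A' x)]; the weight [w A x] is at most [w A' x]. *)
Lemma tangent_mass_error K A A' : borel K -> borel A -> borel A' -> K `&` A' = set0 ->
  A `<=` A' ->
  (tangent_mass K A <= tangent_mass (K `|` A') A + thinning_error mu P1 V eta A')%E.
Proof.
move=> bK bA bA' KA AA'.
have bKA' : borel (K `|` A') by exact: borelU.
have e0 x : 0 <= m1 - dG (1 - w A' x).
  by apply: (dpgf_le_size_mu HL); exact: c01.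
rewrite /tangent_mass /thinning_error -ge0_integralD//; last 4 first.
- by move=> x _; rewrite lee_fin mulr_ge0 ?tmass_ge0// dpgf_ge0// c01.
- by apply: (measurable_tmass_dpgf HL) => //; [exact: measurable_tmass|by move=> x; exact: w01].
- by move=> x _; rewrite lee_fin mulr_ge0 ?tmass_ge0.
- apply/measurable_EFinP; apply: measurable_funM; first exact: measurable_tmass.
  apply: measurable_funB => //; apply: measurable_dpgf => //.
    by apply: measurable_funB => //; exact: measurable_tmass.
  by move=> x; exact: c01.
apply: ge0_le_integralT => x.
  by rewrite lee_fin mulr_ge0 ?tmass_ge0// dpgf_ge0// c01.
rewrite -EFinD lee_fin -lerBlDl -mulrBr.
have /andP[a0 a1] := c01 x bKA'; have /andP[b0 b1] := c01 x bK.
apply: (@le_trans _ _ (w A x * (m1 - dG (1 - w A' x)))); last first.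
  by rewrite ler_wpM2r// le_tmass.
rewrite ler_wpM2l ?tmass_ge0//.
have w0 := tmass_ge0 V x bA'.
have := @dpgf_diff _ _ _ P1 eta meta efin (1 - w (K `|` A') x) (1 - w K x) a0.
rewrite tmassU// (_ : 1 - w K x - (1 - (w K x + w A' x)) = w A' x); last by ring.
apply => //; lra.
Qed.

Lemma void_increment_set0 A : (void_increment set0 A = \int[mu]_x (1 - G (1 - w A x))%:E)%E.
Proof.
apply: eq_integral => x _; rewrite set0U /tmass /mass.
rewrite (_ : [set l | set0 (x + l)] = set0); last by apply/seteqP; split.
by rewrite measure0/= subr0 pgf1.
Qed.

Lemma void_exponentE A : borel A -> (mu A < +oo)%E ->
  (void_exponent A)%:E = (\int[mu]_x (1 - G (1 - w A x))%:E)%E.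
Proof.
move=> bA muA; rewrite /void_exponent fineK// -void_increment_set0 ge0_fin_numE.
  apply: le_lt_trans (void_increment_le _ _ _) _; [exact: borel0|by []|exact: set0I|].
  apply: le_lt_trans (tangent_mass_le _ _) _; [exact: borel0|by []|].
  by rewrite lte_mul_pinfty// lee_fin.
apply: integral_ge0 => x _; rewrite lee_fin pgf_increment_ge0//; [exact: borel0|exact: set0I].
Qed.

Lemma void_exponentU K A : borel K -> borel A -> K `&` A = set0 ->
  (mu K < +oo)%E -> (mu A < +oo)%E ->
  (void_exponent (K `|` A))%:E = ((void_exponent K)%:E + void_increment K A)%E.
Proof.
move=> bK bA KA muK muA.
have bKA : borel (K `|` A) by exact: borelU.
rewrite (void_exponentE bK muK) (void_exponentE bKA); last first.
  apply: le_lt_trans (measureU2 _ _ _) _ => //.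
  by rewrite lte_add_pinfty.
rewrite /void_increment -ge0_integralD//; last 4 first.
- move=> x _; rewrite lee_fin subr_ge0 -[leRHS](pgf1 P1 eta).
  by have /andP[a b] := c01 x bK; apply: pgf_le.
- apply/measurable_EFinP; apply: measurable_funB => //; apply: measurable_pgf => //.
    by apply: measurable_funB => //; exact: measurable_tmass.
  by move=> x; exact: c01.
- by move=> x _; rewrite lee_fin pgf_increment_ge0.
- apply/measurable_EFinP; apply: measurable_funB; apply: measurable_pgf => //;
    try (by move=> x; exact: c01);
    by apply: measurable_funB => //; exact: measurable_tmass.
by apply: eq_integral => x _; rewrite -EFinD; congr EFin; ring.
Qed.

Lemma void_exponent_le A : borel A -> (mu A < +oo)%E -> ((void_exponent A)%:E <= m1%:E * mu A)%E.
Proof.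
move=> bA muA; rewrite void_exponentE// -void_increment_set0.
have b0 : borel (set0 : set 'rV[R]_n) by exact: borel0.
exact: le_trans (void_increment_le b0 bA (set0I _)) (tangent_mass_le b0 bA).
Qed.

Lemma void_exponent_ge0 A : borel A -> 0 <= void_exponent A.
Proof.
move=> bA; rewrite /void_exponent fine_ge0// -void_increment_set0.
apply: integral_ge0 => x _; rewrite lee_fin pgf_increment_ge0//; [exact: borel0|exact: set0I].
Qed.

(** The case of empty [K]: the slope there is [dG] at 1, so the tangent mass is the full first-order
    term [m1 * mu A]. *)
Lemma void_exponent_ge A : borel A -> (mu A < +oo)%E ->
  (m1%:E * mu A <= (void_exponent A)%:E + thinning_error mu P1 V eta A)%E.
Proof.
move=> bA muA; rewrite void_exponentE// -void_increment_set0.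
have b0 : borel (set0 : set 'rV[R]_n) by exact: borel0.
have H := tangent_mass_error b0 bA bA (set0I _) (fun x => id).
apply: (@le_trans _ _ (tangent_mass set0 A)).
  rewrite -(integral_tmass mu_shift V bA) -ge0_integralZl//; last 2 first.
  - by apply/measurable_EFinP; exact: measurable_tmass.
  - by move=> x _; rewrite lee_fin tmass_ge0.
  apply: ge0_le_integralT => x; first by rewrite lee_fin mulr_ge0// tmass_ge0.
  rewrite -EFinM lee_fin mulrC ler_wpM2l ?tmass_ge0//.
  rewrite /tmass /mass (_ : [set l | set0 (x + l)] = set0); last by apply/seteqP; split.
  by rewrite measure0/= subr0 dpgf1.
apply: (le_trans H); rewrite leeD2r//.
exact (void_increment_ge b0 bA bA (set0I _) (fun x => id)).
Qed.
End void_exponent.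

(** * Number of points in small sets *)

Section grid_cells.
Context {R : realType} {n : nat}.

Definition grid_index (k : nat) (v : 'rV[R]_n) : 'rV[int]_n :=
  \row_i Num.floor (k.+1%:R * v ord0 i).

(** Cells are numbered by the code of their integer corner; codes that do not occur give empty
    cells. *)
Definition grid_cell (k j : nat) : set 'rV[R]_n :=
  [set v | choice.pickle (grid_index k v) = j].

Lemma grid_cell_cover k : \bigcup_j grid_cell k j = setT.
Proof. by apply/seteqP; split => // v _; exists (choice.pickle (grid_index k v)). Qed.

Lemma grid_cell_triv k : trivIset setT (grid_cell k).
Proof. by move=> i j _ _ [v []]; rewrite /grid_cell/= => <-. Qed.

Lemma grid_cellE k j v : grid_cell k j v ->
  grid_cell k j = [set u | forall i, (grid_index k v ord0 i)%:~R <= k.+1%:R * u ord0 i <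
                                     (grid_index k v ord0 i + 1)%:~R].
Proof.
move=> vj; apply/seteqP; split => u /=.
  rewrite /grid_cell/= -vj => /(pcan_inj choice.pickleK) <- i.
  by rewrite mxE; exact: floor_itv.
move=> H; rewrite /grid_cell/= -vj; congr choice.pickle; apply/rowP => i.
by rewrite [LHS]mxE; apply: floor_def.
Qed.

Lemma borel_grid_cell k j : borel (grid_cell k j).
Proof.
have [->|/set0P[v vj]] := eqVneq (grid_cell k j) set0; first exact: borel0.
rewrite (grid_cellE vj).
pose z := grid_index k v.
have H : measurable (\bigcap_(i in [set: 'I_n])
  ((fun u : borelType R n => k.+1%:R * (u : 'rV[R]_n) ord0 i) @^-1` `[(z ord0 i)%:~R, (z ord0 i + 1)%:~R[%classic)).
  apply: fin_bigcap_measurable => // i _.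
  rewrite -[X in measurable X]setTI.
  have mf : measurable_fun setT (fun u : borelType R n => k.+1%:R * (u : 'rV[R]_n) ord0 i).
    by apply: measurable_funM => //; exact: measurable_coord.
  exact: mf.
rewrite [X in borel X](_ : _ = \bigcap_(i in [set: 'I_n])
  ((fun u : borelType R n => k.+1%:R * (u : 'rV[R]_n) ord0 i) @^-1` `[(z ord0 i)%:~R, (z ord0 i + 1)%:~R[%classic)); first exact: H.
apply/seteqP; split => u /= h i; first by move=> _; rewrite /= in_itv/=; exact: h.
by have := h i Logic.I; rewrite /= in_itv.
Qed.

(** Distinct points differ in some coordinate and get different integer parts once the mesh is below
    that difference; a finite set has finitely many pairs. *)
Lemma grid_cell_separates (S : set 'rV[R]_n) : finite_set S ->
  exists K, forall k, (K <= k)%N -> forall j u v, S u -> S v ->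
    grid_cell k j u -> grid_cell k j v -> u = v.
Proof.
move=> fS.
have /choice[f Hf] : forall p : 'rV[R]_n * 'rV[R]_n, exists K, p.1 <> p.2 ->
    forall k, (K <= k)%N -> grid_index k p.1 <> grid_index k p.2.
  move=> [u v]/=; have [->|/eqP uv] := eqVneq u v; first by exists 0%N.
  have [i ui] : exists i, u ord0 i != v ord0 i.
    apply: contrapT => H; apply: uv; apply/rowP => i; apply/eqP.
    by apply: contrapT => /negP ?; apply: H; exists i.
  have d0 : 0 < `|u ord0 i - v ord0 i| by rewrite normr_gt0 subr_eq0.
  exists (Num.truncn (`|u ord0 i - v ord0 i|^-1)).+1 => _ k Kk /rowP/(_ i).
  rewrite !mxE => fl.
  have : 1 < k.+1%:R * `|u ord0 i - v ord0 i|.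
    rewrite -ltr_pdivrMr// div1r (lt_le_trans (truncnS_gt _))// ler_nat.
    exact: leq_trans Kk _.
  rewrite -[X in X * _](ger0_norm (ler0n R k.+1)) -normrM mulrBr.
  have := floor_itv (k.+1%:R * u ord0 i); have := floor_itv (k.+1%:R * v ord0 i).
  rewrite fl intrD.
  set a := _%:~R; move=> /andP[h1 h2] /andP[h3 h4].
  have : `|k.+1%:R * u ord0 i - k.+1%:R * v ord0 i| < 1.
    by rewrite ltr_norml; apply/andP; split; move: h1 h2 h3 h4; rewrite mulr1z; lra.
  by move=> h; rewrite ltNge (ltW h).
pose s := fset_set S.
exists (\max_(p <- [seq (u, v) | u <- s, v <- s]) f p)%N => k Kk j u v Su Sv uj vj.
apply: contrapT => uv; apply: (Hf (u, v) uv k); last first.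
  by apply: (pcan_inj choice.pickleK); rewrite uj vj.
apply: leq_trans Kk.
have puv : (u, v) \in [seq (u, v) | u <- s, v <- s].
  by apply/allpairsP; exists (u, v); split => //; rewrite in_fset_set ?inE.
by rewrite (big_rem _ puv)/= leq_maxl.
Qed.

(** A cell lies in the dilate by 1 / (k + 1) of a translated box of half-side 1. As n > 0, the
    volume factor (k + 1) ^ -n is at most 1 / (k + 1). *)
Lemma grid_cell_small (mu : {measure set (borelType R n) -> \bar R}) :
  (0 < n)%N ->
  (forall A x, borel A -> mu [set v | A (v + x)] = mu A) ->
  (forall A r, 0 < r -> borel A -> mu [set v | A (r^-1 *: v)] = ((r ^+ n)%:E * mu A)%E) ->
  (forall k : R, (mu (centered_box k) < +oo)%E) ->
  forall de : R, 0 < de -> exists k, forall k' j, (k <= k')%N -> (mu (grid_cell k' j) < de%:E)%E.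
Proof.
move=> n0 mu_shift mu_scale mu_box de de0.
have bB1 : borel (@centered_box R n 1) by exact: measurable_centered_box.
pose c := fine (mu (centered_box 1)).
have cE : c%:E = mu (centered_box 1) by rewrite /c fineK// ge0_fin_numE.
have c0 : 0 <= c by rewrite -lee_fin cE.
exists (Num.truncn (c / de)) => k j Kk.
have [->|/set0P[v vj]] := eqVneq (grid_cell k j) set0; first by rewrite measure0 lte_fin.
pose z : 'rV[R]_n := \row_i (grid_index k v ord0 i)%:~R.
pose D := [set u : 'rV[R]_n | centered_box 1 (u - z)].
have bD : borel D by exact: borel_shift.
apply: (@le_lt_trans _ _ (mu [set u | D ((k.+1%:R^-1)^-1 *: u)])).
  apply: measure_le; [exact: borel_grid_cell|exact: borel_scale|].
  rewrite (grid_cellE vj) => u /= h i; have /andP[h1 h2] := h i.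
  rewrite invrK !mxE ler_norml; move: h1 h2; rewrite mxE.
  set y := Num.floor _; move=> h1; rewrite intrD mulr1z => h2.
  by apply/andP; split; lra.
rewrite mu_scale ?invr_gt0//.
have -> : mu D = c%:E by rewrite cE; have H := mu_shift _ (- z) bB1; exact: H.
rewrite -EFinM lte_fin.
apply: (@le_lt_trans _ _ (k.+1%:R^-1 * c)).
  rewrite ler_wpM2r// -[leRHS]expr1 ler_wiXn2l//.
  by rewrite invf_le1 ?ltr0n// ler1n.
rewrite mulrC ltr_pdivrMr ?ltr0n// mulrC -ltr_pdivrMr//.
by rewrite (lt_le_trans (truncnS_gt _))// ler_nat.
Qed.
End grid_cells.

(** From exp(- x) <= 1 / (1 + x) <= 1 - x + x ^ 2; it bounds the quadratic error in hitting
    probabilities. *)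
Lemma expR_opp_upper {R : realType} (x : R) : 0 <= x -> x - x ^+ 2 <= 1 - expR (- x).
Proof.
move=> x0; have h : 1 + x <= expR x by exact: expR_ge1Dx.
have x10 : 0 < 1 + x by lra.
have : expR (- x) <= (1 + x)^-1 by rewrite expRN lef_pV2// posrE ?expR_gt0.
have : (1 + x)^-1 <= 1 - x + x ^+ 2.
  by rewrite -[leLHS]mul1r ler_pdivrMr//; have := exprn_ge0 3 x0; rewrite !expr2 !exprS expr0; lra.
lra.
Qed.

Section counts.
Context {R : realType} {n : nat}.
Hypothesis n0 : (0 < n)%N.
Variable mu : {sigma_finite_measure set (borelType R n) -> \bar R}.
Hypothesis muE : forall A, borel A -> mu A = lebesgue_rV A.
Hypothesis mu_shift : forall A x, borel A -> mu [set v | A (v + x)] = mu A.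
Hypothesis mu_scale : forall A r, 0 < r -> borel A -> mu [set v | A (r^-1 *: v)] = ((r ^+ n)%:E * mu A)%E.
Hypothesis mu_box : forall k : R, (mu (centered_box k) < +oo)%E.
Context {d d1 : measure_display} {O : measurableType d} {O1 : measurableType d1}.
Variables (P : probability O R) (P1 : probability O1 R) (lambda : R).
Variables (N : O -> set 'rV[R]_n) (Ltyp : O1 -> set 'rV[R]_n).
Variables (V : probability (borelType R n) R) (eta : O1 -> nat).
Hypothesis HN : poisson_cluster_process P P1 lambda N Ltyp.
Hypothesis HL : neyman_scott_cluster P1 V eta Ltyp.
Local Notation m1 := (size_mu P1 eta).
Local Notation ve := (void_exponent mu P1 V eta).
Local Notation rho := (lambda * m1).
Implicit Types A K : set 'rV[R]_n.

Let lambda0 : 0 < lambda. Proof. by case: HN. Qed.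
Let m10 : 0 < m1.
Proof. exact (size_mu_gt0 (ns_eta_fin HL) (ns_eta_gt0 HL)). Qed.
Let rho0 : 0 < rho. Proof. exact: mulr_gt0 lambda0 m10. Qed.

Lemma void_probability A : borel A -> (mu A < +oo)%E ->
  P [set w | N w `&` A = set0] = (expR (- (lambda * ve A)))%:E.
Proof.
move=> bA muA; apply: (cluster_process_avoidance muE mu_box HN bA) => [x|].
  by rewrite (neyman_scott_void HL)//; exact: borel_translate.
by rewrite -(void_exponentE mu_shift HL bA muA) ltry.
Qed.

Definition hit A := [set w | (N w `&` A) !=set0].

Lemma hitE A : hit A = ~` [set w | N w `&` A = set0].
Proof.
by apply/seteqP; split => w /=; [move/set0P/eqP|move/eqP/set0P].
Qed.

Lemma measurable_hit A : borel A -> measurable (hit A).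
Proof. by move=> bA; rewrite hitE; apply: measurableC; exact (measurable_avoid HN bA). Qed.

Lemma hit_probability A : borel A -> (mu A < +oo)%E ->
  P (hit A) = (1 - expR (- (lambda * ve A)))%:E.
Proof.
move=> bA muA; rewrite hitE probability_setC; last exact (measurable_avoid HN bA).
by rewrite void_probability// EFinB.
Qed.

Lemma hit_probability_le A : borel A -> (mu A < +oo)%E -> (P (hit A) <= rho%:E * mu A)%E.
Proof.
move=> bA muA; rewrite hit_probability//.
apply: (@le_trans _ _ (lambda * ve A)%:E).
  by rewrite lee_fin lerBlDr -lerBlDl; have := expR_ge1Dx (- (lambda * ve A)).
rewrite !EFinM -muleA; apply: lee_wpmul2l; first by rewrite lee_fin ltW.
exact (void_exponent_le mu_shift HL bA muA).
Qed.

Hypothesis Hdiff : forall A, borel A -> lebesgue_rV A = 0%E -> difference_measure P1 Ltyp A = 0%E.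

(** The hitting probability is 1 - exp(- x) with x = [lambda * ve A]. The thinning error controls x
    from below, and x ^ 2 is of higher order than [mu A]. *)
Lemma hit_probability_ge e : 0 < e -> exists2 de, 0 < de & forall A, borel A ->
  (mu A < de%:E)%E -> (rho%:E * mu A <= P (hit A) + e%:E * mu A)%E.
Proof.
move=> e0.
have e10 : 0 < e / 2 / lambda by rewrite !divr_gt0.
have [de1 de10 H1] := thinning_error_small muE mu_shift HL Hdiff e10.
(* Below this volume the square of [rho * mu A] is at most [e / 2 * mu A]. *)
pose de2 := e / 2 / rho ^+ 2.
have de20 : 0 < de2 by rewrite /de2 !divr_gt0// exprn_gt0.
exists (Num.min de1 de2); first by rewrite lt_min de10.
move=> A bA muA.
have [muA1 muA2] : (mu A < de1%:E)%E /\ (mu A < de2%:E)%E.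
  by split; apply: (lt_le_trans muA); rewrite lee_fin ge_min lexx ?orbT.
have muAf : (mu A < +oo)%E by rewrite (lt_le_trans muA1)// leey.
have aE : (fine (mu A))%:E = mu A by rewrite fineK// ge0_fin_numE.
move: (H1 A bA muA1) (void_exponent_ge mu_shift HL bA muAf) (void_exponent_le mu_shift HL bA muAf) muA2.
have a0 : 0 <= fine (mu A) by rewrite fine_ge0.
have ve0 := @void_exponent_ge0 _ _ mu _ _ P1 V eta Ltyp HL A bA.
rewrite hit_probability//.
rewrite -aE -!EFinM !lee_fin lte_fin => HE Hge Hle aD.
have {HE}Hge : m1 * fine (mu A) <= ve A + e / 2 / lambda * fine (mu A).
  by rewrite -lee_fin EFinD (le_trans Hge)// leeD2l.
set a := fine (mu A) in a0 Hle aD Hge *; set x := ve A in ve0 Hge Hle *.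
have x0 : 0 <= lambda * x by rewrite mulr_ge0// ltW.
have h1 : rho * a <= lambda * x + e / 2 * a.
  rewrite -mulrA (le_trans (ler_wpM2l (ltW lambda0) Hge))// mulrDr lerD2l.
  by rewrite mulrA (mulrC lambda) divfK// gt_eqF.
have h2 : lambda * x <= rho * a by rewrite -mulrA ler_wpM2l// ltW.
have h3 : (lambda * x) ^+ 2 <= e / 2 * a.
  apply: (@le_trans _ _ ((rho * a) ^+ 2)); first by rewrite lerXn2r// nnegrE mulr_ge0// ltW.
  rewrite exprMn (expr2 a) mulrA ler_wpM2r//.
  have := ltW aD; rewrite /de2 ler_pdivlMr ?exprn_gt0//.
  by rewrite (mulrC a).
have := expR_opp_upper x0.
lra.
Qed.

(** A sum of indicators of hitting events, whose probabilities are explicit; it bounds the count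
    from below and reaches it once the grid separates the points. *)
Definition occupied_cells A (k : nat) (w : O) : \bar R :=
  (\sum_(0 <= j <oo) (\1_(hit (A `&` grid_cell k j)) w : R)%:E)%E.

Let bcell A k j : borel A -> borel (A `&` grid_cell k j).
Proof. by move=> bA; apply: borelI => //; exact: borel_grid_cell. Qed.

Lemma measurable_occupied_cells A k : borel A -> measurable_fun setT (occupied_cells A k).
Proof.
move=> bA; apply: ge0_emeasurable_sum => [j w _ _|j _]; first by rewrite lee_fin.
by apply/measurable_EFinP; apply: measurable_indic; apply: measurable_hit; exact: bcell.
Qed.

Lemma integral_occupied_cells A k : borel A ->
  (\int[P]_w occupied_cells A k w = \sum_(0 <= j <oo) P (hit (A `&` grid_cell k j)))%E.
Proof.
move=> bA; have mh j : measurable (hit (A `&` grid_cell k j)) by apply: measurable_hit; exact: bcell.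
rewrite /occupied_cells integral_nneseries//.
  by apply: eq_eseriesr => j _; rewrite integral_indic// setIT.
by move=> j; apply/measurable_EFinP; exact: measurable_indic.
Qed.

Let count_cells A k w :
  count_in A (N w) = (\sum_(0 <= j <oo) count_in (A `&` grid_cell k j) (N w))%E :> \bar R.
Proof.
rewrite /count_in -counting_bigcup.
  congr counting; rewrite -[in LHS](setIT (N w `&` A)) -(grid_cell_cover k) setI_bigcupr.
  by apply: eq_bigcupr => j _; rewrite setIA.
by move=> i j _ _ [v [[_ [_ vi]] [_ [_ vj]]]]; apply: (@grid_cell_triv R n k i j) => //; exists v.
Qed.

Let indic_hit A w : ((\1_(hit A) w : R)%:E <= count_in A (N w))%E.
Proof.
rewrite indicE; have [/set_mem hA|_] := boolP (w \in hit A); last exact: counting_ge0.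
exact/counting_ge1.
Qed.

Lemma occupied_cells_le A k w : (occupied_cells A k w <= count_in A (N w))%E.
Proof.
rewrite (count_cells A k); apply: lee_nneseries => j _ //; exact: indic_hit.
Qed.

Lemma occupied_cells_cvg A (r : R) w : A `<=` centered_box r ->
  occupied_cells A k w @[k --> \oo] --> (count_in A (N w) : \bar R).
Proof.
move=> Ar; have [_ _ [lfN _] _] := HN.
have fS : finite_set (N w `&` A) by apply: lfN; exact: (bounded_centered_box Ar).
have [K HK] := grid_cell_separates fS.
apply: cvg_near_cst; exists K => // k /= Kk.
rewrite (count_cells A k); apply: eq_eseriesr => j _.
apply/eqP; rewrite eq_le indic_hit/= indicE.
have [/set_mem [v [Nv [Av vj]]]|/negP hA] := boolP (w \in hit _).
  rewrite /count_in (_ : N w `&` _ = [set v]) ?counting_set1//.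
  apply/seteqP; split => [u [Nu [Au uj]]|u ->]//=.
  by apply: (HK k Kk j).
rewrite /count_in (_ : N w `&` _ = set0) ?counting0//.
apply: contrapT => /eqP/set0P h; apply: hA; exact/mem_set.
Qed.

Let mu_cells A k : borel A -> (\sum_(0 <= j <oo) mu (A `&` grid_cell k j) = mu A)%E.
Proof.
move=> bA; rewrite -[in RHS](setIT A) -(grid_cell_cover k) setI_bigcupr measure_bigcup//.
- by apply: eq_eseriesl => j; rewrite in_setT.
- by move=> j _; exact: bcell.
by move=> i j _ _ [v [[_ vi] [_ vj]]]; apply: (@grid_cell_triv R n k i j) => //; exists v.
Qed.

Let cell_le A k j : borel A -> (mu (A `&` grid_cell k j) <= mu (grid_cell k j))%E.
Proof.
by move=> bA; apply: measure_le; [exact: bcell|exact: borel_grid_cell|exact: subIsetr].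
Qed.

Let cell_fin A (r : R) : borel A -> A `<=` centered_box r -> (mu A < +oo)%E.
Proof.
move=> bA Ar; apply: le_lt_trans (mu_box r); apply: measure_le => //.
exact: measurable_centered_box.
Qed.

(* Fatou: as the grid is refined, the number of occupied cells tends to the number
   of points. *)
Lemma mean_count_le A (r : R) : borel A -> A `<=` centered_box r ->
  (\int[P]_w count_in A (N w) <= rho%:E * mu A)%E.
Proof.
move=> bA Ar.
have occ0 k w : (0 <= occupied_cells A k w)%E.
  by apply: nneseries_ge0 => j _ _; rewrite lee_fin.
have H := fatou P measurableT (fun k => measurable_occupied_cells k bA) (fun k w _ => occ0 k w).
have E : (\int[P]_w limn_einf (fun k => occupied_cells A k w) = \int[P]_w count_in A (N w))%E.
  by apply: eq_integral => w _; have [->] := cvg_limn_einf_sup (@occupied_cells_cvg A r w Ar).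
rewrite -E; apply: (le_trans H).
rewrite limn_einf_lim; apply: lime_le; first exact: is_cvg_einfs.
near=> k; apply: (@le_trans _ _ (\int[P]_w occupied_cells A k w)%E).
  by apply: ereal_inf_lbound; exists k => //=.
rewrite integral_occupied_cells// -(mu_cells k bA) -nneseriesZl//.
apply: lee_nneseries => // j _; apply: hit_probability_le; first exact: bcell.
by apply: (@cell_fin _ r); [exact: bcell|move=> v [/Ar]].
Unshelve. all: by end_near. Qed.

(** Occupied cells never outnumber the points, and in cells of small volume the hitting probability
    is nearly [rho] times the volume; summing over the cells loses at most e. *)
Lemma mean_count_ge A (r : R) : borel A -> A `<=` centered_box r ->
  (rho%:E * mu A <= \int[P]_w count_in A (N w))%E.
Proof.
move=> bA Ar; have muA := cell_fin bA Ar.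
have aE : (fine (mu A))%:E = mu A by rewrite fineK// ge0_fin_numE.
have a0 : 0 <= fine (mu A) by rewrite fine_ge0.
apply/lee_addgt0Pr => e e0.
(* The summand 1 guards against a set of volume zero. *)
pose e' := e / (fine (mu A) + 1).
have e'0 : 0 < e' by rewrite divr_gt0// ltr_wpDl.
have [de de0 Hde] := hit_probability_ge e'0.
have [k Hk] := grid_cell_small n0 mu_shift mu_scale mu_box de0.
apply: (@le_trans _ _ (\int[P]_w occupied_cells A k w + e'%:E * mu A)%E).
  rewrite integral_occupied_cells// -(mu_cells k bA) -!nneseriesZl//.
  rewrite -nneseriesD//; last by move=> j _ _; rewrite mule_ge0// lee_fin ltW.
  apply: lee_nneseries => [j _ _|j _]; first by rewrite mule_ge0// lee_fin ltW.
  apply: Hde; first exact: bcell.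
  exact: le_lt_trans (cell_le k j bA) (Hk k j (leqnn k)).
apply: leeD.
  by apply: ge0_le_integralT => w; [apply: nneseries_ge0 => j _ _; rewrite lee_fin|exact: occupied_cells_le].
rewrite -aE -EFinM lee_fin /e' -mulrA ler_piMr//; first exact: ltW.
by rewrite mulrC ler_pdivrMr ?ltr_wpDl// mul1r lerDl.
Qed.

(** The mean count exceeds the hitting probability by at least the probability of two points, yet
    both equal [rho * mu A] up to [e * mu A]. *)
Lemma two_points_small e : 0 < e -> exists2 de, 0 < de & forall A (r : R), borel A ->
  A `<=` centered_box r -> (mu A < de%:E)%E ->
  (P [set w | (2%:R%:E <= count_in A (N w))%E] <= e%:E * mu A)%E.
Proof.
move=> e0; have [de de0 Hde] := hit_probability_ge e0.
exists de => // A r bA Ar muA.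
have muAf := cell_fin bA Ar.
have [_ _ [_ mN] _] := HN.
pose T := [set w | (2%:R%:E <= count_in A (N w) :> \bar R)%E].
have mT : measurable T.
  rewrite /T -[X in measurable X]setTI; apply: emeasurable_fun_c_infty => //; exact: mN.
have mH := measurable_hit bA.
(* 1{N(A) >= 2} + 1{N(A) >= 1} <= N(A) *)
have : (P T + P (hit A) <= \int[P]_w count_in A (N w))%E.
  have E S : measurable S -> P S = (\int[P]_w (\1_S w : R)%:E)%E.
    by move=> mS; rewrite integral_indic// setIT.
  rewrite (E T mT) (E _ mH) -ge0_integralD//; last 2 first.
  - by apply/measurable_EFinP; exact: measurable_indic.
  - by apply/measurable_EFinP; exact: measurable_indic.
  apply: ge0_le_integralT => w; first by rewrite adde_ge0// lee_fin.
  rewrite indicE; have [/set_mem Tw|_] := boolP (w \in T); last by rewrite add0e indic_hit.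
  apply: le_trans Tw; rewrite -EFinD lee_fin indicE.
  by rewrite -natrD ler_nat; case: (w \in hit A).
move=> /le_trans/(_ (mean_count_le bA Ar)) H1.
have H2 := Hde A bA muA.
have Hfin : P (hit A) \is a fin_num by exact: fin_num_measure.
by have := le_trans H1 H2; rewrite addeC leeD2lE.
Qed.
End counts.

(** * Gauge of the structuring body *)

Section gauge.
Context {R : realType} {n : nat}.
Variable B : set 'rV[R]_n.
Hypothesis Bcompact : compact B.
Hypothesis Bconvex : convex_set (B : set (convex_lmodType 'rV[R]_n)).
Hypothesis B0 : nbhs (0 : 'rV[R]_n) B.
Implicit Types (x y : 'rV[R]_n) (r s t : R).

(** Minkowski functional of [B] itself and not of its reflection: contact is sought in 0 + tB, so
    the gauge of a point is its distance from the origin. *)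
Definition gauge y : R := inf [set s | 0 <= s /\ exists2 b, B b & y = s *: b].

Let convB a b p : 0 <= p <= 1 -> B a -> B b -> B (p *: a + (1 - p) *: b).
Proof.
move=> /andP[p0 p1] Ba Bb.
have := Bconvex (Itv01 p0 p1) (mem_set Ba : (a : convex_lmodType 'rV[R]_n) \in B) (mem_set Bb).
by rewrite inE.
Qed.

Let B00 : B 0. Proof. exact: nbhs_singleton B0. Qed.

Let starB b p : 0 <= p <= 1 -> B b -> B (p *: b).
Proof. by move=> p01 Bb; have := convB p01 Bb B00; rewrite scaler0 addr0. Qed.

Let ball0 : exists2 e, 0 < e & forall x, `|x| < e -> B x.
Proof.
have /nbhs_ballP[e /= e0 eB] := B0; exists e => // x xe; apply: eB.
by rewrite mx_norm_ball /ball_/= sub0r normrN.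
Qed.

Let boundB : exists2 M, 0 < M & forall x, B x -> `|x| <= M.
Proof.
have [M [_ HM]] := compact_bounded Bcompact.
exists (`|M| + 1); first by rewrite ltr_wpDl.
by move=> x Bx; apply: HM => //; rewrite (le_lt_trans (ler_norm _))// ltrDl.
Qed.

Let gauge_set y := [set s | 0 <= s /\ exists2 b, B b & y = s *: b].

Let gauge_set_upper y s t : gauge_set y s -> s <= t -> gauge_set y t.
Proof.
move=> [s0 [b Bb ->]] st; have t0 := le_trans s0 st; split => //.
have [t00|tn0] := eqVneq t 0.
  rewrite t00 in st *; have -> : s = 0 by apply/eqP; rewrite eq_le st.
  by exists b => //; rewrite !scale0r.
exists ((s / t) *: b); last by rewrite scalerA mulrC divfK.
apply: starB => //; rewrite divr_ge0//= ler_pdivrMr ?mul1r//.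
by rewrite lt0r tn0.
Qed.

Let gauge_set_neq0 y : gauge_set y !=set0.
Proof.
have [e e0 eB] := ball0.
(* Large enough for y / s to have norm at most e / 2. *)
pose s := (`|y| + 1) / (e / 2).
have s0 : 0 < s by rewrite !divr_gt0// ltr_wpDl.
exists s; split; first exact: ltW.
exists (s^-1 *: y); last by rewrite scalerA divff ?scale1r// gt_eqF.
apply: eB; rewrite normrZ gtr0_norm ?invr_gt0// /s invf_div -mulrA.
have : (`|y| + 1)^-1 * `|y| <= 1.
  by rewrite mulrC ler_pdivrMr ?ltr_wpDl// mul1r lerDl.
move=> /(ler_wpM2l (ltW (divr_gt0 e0 (ltr0n R 2)))) /le_lt_trans; apply.
by rewrite mulr1 ltr_pdivrMr// ltr_pMr// ltr1n.
Qed.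

Let gauge_lb y : lbound (gauge_set y) 0. Proof. by move=> s []. Qed.

Lemma gauge_ge0 y : 0 <= gauge y.
Proof. by apply: lb_le_inf; [exact: gauge_set_neq0|exact: gauge_lb]. Qed.

Let gauge_lt y s : gauge y < s -> gauge_set y s.
Proof.
move=> ys; have s0 : 0 < s - gauge y by rewrite subr_gt0.
have hi : has_inf (gauge_set y) by split; [exact: gauge_set_neq0|exists 0; exact: gauge_lb].
have [t ty ts] := inf_adherent s0 hi.
apply: (gauge_set_upper ty); rewrite ltW//.
by move: ts; rewrite -[inf _]/(gauge y) addrC subrK.
Qed.

(** The infimum is attained: for s > 0 because [B] is closed, for s = 0 because [B] is bounded,
    which forces y = 0. *)
Lemma gaugeP y s : 0 <= s -> gauge y <= s <-> exists2 b, B b & y = s *: b.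
Proof.
move=> s0; split=> [ys|[b Bb ys]]; last first.
  by apply: ge_inf; [exists 0; exact: gauge_lb|split => //; exists b].
have H k : gauge_set y (s + k.+1%:R^-1).
  by apply: gauge_lt; rewrite (le_lt_trans ys)// ltrDl invr_gt0.
have [s00|sn0] := eqVneq s 0.
  rewrite s00 in H *; exists 0 => //; rewrite scale0r; apply/normr0_eq0/eqP; rewrite eq_le normr_ge0 andbT.
  have [M M0 HM] := boundB.
  rewrite leNgt; apply/negP => y0.
  pose k := Num.truncn (M / `|y|).
  have [_ [b Bb yb]] := H k.
  have : `|y| <= k.+1%:R^-1 * M.
    by rewrite {1}yb normrZ add0r gtr0_norm ?invr_gt0// ler_wpM2l ?HM// invr_ge0.
  rewrite mulrC ler_pdivlMr ?ltr0n// mulrC -ler_pdivlMr// leNgt => /negP; apply.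
  exact: truncnS_gt.
have sp : 0 < s by rewrite lt0r sn0.
exists (s^-1 *: y); last by rewrite scalerA divff// scale1r.
have cB : closed B by apply: compact_closed => //; exact: norm_hausdorff.
have Hc : (s + k.+1%:R^-1)^-1 *: y @[k --> \oo] --> s^-1 *: y.
  apply: cvgZr_tmp.
  apply: cvgV => //.
  rewrite -[X in _ --> X]addr0; apply: cvgD; [exact: cvg_cst|exact: cvg_harmonic].
apply: (closed_cvg _ cB _ _ Hc); near=> k.
have [sk [b Bb ->]] := H k.
rewrite scalerA mulVf ?scale1r// gt_eqF// ltr_wpDr//.
Unshelve. all: by end_near. Qed.

Lemma gaugeZ r y : 0 <= r -> gauge (r *: y) = r * gauge y.
Proof.
have le_gaugeZ a z : 0 <= a -> gauge (a *: z) <= a * gauge z.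
  move=> a0; have [b Bb zb] := (gaugeP z (gauge_ge0 z)).1 (lexx _).
  apply/gaugeP; first by rewrite mulr_ge0 ?gauge_ge0.
  by exists b => //; rewrite {1}zb scalerA.
move=> r0; apply/eqP; rewrite eq_le le_gaugeZ//=.
have [->|rn0] := eqVneq r 0; first by rewrite mul0r gauge_ge0.
have rp : 0 < r by rewrite lt0r rn0.
rewrite -ler_pdivlMl//.
have := le_gaugeZ r^-1 (r *: y); rewrite scalerA mulVf// scale1r; apply.
by rewrite invr_ge0.
Qed.

(** Convexity of [B], with weights proportional to the two gauges. *)
Lemma gaugeD x y : gauge (x + y) <= gauge x + gauge y.
Proof.
have [a Ba xa] := (gaugeP x (gauge_ge0 x)).1 (lexx _).
have [b Bb yb] := (gaugeP y (gauge_ge0 y)).1 (lexx _).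
have x0 := gauge_ge0 x; have y0 := gauge_ge0 y.
apply/gaugeP; first by rewrite addr_ge0.
have [s0|sn0] := eqVneq (gauge x + gauge y) 0.
  have gx : gauge x = 0 by lra.
  have gy : gauge y = 0 by lra.
  by exists 0 => //; rewrite s0 scale0r xa yb gx gy !scale0r addr0.
have sp : 0 < gauge x + gauge y by rewrite lt0r sn0 addr_ge0.
pose p := gauge x / (gauge x + gauge y).
exists (p *: a + (1 - p) *: b).
  apply: convB => //; rewrite /p divr_ge0 ?addr_ge0//= ler_pdivrMr// mul1r lerDl//.
rewrite scalerDr !scalerA {1}xa {1}yb /p mulrC divfK//; congr (_ + _ *: _).
by field.
Qed.

Lemma gauge0 : gauge 0 = 0.
Proof. by have := gaugeZ 0 (lexx 0); rewrite scale0r mul0r; apply. Qed.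

Lemma gauge_eq0 y : gauge y = 0 -> y = 0.
Proof.
move=> y0; have [|b _ ->] := (gaugeP y (lexx 0)).1; first by rewrite y0.
by rewrite scale0r.
Qed.

Lemma gauge_gt0 y : y <> 0 -> 0 < gauge y.
Proof.
by move=> yn0; rewrite lt0r gauge_ge0 andbT; apply/eqP => /gauge_eq0.
Qed.

Definition gauge_disk s : set 'rV[R]_n := [set y | gauge y <= s].

Lemma gauge_disk_box s : exists k : R, gauge_disk s `<=` centered_box k.
Proof.
have [M M0 HM] := boundB; exists (`|s| * M) => y ys i.
have [|b Bb ->] := (gaugeP y (normr_ge0 s)).1; first exact: le_trans ys (ler_norm s).
rewrite mxE normrM normr_id ler_wpM2l//.
apply: le_trans (HM b Bb).
rewrite [leRHS]/Num.norm/= mx_normrE.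
exact: (@le_bigmax _ _ _ 0 (fun ij : 'I_1 * 'I_n => `|b ij.1 ij.2|) (ord0, i)).
Qed.

Lemma borel_gauge_disk s : borel (gauge_disk s).
Proof.
have [s0|s0] := ltP s 0.
  rewrite (_ : gauge_disk s = set0); first exact: borel0.
  apply/seteqP; split => // y /= ys; have := gauge_ge0 y.
  by move: ys; rewrite /gauge_disk/=; lra.
have cB : closed B by apply: compact_closed => //; exact: norm_hausdorff.
have [->|sn0] := eqVneq s 0.
  rewrite (_ : gauge_disk 0 = [set 0]).
    by apply: closed_borel; exact/accessible_closed_set1/hausdorff_accessible/norm_hausdorff.
  apply/seteqP; split => y /= => [|->]; last by rewrite /gauge_disk/= gauge0.
  by move=> y0; apply: gauge_eq0; apply/eqP; rewrite eq_le y0 gauge_ge0.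
have bB : borel B by exact: closed_borel.
rewrite (_ : gauge_disk s = [set y | B (s^-1 *: y)]); first exact: borel_scale.
apply/seteqP; split => y /=.
  move=> /(gaugeP y s0)[b Bb ->]; by rewrite scalerA mulVf// scale1r.
move=> Bsy; apply/(gaugeP y s0); exists (s^-1 *: y) => //.
by rewrite scalerA divff// scale1r.
Qed.

Lemma measurable_gauge : measurable_fun setT (gauge : borelType R n -> R).
Proof.
apply: (measurability (RGenInftyO.G (R:=R))); first exact: RGenInftyO.measurableE.
move=> _ [_ [x ->] <-]; rewrite setTI.
rewrite (_ : _ @^-1` _ = \bigcup_k gauge_disk (x - k.+1%:R^-1)).
  apply: bigcup_measurable => k _; exact: borel_gauge_disk.
apply/seteqP; split => y /=.
  rewrite in_itv/= => yx.
  have d0 : 0 < x - gauge y by rewrite subr_gt0.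
  exists (Num.truncn (x - gauge y)^-1) => //.
  rewrite /gauge_disk/= lerBrDr -lerBrDl -[leRHS]invrK lef_pV2 ?posrE ?invr_gt0//.
  exact/ltW/truncnS_gt.
move=> [k _]; rewrite /gauge_disk/= in_itv/= => h.
by apply: le_lt_trans h _; rewrite ltrBlDr ltrDl invr_gt0.
Qed.
End gauge.

(** * Distance and direction to the nearest point *)

Lemma seq_gap {R : realDomainType} {T : eqType} (g : T -> R) (s : R) (l : seq T) :
  exists2 m, s < m & forall y, y \in l -> s < g y -> m <= g y.
Proof.
elim: l => [|a l [m sm H]]; first by exists (s + 1) => //; rewrite ltrDl.
have [sa|sa] := ltP s (g a).
  exists (Num.min m (g a)); first by rewrite lt_min sm.
  move=> y; rewrite inE => /orP[/eqP -> _|yl sy]; first by rewrite ge_min lexx orbT.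
  by rewrite ge_min H.
exists m => // y; rewrite inE => /orP[/eqP ->|]; last exact: H.
by rewrite ltNge sa.
Qed.

Section contact.
Context {R : realType} {n : nat}.
Variable B : set 'rV[R]_n.
Hypothesis Bcompact : compact B.
Hypothesis Bconvex : convex_set (B : set (convex_lmodType 'rV[R]_n)).
Hypothesis B0 : nbhs (0 : 'rV[R]_n) B.
Local Notation ga := (gauge B).
Local Notation disk := (gauge_disk B).
Variable u0 : 'rV[R]_n.
Implicit Types (y : 'rV[R]_n) (K C : set 'rV[R]_n) (s : R).

Let ga0 y : 0 <= ga y. Proof. exact: gauge_ge0. Qed.

Lemma gauge_ballE t y : 0 <= t -> gauge_ball B 0 t y <-> ga y <= t.
Proof.
move=> t0; rewrite (gaugeP Bcompact Bconvex B0)//.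
by split=> -[b Bb]; rewrite ?add0r => E; exists b => //; rewrite add0r.
Qed.

(** The disk of radius s + 1 holds finitely many points of [K], so gauges beyond s cannot accumulate
    at s. *)
Lemma gauge_gap K s : locally_finite K ->
  exists2 m, s < m & forall y, K y -> s < ga y -> m <= ga y.
Proof.
move=> lK; have [k Hk] := gauge_disk_box Bcompact Bconvex B0 (s + 1).
have fK : finite_set (K `&` disk (s + 1)) by apply: lK; exact: bounded_centered_box Hk.
have [m sm H] := seq_gap ga s (fset_set (K `&` disk (s + 1))).
exists (Num.min m (s + 1)); first by rewrite lt_min sm/= ltrDl.
move=> y Ky sy; rewrite ge_min; have [ys|ys] := leP (ga y) (s + 1); last by rewrite (ltW ys) orbT.
by rewrite H// in_fset_set// inE.
Qed.

(** In general an infimum equal to s need not come from a point at gauge at most s; the gap above s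
    excludes this. *)
Lemma dist_le K s : locally_finite K -> 0 <= s ->
  (dist_B B 0 K <= s%:E)%E <-> (K `&` disk s) !=set0.
Proof.
move=> lK s0; split=> [ds|[y [Ky ys]]]; last first.
  apply: ereal_inf_lbound; exists s => //; split => //; exists y; split => //.
  exact/gauge_ballE.
apply: contrapT => H; have [m sm Hm] := gauge_gap s lK.
have : (m%:E <= dist_B B 0 K)%E.
  apply: le_ereal_inf_tmp => _ [t [t0 [y [yt Ky]]] <-].
  move/(gauge_ballE y t0) : yt => yt; rewrite lee_fin (le_trans _ yt)// Hm//.
  by rewrite ltNge; apply/negP => ys; apply: H; exists y.
by move=> /le_trans/(_ ds); rewrite lee_fin leNgt sm.
Qed.

Lemma dist_unique K q y : K `&` disk q = [set y] -> dist_B B 0 K = (ga y)%:E.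
Proof.
move=> KE; have [Ky yq] : (K `&` disk q) y by rewrite KE.
apply/eqP; rewrite eq_le; apply/andP; split.
  apply: ereal_inf_lbound; exists (ga y) => //; split => //; exists y; split => //.
  exact/gauge_ballE.
apply: le_ereal_inf_tmp => _ [t [t0 [z [zt Kz]]] <-].
move/(gauge_ballE z t0) : zt => zt; rewrite lee_fin leNgt; apply/negP => ty.
have : (K `&` disk q) z.
  by split => //; rewrite /gauge_disk/= (le_trans zt)// (le_trans (ltW ty)).
rewrite KE => /= zy; move: zt; rewrite zy leNgt ty//.
Qed.

Lemma contact_unique K q y : K `&` disk q = [set y] -> contact_set B 0 K = [set y].
Proof.
move=> KE; have [Ky yq] : (K `&` disk q) y by rewrite KE.
rewrite /contact_set (dist_unique KE)/=; apply/seteqP; split => z /=.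
  move=> [/(gauge_ballE z (ga0 y)) zy Kz].
  by rewrite -[z = y]/([set y] z) -KE; split => //; exact: le_trans zy yq.
by move=> ->; split => //; exact/gauge_ballE.
Qed.

Definition proper_contact K := (0 < dist_B B 0 K < +oo)%E /\
         exists y, contact_set B 0 K = [set y].

(** Value of [dir_B] when y is the unique nearest point. It is unchanged by positive dilations,
    which makes [cone] a cone. *)
Definition direction y : 'rV[R]_n := (ga y)^-1 *: (- y).

Definition cone C : set 'rV[R]_n := [set y | y <> 0 /\ C (direction y)].

Lemma proper_unique K q y : y <> 0 -> K `&` disk q = [set y] ->
  proper_contact K /\ dir_B B u0 K 0 = direction y.
Proof.
move=> y0 KE; have cE := contact_unique KE; have dE := dist_unique KE.
have pK : proper_contact K.
  split; last by exists y.
  by rewrite dE lte_fin ltry andbT gauge_gt0.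
split => //; rewrite /dir_B; case: asboolP => // _.
have -> : [get x | contact_set B 0 K x] = y by rewrite cE; apply: get_unique.
by rewrite dE sub0r.
Qed.

Lemma proper_gap K : locally_finite K -> proper_contact K -> exists y m,
  [/\ y <> 0, ga y < m, dist_B B 0 K = (ga y)%:E &
      forall q, ga y <= q < m -> K `&` disk q = [set y]].
Proof.
move=> lK [/andP[d0 dfin] [y cE]].
have [m ym Hm] := gauge_gap (ga y) lK.
have dE : (fine (dist_B B 0 K))%:E = dist_B B 0 K by rewrite fineK// ge0_fin_numE// ltW.
have fd0 : 0 < fine (dist_B B 0 K) by rewrite -lte_fin dE.
have [yd Ky] : contact_set B 0 K y by rewrite cE.
move/(gauge_ballE y (ltW fd0)) : yd => yd.
have dy : (dist_B B 0 K <= (ga y)%:E)%E by apply/dist_le => //; exists y; split => //; exact: lexx.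
have yE : dist_B B 0 K = (ga y)%:E.
  by apply/eqP; rewrite eq_le dy -dE lee_fin.
have min z : K z -> ga y <= ga z.
  move=> Kz; rewrite -lee_fin -yE; apply/dist_le => //; exists z; split => //; exact: lexx.
exists y, m; split => //.
  move=> y0; move: d0; rewrite yE y0 (gauge0 Bcompact Bconvex B0) ltxx//.
move=> q /andP[yq qm]; apply/seteqP; split => z /=; last by move=> ->.
move=> [Kz zq]; rewrite -[z = y]/([set y] z) -cE /contact_set yE/=; split => //.
apply/gauge_ballE => //; rewrite leNgt; apply/negP => yz.
by have := Hm z Kz yz; move: (le_lt_trans zq qm); rewrite ltNge => /negP.
Qed.

(* Local finiteness provides a rational radius between the nearest point and the
   others, which makes the event a countable union. *)
Lemma proper_dirP K C s : locally_finite K -> 0 <= s ->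
  [/\ (dist_B B 0 K <= s%:E)%E, proper_contact K & C (dir_B B u0 K 0)] <->
  exists (r : rat) y, K `&` disk (Num.min s (ratr r)) = [set y] /\ cone C y.
Proof.
move=> lK s0; split=> [[ds pK Cd]|[r [y [KE [y0 Cy]]]]].
  have [y [m [y0 ym dE H]]] := proper_gap lK pK.
  have [r _ /andP[yr rm]] : exists2 r : rat, True & ga y < ratr r < m.
    by have [r] := rat_in_itvoo ym; rewrite in_itv/= => ?; exists r.
  have ys : ga y <= s by rewrite -lee_fin -dE.
  have KE : K `&` disk (Num.min s (ratr r)) = [set y].
    by apply: H; rewrite le_min ys (ltW yr)/= gt_min rm orbT.
  exists r, y; split => //; split => //.
  by have [_ <-] := proper_unique y0 KE.
have [pK dE] := proper_unique y0 KE.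
split => //; last by rewrite dE.
have [Ky /=] : (K `&` disk (Num.min s (ratr r))) y by rewrite KE.
by rewrite (dist_unique KE) lee_fin /gauge_disk/= le_min => /andP[].
Qed.

Lemma dir_improper K : ~ proper_contact K -> dir_B B u0 K 0 = u0.
Proof. by rewrite /dir_B => H; case: asboolP. Qed.

Lemma measurable_direction : measurable_fun setT (direction : borelType R n -> borelType R n).
Proof.
apply: measurable_rVZ.
  rewrite (_ : (fun x => _) = (fun y : borelType R n => ga y `^ (- 1))).
    apply: (measurableT_comp (measurable_powR _)); exact: measurable_gauge.
  by apply/funext => y; rewrite powR_inv1.
by apply: measurable_rVN; exact: measurable_id.
Qed.

Lemma borel_cone C : borel C -> borel (cone C).
Proof.
move=> bC; have b0 : borel [set (0 : 'rV[R]_n)].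
  apply: closed_borel; exact/accessible_closed_set1/hausdorff_accessible/norm_hausdorff.
rewrite (_ : cone C = (direction @^-1` C) `\` [set 0]).
  by apply: borelD => //; exact: (preimage_borel measurable_direction bC).
by apply/seteqP; split => y /= [].
Qed.

Section events.
Context {d : measure_display} {O : measurableType d}.
Variable N : O -> set 'rV[R]_n.
Hypothesis NP : point_process N.

Let mcount A c : borel A -> measurable [set w | count_in A (N w) = c%:E :> \bar R].
Proof.
move=> bA; have [_ mN] := NP.
rewrite -[X in measurable X]setTI.
exact: (mN A bA measurableT [set c%:E] (emeasurable_set1 _)).
Qed.

(** A lone point of the disk that lies in the cone is recognised by two counts equal to 1, and
    counts are measurable. *)
Let singleton_event (q : R) C :
  [set w | exists y, N w `&` disk q = [set y] /\ cone C y] =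
  [set w | count_in (disk q) (N w) = 1%:E :> \bar R] `&`
  [set w | count_in (disk q `&` cone C) (N w) = 1%:E :> \bar R].
Proof.
have single A w : count_in A (N w) = 1%:E :> \bar R -> exists y, N w `&` A = [set y].
  move=> H.
  have [y Ay] : (N w `&` A) !=set0 by apply/(@counting_ge1 R); rewrite -[counting _]/(count_in A (N w)) H.
  exists y; apply: (@counting_eq1 R) => //; rewrite -[counting _]/(count_in A (N w)) H lte_fin ltr1n//.
apply/seteqP; split => w /=.
  move=> [y [KE Cy]]; rewrite /count_in KE counting_set1; split => //.
  rewrite setIA KE (_ : [set y] `&` _ = [set y]) ?counting_set1//.
  by apply/seteqP; split => z /=; [case|move=> ->].
move=> [/single[y yE] /single[z zE]].
exists y; split => //.
have [Nz [zq Cz]] : (N w `&` (disk q `&` cone C)) z by rewrite zE.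
have zy : [set y] z by rewrite -yE.
by rewrite /= in zy; rewrite -zy.
Qed.

Lemma measurable_proper_dir C s : borel C -> 0 <= s ->
  measurable [set w | [/\ (dist_B B 0 (N w) <= s%:E)%E, proper_contact (N w) &
                          C (dir_B B u0 (N w) 0)]].
Proof.
move=> bC s0; rewrite (_ : [set w | _] = \bigcup_(r in [set: rat])
    [set w | exists y, N w `&` disk (Num.min s (ratr r)) = [set y] /\ cone C y]); last first.
  apply/seteqP; split => w /=.
    by move/(proper_dirP C (NP.1 w) s0) => [r H]; exists r.
  by move=> [r _ H]; apply/(proper_dirP C (NP.1 w) s0); exists r.
apply: countable_bigcupT_measurable => [|r]; first exact: countableP.
rewrite singleton_event.
have bd : borel (disk (Num.min s (ratr r))) by exact: borel_gauge_disk.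
by apply: measurableI; apply: mcount => //; apply: borelI => //; exact: borel_cone.
Qed.

(** Configurations within distance s but without proper contact have direction [u0], so all or none
    of them belong to the event, according to whether [C] contains [u0]. *)
Lemma measurable_empty_space C s : borel C -> 0 <= s ->
  measurable [set w | (dist_B B 0 (N w) <= s%:E)%E /\ C (dir_B B u0 (N w) 0)].
Proof.
move=> bC s0; have bT : borel (setT : set 'rV[R]_n) by exact: (@measurableT _ (borelType R n)).
have mC := measurable_proper_dir bC s0; have mT := measurable_proper_dir bT s0.
have md : measurable [set w | (dist_B B 0 (N w) <= s%:E)%E].
  rewrite (_ : [set w | _] = ~` [set w | count_in (disk s) (N w) = 0%:E :> \bar R]).
    by apply: measurableC; apply: mcount; exact: borel_gauge_disk.
  apply/seteqP; split => w /=.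
    by move=> /(dist_le (NP.1 w) s0)/set0P/eqP H /(@counting_eq0 R).
  move=> H; apply/(dist_le (NP.1 w) s0)/set0P/negP => /eqP H0; apply: H.
  by rewrite /count_in H0 counting0.
pose U C := [set w | [/\ (dist_B B 0 (N w) <= s%:E)%E, proper_contact (N w) &
                          C (dir_B B u0 (N w) 0)]].
have [Cu|Cu] := pselect (C u0).
  rewrite (_ : [set w | _] = U C `|` ([set w | (dist_B B 0 (N w) <= s%:E)%E] `\` U setT)).
    by apply: measurableU => //; exact: measurableD.
  apply/seteqP; split => w /=.
    move=> [dw Cw]; have [pw|pw] := pselect (proper_contact (N w)); [left|right] => //.
    by split => // -[].
  move=> [[]//|[dw Uw]]; split => //; rewrite dir_improper// => pw; exact: Uw.
rewrite (_ : [set w | _] = U C)//; apply/seteqP; split => w /= [] // dw Cw.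
split => //; apply: contrapT => /dir_improper uw; apply: Cu; by rewrite -uw.
Qed.

(** If the inner disk is empty and the shell holds a single point, that point is the contact point
    and its membership in the cone decides the direction. Configurations with more points in the
    shell are absorbed by [T]. *)
Lemma new_contact_sub C t h : 0 <= t -> 0 < h ->
  let E s := [set w | (dist_B B 0 (N w) <= s%:E)%E /\ C (dir_B B u0 (N w) 0)] in
  let shell := disk (t + h) `\` disk t in
  let D := [set w | N w `&` disk t = set0 /\ (N w `&` (shell `&` cone C)) !=set0] in
  let T := [set w | (2%:R%:E <= count_in shell (N w) :> \bar R)%E] in
  (E (t + h) `\` E t `<=` D `|` T) /\ (D `<=` (E (t + h) `\` E t) `|` T).
Proof.
move=> t0 h0 E shell D T; have th0 : 0 <= t + h by rewrite addr_ge0// ltW.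
have lN w : locally_finite (N w) := NP.1 w.
have diskE w : N w `&` disk t = set0 -> N w `&` disk (t + h) = N w `&` shell.
  move=> H; apply/seteqP; split => y [Ny yth].
    split => //; split => // yt.
    by rewrite -[False]/(set0 y) -H.
  by split => //; case: yth.
have sing w y : (N w `&` shell) y -> ~ T w -> N w `&` shell = [set y].
  move=> Ny nT; apply: (@counting_eq1 R) => //; rewrite ltNge; exact/negP.
have yn0 y : shell y -> y <> 0.
  move=> [_ yt] y0; apply: yt; rewrite y0 /gauge_disk/= (gauge0 Bcompact Bconvex B0)//.
split => w.
  move=> [[dth Cw] nE]; have [Tw|nT] := pselect (T w); [by right|left].
  have Kt : N w `&` disk t = set0.
    apply: contrapT => /eqP/set0P Kt; apply: nE; split => //; exact/(dist_le (lN w) t0).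
  split => //.
  have [y] := (dist_le (lN w) th0).1 dth; rewrite (diskE _ Kt) => Ny.
  have yE := sing w y Ny nT; have y0 := yn0 y Ny.2.
  exists y; split; [exact: Ny.1|split; [exact: Ny.2|split => //]].
  rewrite -(diskE _ Kt) in yE; have [_ dE] := proper_unique y0 yE.
  by rewrite -dE.
move=> [Kt [y [Ny [ysh [y0 Cy]]]]].
have [Tw|nT] := pselect (T w); [by right|left].
have yE := sing w y (conj Ny ysh) nT.
rewrite -(diskE _ Kt) in yE.
have [_ dE] := proper_unique y0 yE.
split.
  split; last by rewrite dE.
  by rewrite (dist_unique yE) lee_fin; case: ysh.
by move=> [/(dist_le (lN w) t0)]; rewrite Kt => -[].
Qed.
End events.
End contact.

(** * The radial profile *)

Section radial_mass.
Context {R : realType} {n : nat}.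
Hypothesis n0 : (0 < n)%N.
Variable mu : {sigma_finite_measure set (borelType R n) -> \bar R}.
Hypothesis mu_shift : forall A x, borel A -> mu [set v | A (v + x)] = mu A.
Hypothesis mu_scale : forall A r, 0 < r -> borel A -> mu [set v | A (r^-1 *: v)] = ((r ^+ n)%:E * mu A)%E.
Hypothesis mu_box : forall k : R, (mu (centered_box k) < +oo)%E.
Variable B : set 'rV[R]_n.
Hypothesis Bcompact : compact B.
Hypothesis Bconvex : convex_set (B : set (convex_lmodType 'rV[R]_n)).
Hypothesis B0 : nbhs (0 : 'rV[R]_n) B.
Context {d1 : measure_display} {O1 : measurableType d1}.
Variables (P1 : probability O1 R) (V : probability (borelType R n) R) (eta : O1 -> nat)
  (Ltyp : O1 -> set 'rV[R]_n).
Hypothesis HL : neyman_scott_cluster P1 V eta Ltyp.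
Local Notation dG := (dpgf P1 eta).
Local Notation m1 := (size_mu P1 eta).
Local Notation ga := (gauge B).
Local Notation disk := (gauge_disk B).
Implicit Types (A C K : set 'rV[R]_n) (y z x : 'rV[R]_n).

Let ga0 y : 0 <= ga y. Proof. exact: gauge_ge0. Qed.
Let bdisk s : borel (disk s). Proof. exact: borel_gauge_disk. Qed.

Lemma ge0_integral_rV_scale (r : R) (f : borelType R n -> \bar R) : 0 < r ->
  measurable_fun setT f -> (forall x, 0 <= f x)%E ->
  (\int[mu]_x f x = (r ^+ n)%:E * \int[mu]_x f (r *: (x : 'rV[R]_n))%R)%E.
Proof.
move=> r0 mf f0.
have ms : measurable_fun setT (fun x : borelType R n => r *: (x : 'rV[R]_n) : borelType R n).
  by apply: measurable_rVZ => //; exact: measurable_id.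
rewrite -(ge0_integral_image_measure mu ms mf f0).
have rn0 : 0 <= r ^+ n by rewrite exprn_ge0// ltW.
rewrite -(ge0_integral_mscale _ _ (NngNum rn0))//.
apply: eq_measure_integral => A mA _.
transitivity ((r ^+ n)%:E * mu [set v | A (r *: v)])%E; last by [].
have ri0 : 0 < r^-1 by rewrite invr_gt0.
have H := mu_scale ri0 mA; rewrite invrK in H.
by rewrite H muleA -EFinM exprVn divff ?mul1e// expf_neq0// gt_eqF.
Qed.

Lemma mu_disk_fin s : (mu (disk s) < +oo)%E.
Proof.
have [k Hk] := gauge_disk_box Bcompact Bconvex B0 s.
by apply: le_lt_trans (mu_box k); apply: measure_le => //; [exact: bdisk|exact: measurable_centered_box].
Qed.

Lemma gauge_disk_scale r s : 0 < r -> disk (r * s) = [set v | disk s (r^-1 *: v)].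
Proof.
move=> r0; have ri0 : 0 <= r^-1 by rewrite invr_ge0 ltW.
by apply/seteqP; split => v; rewrite /gauge_disk/= (gaugeZ Bcompact Bconvex B0)// ler_pdivrMl.
Qed.

Definition disk_volume := fine (mu (disk 1)).

Lemma disk_volume_ge0 : 0 <= disk_volume.
Proof. by rewrite /disk_volume fine_ge0. Qed.

Lemma mu_disk s : 0 <= s -> mu (disk s) = (s ^+ n * disk_volume)%:E.
Proof.
move=> s0; have vE : disk_volume%:E = mu (disk 1).
  by rewrite /disk_volume fineK// ge0_fin_numE//; exact: mu_disk_fin.
have [->|sn0] := eqVneq s 0; last first.
  have sp : 0 < s by rewrite lt0r sn0.
  by rewrite -[s in disk s]mulr1 (gauge_disk_scale _ sp) mu_scale// -vE.
rewrite expr0n gtn_eqF// mul0r.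
(* [disk 0] is its own double, so its finite volume is unchanged by the factor 2 ^ n >= 2 and must
   vanish. *)
have H : mu (disk 0) = ((2 ^+ n)%:E * mu (disk 0))%E.
  rewrite -[LHS]/(mu (disk 0)) -{1}(mulr0 (2 : R)) gauge_disk_scale ?ltr0n//.
  by apply: mu_scale => //; exact: bdisk.
have fE : (fine (mu (disk 0)))%:E = mu (disk 0).
  by rewrite fineK// ge0_fin_numE//; exact: mu_disk_fin.
move: H; rewrite -fE -EFinM => -[H]; congr EFin; apply/eqP.
move/eqP: H; rewrite -subr_eq0 -{1}(mul1r (fine _)) -mulrBl mulf_eq0 => /orP[|//].
have : 2 <= 2 ^+ n :> R by rewrite -{1}(expr1 2) ler_weXn2l// ler1n.
by move=> h /eqP; lra.
Qed.

(* For a cluster that has a point at [p.1] with displacement [p.2] from its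
   centre, the mass of the displacements of points at least as close to the origin. *)
Definition near_mass (p : borelType R n * borelType R n) : R :=
  mass V [set l | ga (p.1 - p.2 + l) <= ga p.1].

Let mnear : measurable ([set q | ga (q.1.1 - q.1.2 + q.2) <= ga q.1.1] :
  set ((borelType R n * borelType R n) * borelType R n)).
Proof.
pose f (q : (borelType R n * borelType R n) * borelType R n) := ga (q.1.1 - q.1.2 + q.2) - ga q.1.1.
have mf : measurable_fun setT f.
  apply: measurable_funB.
    apply: (measurableT_comp (measurable_gauge Bcompact Bconvex B0)).
    apply: measurable_rVD => //; apply: measurable_rVD; first exact: measurableT_comp.
    by apply: measurable_rVN; exact: measurableT_comp.
  apply: (measurableT_comp (measurable_gauge Bcompact Bconvex B0)).
  exact: measurableT_comp.
rewrite (_ : [set q | _] = f @^-1` `]-oo, 0]%classic).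
  by rewrite -[X in measurable X]setTI; apply: mf.
by apply/seteqP; split => q; rewrite /f/= in_itv/= subr_le0.
Qed.

Lemma measurable_near_mass : measurable_fun setT near_mass.
Proof. exact: (measurable_translated_mass V mnear). Qed.

Let bnear p : borel [set l | ga (p.1 - p.2 + l) <= ga p.1].
Proof. exact: (borel_translate (p.1 - p.2) (bdisk (ga p.1))). Qed.

Lemma near_mass01 p : 0 <= near_mass p <= 1.
Proof. by apply: mass01; exact: bnear. Qed.

Let n01 p : 0 <= 1 - near_mass p <= 1. Proof. exact/compl01/near_mass01. Qed.

Let dGn0 p : 0 <= dG (1 - near_mass p). Proof. by apply: dpgf_ge0. Qed.

Let meta := ns_eta_measurable HL.
Let efin := ns_eta_fin HL.

Let dGn1 p : dG (1 - near_mass p) <= m1.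
Proof. by rewrite -subr_ge0; apply: (dpgf_le_size_mu HL). Qed.

Let m1_ge0 : 0 <= m1. Proof. exact: le_trans (dGn0 (0, 0)) (dGn1 _). Qed.

Let mdGn : measurable_fun setT (fun p => (dG (1 - near_mass p))%:E).
Proof.
apply/measurable_EFinP; apply: measurable_dpgf => //.
by apply: measurable_funB => //; exact: measurable_near_mass.
Qed.

(** Up to the factor [m1], the probability that a process point at y is strictly nearer to 0 than
    all other points of its cluster: [dG] divided by [m1] is the generating function of the number
    of companions in the size-biased cluster, and [y - z] is the centre. *)
Definition radial_density y : \bar R := (\int[V]_z (dG (1 - near_mass (y, z)))%:E)%E.

Definition radial_mass A : \bar R :=
  (\int[mu]_y ((\1_A y : R)%:E * radial_density y))%E.

Lemma radial_density_ge0 y : (0 <= radial_density y)%E.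
Proof. by apply: integral_ge0 => z _; rewrite lee_fin. Qed.

Lemma radial_density_le y : (radial_density y <= m1%:E)%E.
Proof.
apply: (@le_trans _ _ (\int[V]_z (cst m1%:E z))%E).
  by apply: ge0_le_integralT => z; rewrite lee_fin.
have H : (\int[V]_z (cst m1%:E z) = m1%:E * V setT)%E by exact: integral_cst.
by rewrite H probability_setT mule1.
Qed.

Lemma measurable_radial_density :
  measurable_fun setT (radial_density : borelType R n -> \bar R).
Proof.
have := @measurable_fun_fubini_tonelli_F _ _ _ _ _ V _ mdGn; apply => p.
by rewrite lee_fin.
Qed.

Let mrad A : borel A -> measurable_fun setT
  (fun y : borelType R n => ((\1_A y : R)%:E * radial_density y)%E).
Proof.
move=> bA; apply: emeasurable_funM; last exact: measurable_radial_density.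
by apply/measurable_EFinP; apply: measurable_indic; exact: bA.
Qed.

Lemma radial_mass_ge0 A : (0 <= radial_mass A)%E.
Proof. by apply: integral_ge0 => y _; rewrite mule_ge0 ?lee_fin// radial_density_ge0. Qed.

Lemma radial_mass_le A : borel A -> (radial_mass A <= m1%:E * mu A)%E.
Proof.
move=> bA; have := integral_indic mu measurableT bA; rewrite setIT => <-.
rewrite -ge0_integralZl//; last by apply/measurable_EFinP; apply: measurable_indic; exact: bA.
apply: ge0_le_integralT => y; first by rewrite mule_ge0 ?lee_fin// radial_density_ge0.
rewrite muleC; apply: lee_wpmul2r; [by rewrite lee_fin|exact: radial_density_le].
Qed.

Lemma radial_massU A A' : borel A -> borel A' -> A `&` A' = set0 ->
  radial_mass (A `|` A') = (radial_mass A + radial_mass A')%E.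
Proof.
move=> bA bA' AA'; rewrite /radial_mass -ge0_integralD//.
- apply: eq_integral => y _; rewrite -ge0_muleDl ?lee_fin//; congr (_ * _)%E.
  rewrite -EFinD; congr EFin; rewrite !indicE in_setU.
  have [/set_mem Ay|_] := boolP (y \in A); last by rewrite add0r.
  have [/set_mem A'y|_] := boolP (y \in A'); last by rewrite addr0.
  by exfalso; rewrite -[False]/(set0 y) -AA'.
- by move=> y _; rewrite mule_ge0 ?lee_fin// radial_density_ge0.
- exact: mrad.
- by move=> y _; rewrite mule_ge0 ?lee_fin// radial_density_ge0.
- exact: mrad.
Qed.

(* The disk through [r *: y] contains the translate by [(r - 1) *: y] of the disk
   through [y]. *)
Lemma radial_density_scale r y : 1 <= r -> (radial_density (r *: y) <= radial_density y)%E.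
Proof.
move=> r1; apply: ge0_le_integralT => z; first by rewrite lee_fin.
rewrite lee_fin; have /andP[a0 a1] := n01 (r *: y, z); have /andP[b0 b1] := n01 (y, z).
apply: dpgf_le => //; rewrite lerD2l lerN2; apply: le_mass; [exact: bnear|exact: bnear|].
move=> l /= H.
have -> : r *: y - z + l = (r - 1) *: y + (y - z + l).
  by apply/rowP => i; rewrite !mxE; ring.
apply: (le_trans (gaugeD Bcompact Bconvex B0 _ _)).
rewrite !(gaugeZ Bcompact Bconvex B0) ?subr_ge0//; last by rewrite (le_trans _ r1).
by move: H; lra.
Qed.

Lemma direction_scale r y : 0 < r -> direction B (r *: y) = direction B y.
Proof.
move=> r0; rewrite /direction (gaugeZ Bcompact Bconvex B0 _ (ltW r0)) -scalerN scalerA.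
by rewrite invfM mulrAC mulVf ?mul1r// gt_eqF.
Qed.

Lemma cone_scale C r y : 0 < r -> cone B C (r *: y) <-> cone B C y.
Proof.
move=> r0; rewrite /cone/= direction_scale//; split=> -[y0 Cy]; split => //.
  by move=> yE; apply: y0; rewrite yE scaler0.
by move/eqP; rewrite scaler_eq0 gt_eqF//= => /eqP.
Qed.

(** Substituting the dilation by r gives the factor r ^ n, and [radial_density] does not increase
    along rays. *)
Lemma radial_mass_scale A A' r : borel A -> borel A' -> 1 <= r ->
  (forall y, A (r *: y) <-> A' y) ->
  (radial_mass A <= (r ^+ n)%:E * radial_mass A')%E.
Proof.
move=> bA bA' r1 AA'; have r0 : 0 < r by rewrite (lt_le_trans _ r1).
rewrite /radial_mass (ge0_integral_rV_scale r0 (mrad bA)); last first.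
  by move=> y; rewrite mule_ge0 ?lee_fin// radial_density_ge0.
apply: lee_wpmul2l; first by rewrite lee_fin exprn_ge0// ltW.
apply: ge0_le_integralT => y; first by rewrite mule_ge0 ?lee_fin// radial_density_ge0.
rewrite (_ : \1_A (r *: y) = \1_A' y :> R).
  by apply: lee_wpmul2l; [rewrite lee_fin|exact: radial_density_scale].
by rewrite !indicE; congr (_ : bool)%:R; apply/idP/idP; rewrite !inE => /AA'.
Qed.

Definition radial_profile C s : R := fine (radial_mass (disk s `&` cone B C)).

Let bcone C : borel C -> borel (cone B C). Proof. exact: borel_cone. Qed.

Lemma radial_mass_fin A s : borel A -> A `<=` disk s -> radial_mass A \is a fin_num.
Proof.
move=> bA As; rewrite ge0_fin_numE ?radial_mass_ge0//.
apply: (le_lt_trans (radial_mass_le bA)); rewrite lte_mul_pinfty ?lee_fin//.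
apply: le_lt_trans (mu_disk_fin s); apply: measure_le => //; exact: bdisk.
Qed.

Let bsh C a b : borel C -> borel ((disk b `\` disk a) `&` cone B C).
Proof. by move=> bC; apply: borelI; [apply: borelD; exact: bdisk|exact: bcone]. Qed.

Lemma radial_profileB C a b : borel C -> a <= b ->
  (radial_profile C b - radial_profile C a)%:E = radial_mass ((disk b `\` disk a) `&` cone B C).
Proof.
move=> bC ab.
have bda s : borel (disk s `&` cone B C) by apply: borelI; [exact: bdisk|exact: bcone].
have fin s : radial_mass (disk s `&` cone B C) \is a fin_num by apply: (@radial_mass_fin _ s).
rewrite /radial_profile EFinB !fineK//.
have -> : disk b `&` cone B C = (disk a `&` cone B C) `|` ((disk b `\` disk a) `&` cone B C).
  apply/seteqP; split => y /=.
    move=> [yb Cy]; have [ya|ya] := pselect (disk a y); [by left|by right].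
  by move=> [[ya Cy]|[[yb _] Cy]]; split => //; exact: le_trans ya ab.
rewrite radial_massU//; first last.
- by apply/seteqP; split => // y [[ya _] [[_ nya] _]].
- exact: bsh.
by rewrite addeAC subee ?add0e.
Qed.

Lemma radial_profile0 C : borel C -> radial_profile C 0 = 0.
Proof.
move=> bC; rewrite /radial_profile (_ : disk 0 `&` _ = set0).
  by rewrite /radial_mass integral0_eq// => y _; rewrite indicE in_set0 mul0e.
apply/seteqP; split => // y [yd [y0 _]]; apply: y0; apply: (gauge_eq0 Bcompact Bconvex B0).
by apply/eqP; rewrite eq_le ga0 andbT.
Qed.

Lemma mu_shell a b : 0 <= a -> a <= b ->
  mu (disk b `\` disk a) = ((b ^+ n - a ^+ n) * disk_volume)%:E.
Proof.
move=> a0 ab; rewrite measureD; [|exact: bdisk|exact: bdisk|exact: mu_disk_fin].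
rewrite (_ : disk b `&` disk a = disk a); last first.
  by apply: setIidr => y; rewrite /gauge_disk/= => /le_trans; apply.
have b0 := le_trans a0 ab.
by rewrite mulrBl EFinB; congr (_ - _)%E; exact: mu_disk.
Qed.

Lemma radial_profile_mono C a b : borel C -> 0 <= a -> a <= b ->
  radial_profile C a <= radial_profile C b.
Proof.
by move=> bC a0 ab; rewrite -subr_ge0 -lee_fin radial_profileB// radial_mass_ge0.
Qed.

(** [radial_density] is at most [m1], so increments are bounded by [m1] times the shell volume. *)
Lemma radial_profile_lip C a b : borel C -> 0 <= a -> a <= b ->
  radial_profile C b - radial_profile C a <= m1 * disk_volume * (b ^+ n - a ^+ n).
Proof.
move=> bC a0 ab; rewrite -lee_fin radial_profileB//.
apply: (le_trans (radial_mass_le (bsh a b bC))).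
rewrite -mulrA EFinM (mulrC disk_volume); apply: lee_wpmul2l; first by rewrite lee_fin.
rewrite -mu_shell//; apply: measure_le; [exact: bsh|apply: borelD; exact: bdisk|exact: subIsetl].
Qed.

Lemma radial_profile_radial C r a b : borel C -> 1 <= r -> 0 <= a -> a <= b ->
  radial_profile C (r * b) - radial_profile C (r * a) <=
  r ^+ n * (radial_profile C b - radial_profile C a).
Proof.
move=> bC r1 a0 ab; have r0 : 0 < r by rewrite (lt_le_trans _ r1).
have r0' := ltW r0.
rewrite -lee_fin EFinM !radial_profileB// ?ler_wpM2l//.
apply: radial_mass_scale => //; [exact: bsh|exact: bsh|move=> y].
have dE s : disk (r * s) (r *: y) <-> disk s y.
  by rewrite /gauge_disk/= (gaugeZ Bcompact Bconvex B0)// ler_pM2l.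
have cE := cone_scale C y r0.
by split=> -[[yb ya] Cy]; (split; [split|]; [exact/dE|move/dE|exact/cE]).
Qed.

Lemma radial_profile_derivative C t : borel C -> 0 <= t ->
  exists l, (radial_profile C (t + h) - radial_profile C t) / h @[h --> 0^'+] --> (l : R).
Proof.
move=> bC t0; apply: (@radial_right_derivative R (radial_profile C) n (m1 * disk_volume)) => //.
- exact: radial_profile0.
- by move=> a b; exact: radial_profile_mono.
- by move=> a b; exact: radial_profile_lip.
- by move=> r a b; exact: radial_profile_radial.
Qed.

(* On the shell, [near_mass (x + z, z)] lies between the masses that the disks of
   radius [t] and [t + h] give to the cluster centred at [x]. *)
Lemma radial_mass_tangent A t s : borel A -> t <= s -> A `<=` disk s `\` disk t ->
  (tangent_mass mu P1 V eta (disk s) A <= radial_mass A <= tangent_mass mu P1 V eta (disk t) A)%E.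
Proof.
move=> bA ts As.
have := integral_tmassM mu_shift V bA mdGn.
move=> /(_ _) E; rewrite /radial_mass -[X in (_ <= X <= _)%E]E; last by move=> p; rewrite lee_fin.
have H x z : A (x + z) -> dG (1 - tmass V (disk s) x) <= dG (1 - near_mass (x + z, z))
    <= dG (1 - tmass V (disk t) x).
  move=> Axz; have [xs xt] := As _ Axz.
  have /andP[a0 a1] := compl01 (tmass01 V x (bdisk s)).
  have /andP[b0 b1] := compl01 (tmass01 V x (bdisk t)).
  have /andP[c0 c1] := n01 (x + z, z).
  have nE : [set l | ga (x + z - z + l) <= ga (x + z)] = [set l | disk (ga (x + z)) (x + l)].
    by rewrite addrK.
  apply/andP; split; apply: dpgf_le => //; rewrite lerD2l lerN2 /near_mass/= nE.
    apply: le_tmass => // y; rewrite /gauge_disk/= => /le_trans; exact.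
  apply: le_tmass => // y; rewrite /gauge_disk/= => /le_trans; apply.
  by rewrite leNgt; apply/negP => h; apply: xt; exact: ltW.
have pull x (c : R) : 0 <= c ->
    ((tmass V A x * c)%:E = \int[V]_z ((\1_A (x + z)%R : R)%:E * c%:E))%E.
  move=> c0; rewrite ge0_integralZr//; first by rewrite EFinM tmass_integral.
  by apply/measurable_EFinP; apply: measurable_indic; exact: borel_translate.
apply/andP; split; apply: ge0_le_integralT => x.
- by rewrite lee_fin mulr_ge0 ?tmass_ge0// dpgf_ge0// compl01// tmass01.
- rewrite pull; last by rewrite dpgf_ge0// compl01// tmass01.
  apply: ge0_le_integralT => z; first by rewrite mule_ge0 ?lee_fin// dpgf_ge0// compl01// tmass01.
  rewrite -!EFinM lee_fin indicE; have [/set_mem Axz|_] := boolP (x + z \in A); last by rewrite !mul0r.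
  by rewrite !mul1r; have /andP[] := H x z Axz.
- by apply: integral_ge0 => z _; rewrite mule_ge0 ?lee_fin.
rewrite pull; last by rewrite dpgf_ge0// compl01// tmass01.
apply: ge0_le_integralT => z; first by rewrite mule_ge0 ?lee_fin.
rewrite -!EFinM lee_fin indicE; have [/set_mem Axz|_] := boolP (x + z \in A); last by rewrite !mul0r.
by rewrite !mul1r; have /andP[] := H x z Axz.
Qed.

End radial_mass.

(** * The hazard as a derivative *)

Section hazard_limit.
Context {R : realType} {n : nat}.
Hypothesis n0 : (0 < n)%N.
Variable mu : {sigma_finite_measure set (borelType R n) -> \bar R}.
Hypothesis muE : forall A, borel A -> mu A = lebesgue_rV A.
Hypothesis mu_shift : forall A x, borel A -> mu [set v | A (v + x)] = mu A.
Hypothesis mu_scale : forall A r, 0 < r -> borel A -> mu [set v | A (r^-1 *: v)] = ((r ^+ n)%:E * mu A)%E.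
Hypothesis mu_box : forall k : R, (mu (centered_box k) < +oo)%E.
Variable B : set 'rV[R]_n.
Hypothesis Bcompact : compact B.
Hypothesis Bconvex : convex_set (B : set (convex_lmodType 'rV[R]_n)).
Hypothesis B0 : nbhs (0 : 'rV[R]_n) B.
Variable u0 : 'rV[R]_n.
Context {d d1 : measure_display} {O : measurableType d} {O1 : measurableType d1}.
Variables (P : probability O R) (P1 : probability O1 R) (lambda : R).
Variables (N : O -> set 'rV[R]_n) (Ltyp : O1 -> set 'rV[R]_n).
Variables (V : probability (borelType R n) R) (eta : O1 -> nat).
Hypothesis HN : poisson_cluster_process P P1 lambda N Ltyp.
Hypothesis HL : neyman_scott_cluster P1 V eta Ltyp.
Local Notation m1 := (size_mu P1 eta).
Local Notation ve := (void_exponent mu P1 V eta).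
Local Notation rho := (lambda * m1).
Local Notation disk := (gauge_disk B).
Local Notation j := (radial_profile mu B P1 V eta).
Local Notation vol := (disk_volume mu B).
Local Notation F t C := (empty_space P B u0 N t C).
Implicit Types (A C K : set 'rV[R]_n).

Let lambda0 : 0 < lambda. Proof. by case: HN. Qed.
Let NP : point_process N. Proof. by case: HN. Qed.
Let Hdiff : forall A, borel A -> lebesgue_rV A = 0%E -> difference_measure P1 Ltyp A = 0%E.
Proof. by case: HN => _ []. Qed.
Let m10 : 0 < m1. Proof. exact (size_mu_gt0 (ns_eta_fin HL) (ns_eta_gt0 HL)). Qed.
Let rho0 : 0 < rho. Proof. exact: mulr_gt0 lambda0 m10. Qed.
Let bdisk s : borel (disk s). Proof. exact: borel_gauge_disk. Qed.
Let vol0 : 0 <= vol. Proof. exact: disk_volume_ge0. Qed.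

Definition void_prob t : R := expR (- (lambda * ve (disk t))).

Lemma void_prob_gt0 t : 0 < void_prob t. Proof. exact: expR_gt0. Qed.

Lemma void_prob_le1 t : void_prob t <= 1.
Proof.
rewrite /void_prob -expR0 ler_expR oppr_le0 mulr_ge0// ?(ltW lambda0)//.
exact (void_exponent_ge0 mu HL (bdisk t)).
Qed.

Let mu_disk_lt t : (mu (disk t) < +oo)%E. Proof. exact: mu_disk_fin. Qed.

Lemma one_sub_empty_space t : 0 <= t -> 1 - F t setT = void_prob t.
Proof.
move=> t0; rewrite /empty_space.
have H := void_probability muE mu_shift mu_box HN HL (bdisk t) (mu_disk_lt t).
rewrite (_ : [set w | _] = ~` [set w | N w `&` disk t = set0]); last first.
  apply/seteqP; split => w /=.
    by move=> [/(dist_le Bcompact Bconvex B0 (NP.1 w) t0)/set0P/eqP].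
  by move=> /eqP/set0P Hw; split => //; exact/(dist_le Bcompact Bconvex B0 (NP.1 w) t0).
rewrite probability_setC; last exact (measurable_avoid HN (bdisk t)).
by rewrite H -EFinB/= subKr.
Qed.

Section increments.
Variable C : set 'rV[R]_n.
Hypothesis bC : borel C.
Local Notation E s := [set w | (dist_B B 0 (N w) <= s%:E)%E /\ C (dir_B B u0 (N w) 0)].
Local Notation shell t h := (disk (t + h) `\` disk t).
Local Notation sector t h := (shell t h `&` cone B C).

Let mE s : 0 <= s -> measurable (E s).
Proof. by move=> s0; apply: measurable_empty_space. Qed.

Lemma empty_spaceB t h : 0 <= t -> 0 < h ->
  (F (t + h) C - F t C)%:E = P (E (t + h) `\` E t).
Proof.
move=> t0 h0; have th0 : 0 <= t + h by rewrite addr_ge0// ltW.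
rewrite measureD; [|exact: mE|exact: mE|by rewrite (le_lt_trans (probability_le1 _ (mE th0))) ?ltry].
rewrite (_ : E (t + h) `&` E t = E t); last first.
  apply/seteqP; split => [w []//|w [dt Cw]]; split => //; split => //.
  by rewrite (le_trans dt)// lee_fin lerDl ltW.
by rewrite /empty_space EFinB !fineK ?fin_num_measure//; exact: mE.
Qed.

Let bshell t h : borel (shell t h). Proof. by apply: borelD; exact: bdisk. Qed.
Let bsector t h : borel (sector t h).
Proof. by apply: borelI => //; exact: borel_cone. Qed.

Let mu_sector_le t h : (mu (sector t h) <= mu (shell t h))%E.
Proof. by apply: measure_le; [exact: bsector|exact: bshell|exact: subIsetl]. Qed.

Let mu_shell_lt t h : (mu (shell t h) < +oo)%E.
Proof.
by apply: le_lt_trans (mu_disk_lt (t + h)); apply: measure_le; [exact: bshell|exact: bdisk|exact: subDsetl].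
Qed.

Let mu_sector_lt t h : (mu (sector t h) < +oo)%E.
Proof. exact: le_lt_trans (mu_sector_le t h) (mu_shell_lt t h). Qed.

Let disj t h : disk t `&` sector t h = set0.
Proof. by apply/seteqP; split => // y [yt [[_ nyt] _]]. Qed.

Local Notation inc t h := (fine (void_increment mu P1 V eta (disk t) (sector t h))).

Let incE t h : (inc t h)%:E = void_increment mu P1 V eta (disk t) (sector t h).
Proof.
rewrite fineK//.
have := void_exponentU mu_shift HL (bdisk t) (bsector t h) (disj t h) (mu_disk_lt t) (mu_sector_lt t h).
by case: (void_increment _ _ _ _ _ _).
Qed.

Let veU t h : ve (disk t `|` sector t h) = ve (disk t) + inc t h.
Proof.
have H := void_exponentU mu_shift HL (bdisk t) (bsector t h) (disj t h) (mu_disk_lt t) (mu_sector_lt t h).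
by rewrite -incE -EFinD in H; case: H.
Qed.

Let inc_le t h : ((inc t h)%:E <= m1%:E * mu (shell t h))%E.
Proof.
rewrite incE (le_trans (void_increment_le mu HL (bdisk t) (bsector t h) (disj t h)))//.
rewrite (le_trans (tangent_mass_le mu_shift HL (bdisk t) (bsector t h)))//.
by apply: lee_wpmul2l => //; rewrite lee_fin ltW.
Qed.

Let inc_ge0 t h : 0 <= inc t h.
Proof.
rewrite -lee_fin incE.
apply: (le_trans _ (void_increment_ge mu HL (bdisk t) (bsector t h) (bsector t h) (disj t h) (fun x => id))).
apply: integral_ge0 => x _; rewrite lee_fin mulr_ge0//.
  by apply: tmass_ge0; exact: bsector.
apply: dpgf_ge0; apply/compl01/tmass01.
by apply: borelU; [exact: bdisk|exact: bsector].
Qed.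

Local Notation D t h := [set w | N w `&` disk t = set0 /\ (N w `&` sector t h) !=set0].

(** The event is the difference of the void events of the disk and of its union with the sector,
    whose exponents differ by [lambda * inc t h]. *)
Let void_hit t h : P (D t h) = (void_prob t * (1 - expR (- (lambda * inc t h))))%:E.
Proof.
have bU : borel (disk t `|` sector t h) by apply: borelU; [exact: bdisk|exact: bsector].
have muU : (mu (disk t `|` sector t h) < +oo)%E.
  apply: le_lt_trans (measureU2 mu (bdisk t) (bsector t h)) _.
  by apply: lte_add_pinfty; [exact: mu_disk_lt|exact: mu_sector_lt].
have H1 := void_probability muE mu_shift mu_box HN HL (bdisk t) (mu_disk_lt t).
have H2 := void_probability muE mu_shift mu_box HN HL bU muU.
have mv := measurable_avoid HN (bdisk t). have mvU := measurable_avoid HN bU.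
rewrite (_ : D t h = [set w | N w `&` disk t = set0] `\`
                     [set w | N w `&` (disk t `|` sector t h) = set0]); last first.
  apply/seteqP; split => w /=.
    move=> [Nt [y [Ny ys]]]; split => // NU.
    by have : set0 y by rewrite -NU; split => //; right.
  move=> [Nt /eqP/set0P[y [Ny [yt|ys]]]]; last by split => //; exists y.
  by exfalso; rewrite -[False]/(set0 y) -Nt.
have -> : P ([set w | N w `&` disk t = set0] `\` [set w | N w `&` (disk t `|` sector t h) = set0]) =
   (P [set w | N w `&` disk t = set0] - P [set w | N w `&` (disk t `|` sector t h) = set0])%E.
  rewrite measureD//; last by rewrite (le_lt_trans (probability_le1 _ mv)) ?ltry.
  congr (_ - P _)%E; apply: setIidr => w /= NU.
  apply/seteqP; split => // y [Ny yt]; rewrite -NU; split => //; by left.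
rewrite H1 H2 -EFinB; congr EFin.
by rewrite veU mulrDr opprD expRD mulrBr mulr1.
Qed.

(** Three errors, each e / 3 times the shell volume: a second point in the shell, the change of
    slope in the void exponent, and the quadratic term of the exponential. The threshold is uniform
    in t and h. *)
Lemma increment_estimate e : 0 < e -> exists2 de, 0 < de & forall t h, 0 <= t -> 0 < h ->
  ((t + h) ^+ n - t ^+ n) * vol < de ->
  `|F (t + h) C - F t C - void_prob t * lambda * (j C (t + h) - j C t)| <=
    e * (((t + h) ^+ n - t ^+ n) * vol).
Proof.
move=> e0; pose e1 := e / 3.
have e10 : 0 < e1 by rewrite divr_gt0.
have [de1 de10 H1] := two_points_small muE mu_shift mu_box HN HL Hdiff e10.
have e20 : 0 < e1 / lambda by rewrite divr_gt0.
have [de2 de20 H2] := thinning_error_small muE mu_shift HL Hdiff e20.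
pose de3 := e1 / rho ^+ 2.
have de30 : 0 < de3 by rewrite divr_gt0// exprn_gt0.
exists (Num.min de1 (Num.min de2 de3)); first by rewrite !lt_min de10 de20.
move=> t h t0 h0; rewrite !lt_min => /and3P[m_de1 m_de2 m_de3].
have th : t <= t + h by rewrite lerDl ltW.
have muS : mu (shell t h) = (((t + h) ^+ n - t ^+ n) * vol)%:E.
  exact (mu_shell n0 mu_scale mu_box Bcompact Bconvex B0 t0 th).
set m := _ * vol in m_de1 m_de2 m_de3 muS *.
have m0 : 0 <= m by rewrite -lee_fin -muS.
pose T := [set w | (2%:R%:E <= count_in (shell t h) (N w) :> \bar R)%E].
have mT : measurable T.
  rewrite /T -[X in measurable X]setTI; apply: emeasurable_fun_c_infty => //.
  exact: NP.2 (bshell t h).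
have [k Hk] := gauge_disk_box Bcompact Bconvex B0 (t + h).
have PT : (P T <= (e1 * m)%:E)%E.
  have := H1 (shell t h) k (bshell t h).
  rewrite muS lte_fin -EFinM; apply => //.
  by move=> y [+ _]; exact: Hk.
have mD : measurable (D t h).
  rewrite (_ : D t h = [set w | N w `&` disk t = set0] `&` hit N (sector t h))//.
  apply: measurableI; first exact (measurable_avoid HN (bdisk t)).
  exact (measurable_hit HN (bsector t h)).
have th0 : 0 <= t + h by rewrite addr_ge0// ltW.
have mX : measurable (E (t + h) `\` E t) by apply: measurableD; exact: mE.
have [XD DX] := new_contact_sub Bcompact Bconvex B0 u0 NP C t0 h0.
have XD' : F (t + h) C - F t C <= void_prob t * (1 - expR (- (lambda * inc t h))) + e1 * m.
  rewrite -lee_fin [leRHS]EFinD -void_hit empty_spaceB//.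
  apply: (@le_trans _ _ (P (D t h `|` T))).
    by apply: measure_le => //; exact: measurableU.
  by rewrite (le_trans (measureU2 _ _ _))// leeD2l.
have DX' : void_prob t * (1 - expR (- (lambda * inc t h))) <= F (t + h) C - F t C + e1 * m.
  rewrite -lee_fin [leRHS]EFinD -void_hit empty_spaceB//.
  apply: (@le_trans _ _ (P ((E (t + h) `\` E t) `|` T))).
    by apply: measure_le => //; exact: measurableU.
  by rewrite (le_trans (measureU2 _ _ _))// leeD2l.
have Err : (thinning_error mu P1 V eta (shell t h) <= (e1 / lambda * m)%:E)%E.
  by have := H2 _ (bshell t h); rewrite muS lte_fin -EFinM; apply.
have KA' : disk t `&` shell t h = set0 by apply/seteqP; split => // y [yt [_ nyt]].
have KU : disk t `|` shell t h = disk (t + h).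
  by apply: setDUK => y yt; exact: le_trans yt th.
have T1 := tangent_mass_error mu HL (bdisk t) (bsector t h) (bshell t h) KA' (@subIsetl _ _ _).
have T2 := void_increment_ge mu HL (bdisk t) (bsector t h) (bshell t h) (disj t h) (@subIsetl _ _ _).
have T3 := void_increment_le mu HL (bdisk t) (bsector t h) (disj t h) : (_ <= tangent_mass mu _ _ _ _ _)%E.
have /andP[T4 T5] := radial_mass_tangent mu_shift Bcompact Bconvex B0 HL (bsector t h) th (@subIsetl _ _ _).
rewrite KU -incE in T1 T2 T3.
have jE := radial_profileB mu_box Bcompact Bconvex B0 HL bC th.
rewrite -jE in T4 T5.
(* The increments of the void exponent and of the profile lie between the same two tangent masses,
   at radii t + h and t, which differ by at most the thinning error of the shell. *)
have incj : inc t h <= j C (t + h) - j C t + e1 / lambda * m.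
  rewrite -lee_fin [leRHS]EFinD; apply: (le_trans T3); apply: (le_trans T1); exact: leeD.
have jinc : j C (t + h) - j C t <= inc t h + e1 / lambda * m.
  rewrite -lee_fin [leRHS]EFinD; apply: (le_trans T5); apply: (le_trans T1); exact: leeD.
set x := lambda * inc t h in XD' DX'.
have x0 : 0 <= x by rewrite mulr_ge0// ltW.
have xm : x <= rho * m.
  have := inc_le t h; rewrite muS -EFinM lee_fin => H.
  by rewrite /x -mulrA ler_wpM2l// ltW.
have x2 : x ^+ 2 <= e1 * m.
  apply: (@le_trans _ _ ((rho * m) ^+ 2)).
    by rewrite lerXn2r// nnegrE mulr_ge0// ltW.
  rewrite exprMn (expr2 m) mulrA ler_wpM2r//.
  by have := ltW m_de3; rewrite /de3 ler_pdivlMr ?exprn_gt0// (mulrC m).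
have xlo := expR_opp_upper x0.
have xhi : 1 - expR (- x) <= x by have := expR_ge1Dx (- x); lra.
set Dj := j C (t + h) - j C t in incj jinc *.
have hl : lambda * (e1 / lambda * m) = e1 * m by field; rewrite gt_eqF.
have xj : x <= lambda * Dj + e1 * m.
  by have := ler_wpM2l (ltW lambda0) incj; rewrite [leRHS]mulrDr hl.
have jx : lambda * Dj <= x + e1 * m.
  by have := ler_wpM2l (ltW lambda0) jinc; rewrite [leRHS]mulrDr hl.
have a0 := void_prob_gt0 t; have a1 := void_prob_le1 t.
have em0 : 0 <= e1 * m by rewrite mulr_ge0// ltW.
have aem : void_prob t * (2 * (e1 * m)) <= 2 * (e1 * m) by rewrite ler_piMl// mulr_ge0.
have low : void_prob t * (lambda * Dj - 2 * (e1 * m)) <= void_prob t * (1 - expR (- x)).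
  by rewrite ler_wpM2l ?(ltW a0)//; lra.
have upp : void_prob t * (1 - expR (- x)) <= void_prob t * (lambda * Dj + 2 * (e1 * m)).
  by rewrite ler_wpM2l ?(ltW a0)//; lra.
have eE : e * m = 3 * (e1 * m) by rewrite /e1; field.
rewrite eE -[void_prob t * lambda * Dj]mulrA.
move: low upp; rewrite mulrBr mulrDr => low upp.
by rewrite ler_norml; apply/andP; split; lra.
Qed.

Lemma hazard_derivative t : 0 <= t -> exists l : R,
  (j C (t + h) - j C t) / h @[h --> 0^'+] --> l /\ hazard P B u0 N t C = lambda * l.
Proof.
move=> t0.
have [l Hl] := radial_profile_derivative n0 mu_scale mu_box Bcompact Bconvex B0 HL bC t0.
exists l; split => //; rewrite /hazard one_sub_empty_space//.
have a0 := void_prob_gt0 t.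
(* The factor [void_prob t] of the density cancels against the denominator of the hazard. *)
suff H : (F (t + h) C - F t C) / h @[h --> 0^'+] --> void_prob t * lambda * l.
  rewrite /empty_space_density (cvg_lim _ H)//.
  by field; rewrite gt_eqF.
(* Bounds the shell volume per unit of h for h <= 1. Only its nonnegativity is at hand, hence the
   denominators [M + 1]. *)
pose M := (n%:R * (t + 1) ^+ n.-1) * vol.
have M0 : 0 <= M by rewrite !mulr_ge0// exprn_ge0// addr_ge0.
have al0 : 0 < void_prob t * lambda by rewrite mulr_gt0.
apply/cvgrPdist_le => e e0.
have e10 : 0 < e / 2 / (M + 1) by rewrite !divr_gt0// ltr_wpDl.
have [de de0 Hde] := increment_estimate e10.
have e20 : 0 < e / 2 / (void_prob t * lambda) by rewrite !divr_gt0.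
have /cvgrPdist_le/(_ _ e20) Hj := Hl.
near=> h.
have h0 : 0 < h by near: h; exact: nbhs_right_gt.
have h1 : h <= 1 by near: h; exact: nbhs_right_le.
have hde : h < de / (M + 1) by near: h; apply: nbhs_right_lt; rewrite divr_gt0// ltr_wpDl.
have mM : ((t + h) ^+ n - t ^+ n) * vol <= M * h.
  rewrite /M mulrAC ler_wpM2r//.
  have th : t <= t + h by rewrite lerDl ltW.
  have /andP[_ H] := pow_diff_bounds n t0 th.
  apply: (le_trans H); rewrite addrC addKr mulrC ler_wpM2r ?(ltW h0)// ler_wpM2l//.
  have th0 : 0 <= t + h by rewrite addr_ge0// ltW.
  by apply: lerXn2r; rewrite ?nnegrE ?addr_ge0// lerD2l.
have Mh : M * h < de.
  apply: (@le_lt_trans _ _ ((M + 1) * h)); first by rewrite ler_wpM2r ?(ltW h0)// lerDl.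
  by rewrite mulrC -ltr_pdivlMr// ltr_wpDl.
have K1 := Hde t h t0 h0 (le_lt_trans mM Mh).
have K2 : `|l - (j C (t + h) - j C t) / h| <= e / 2 / (void_prob t * lambda) by near: h; exact: Hj.
set Df := F (t + h) C - F t C in K1 *; set Dj := j C (t + h) - j C t in K1 K2 *.
have K1' : `|Df / h - void_prob t * lambda * (Dj / h)| <= e / 2.
  have -> : Df / h - void_prob t * lambda * (Dj / h) = (Df - void_prob t * lambda * Dj) / h.
    by field; rewrite gt_eqF.
  rewrite normrM normfV (gtr0_norm h0) ler_pdivrMr//.
  apply: (le_trans K1); apply: (@le_trans _ _ (e / 2 / (M + 1) * (M * h))).
    by rewrite ler_wpM2l ?(ltW e10).
  rewrite mulrA ler_wpM2r ?(ltW h0)// -mulrA ler_piMr//; first by rewrite divr_ge0// ltW.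
  by rewrite mulrC ler_pdivrMr ?ltr_wpDl// mul1r lerDl.
have K2' : `|void_prob t * lambda * l - void_prob t * lambda * (Dj / h)| <= e / 2.
  rewrite -mulrBr normrM (gtr0_norm al0).
  by rewrite mulrC -ler_pdivlMr.
rewrite (_ : _ - _ = (void_prob t * lambda * l - void_prob t * lambda * (Dj / h)) -
   (Df / h - void_prob t * lambda * (Dj / h))); last by ring.
by rewrite (le_trans (ler_normB _ _))// (splitr e) lerD.
Unshelve. all: by end_near. Qed.
End increments.
End hazard_limit.

(** * Volume of the unit cube *)

Section unit_cube_volume.
Context {R : realType}.

Lemma unit_cube_box n : (unit_cube : set 'rV[R]_n) `<=` centered_box 1.
Proof. by move=> v v01 i; have /andP[a b] := v01 i; rewrite ger0_norm. Qed.

Lemma borel_unit_cube n : borel (unit_cube : set 'rV[R]_n).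
Proof.
have H : measurable (\bigcap_(i in [set: 'I_n])
  ((fun u : borelType R n => (u : 'rV[R]_n) ord0 i) @^-1` `[0, 1]%classic)).
  apply: fin_bigcap_measurable => // i _.
  rewrite -[X in measurable X]setTI.
  exact: (measurable_coord i measurableT (@measurable_itv R `[0, 1])).
rewrite [X in borel X](_ : _ = \bigcap_(i in [set: 'I_n])
  ((fun u : borelType R n => (u : 'rV[R]_n) ord0 i) @^-1` `[0, 1]%classic)); first exact: H.
apply/seteqP; split => u /= h i; first by move=> _; rewrite /= in_itv/=; exact: h.
by have := h i Logic.I; rewrite /= in_itv.
Qed.

(** Slices at x in [0, 1] are unit cubes of one dimension less; all others are empty. *)
Lemma lebesgue_rV_unit_cube n : lebesgue_rV (unit_cube : set 'rV[R]_n) = 1%E.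
Proof.
elim: n => [|n IHn].
  by rewrite /= indicE mem_set// => -[].
have [mu [muE _ _ _]] := @lebesgue_rV_measure R n.
rewrite /=; transitivity (\int[@lebesgue_measure R]_x ((\1_(`[0, 1]%classic) x : R)%:E))%E.
  apply: eq_integral => x _; rewrite indicE.
  have [/set_mem/=|/negP] := boolP (x \in `[0, 1]%classic); rewrite ?in_itv/= => x01.
    rewrite (_ : [set v | _] = unit_cube)//; apply/seteqP; split => v /= h i.
      by have := h (@rshift 1 n i); rewrite (@row_mxEr _ 1 1 n).
    rewrite -(@splitK 1 n i); case: (@fintype.split 1 n i) => k /=.
      by rewrite (@row_mxEl _ 1 1 n) mxE.
    by rewrite (@row_mxEr _ 1 1 n).
  rewrite (_ : [set v | _] = set0); first by rewrite -muE ?measure0//; exact: borel0.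
  apply/seteqP; split => // v /= h; apply: x01.
  have := h (@lshift 1 n ord0).
  by rewrite (@row_mxEl _ 1 1 n) mxE => ?; apply/mem_set; rewrite /= in_itv.
transitivity (@lebesgue_measure R `[0, 1]%classic).
  by rewrite integral_indic// setIT.
by rewrite lebesgue_measure_itv/= lte_fin ltr01 -EFinD subr0.
Qed.
End unit_cube_volume.

(** * Comparison of two cluster size laws *)

Section comparison.
Context {R : realType} {n : nat}.
Variable mu : {sigma_finite_measure set (borelType R n) -> \bar R}.
Variable B : set 'rV[R]_n.
Hypothesis Bcompact : compact B.
Hypothesis Bconvex : convex_set (B : set (convex_lmodType 'rV[R]_n)).
Hypothesis B0 : nbhs (0 : 'rV[R]_n) B.
Context {e1 e2 : measure_display} {T1 : measurableType e1} {T2 : measurableType e2}.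
Variables (Q1 : probability T1 R) (Q2 : probability T2 R).
Variables (V : probability (borelType R n) R) (eta1 : T1 -> nat) (eta2 : T2 -> nat)
  (L1 : T1 -> set 'rV[R]_n) (L2 : T2 -> set 'rV[R]_n).
Hypothesis HL1 : neyman_scott_cluster Q1 V eta1 L1.
Hypothesis HL2 : neyman_scott_cluster Q2 V eta2 L2.
Variables (c1 c2 : R).
Hypothesis c10 : 0 <= c1.
Hypothesis c20 : 0 <= c2.
Hypothesis dpgf_c : forall s, 0 <= s <= 1 -> c2 * dpgf Q2 eta2 s <= c1 * dpgf Q1 eta1 s.

Let ZrE e (T : measurableType e) (Q : probability T R) (eta : T -> nat) L c A :
  neyman_scott_cluster Q V eta L -> 0 <= c -> borel A ->
  (c%:E * radial_mass mu B Q V eta A =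
   \int[mu]_y ((\1_A y : R)%:E * \int[V]_z (c * dpgf Q eta (1 - near_mass B V (y, z)))%:E))%E.
Proof.
move=> HL c0 bA.
have n01 p := compl01 (near_mass01 Bcompact Bconvex B0 V p).
have mn := measurable_near_mass Bcompact Bconvex B0 V.
have md : measurable_fun setT (fun p => (dpgf Q eta (1 - near_mass B V p))%:E).
  apply/measurable_EFinP; apply: measurable_dpgf.
  - exact: (ns_eta_measurable HL).
  - exact: (ns_eta_fin HL).
  - exact: measurable_funB.
  - exact: n01.
have d0 p : 0 <= dpgf Q eta (1 - near_mass B V p) by exact: dpgf_ge0.
have mr := measurable_radial_density Bcompact Bconvex B0 HL.
rewrite /radial_mass -ge0_integralZl//; last 2 first.
- apply: emeasurable_funM; last exact: mr.
  by apply/measurable_EFinP; apply: measurable_indic; exact: bA.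
- move=> y _; rewrite mule_ge0 ?lee_fin//; apply: integral_ge0 => z _; by rewrite lee_fin.
apply: eq_integral => y _; rewrite muleCA; congr (_ * _)%E.
rewrite /radial_density -ge0_integralZl//.
  by apply: (measurableT_comp md); exact: measurable_fun_pair.
by move=> z _; rewrite lee_fin.
Qed.

(** [near_mass] depends on [B] and [V] only, so both masses integrate their weighted [dpgf] at the
    same arguments and against the same measures. *)
Lemma radial_mass_compare A : borel A ->
  (c2%:E * radial_mass mu B Q2 V eta2 A <= c1%:E * radial_mass mu B Q1 V eta1 A)%E.
Proof.
move=> bA; rewrite (ZrE HL1 c10 bA) (ZrE HL2 c20 bA).
have n01 p := compl01 (near_mass01 Bcompact Bconvex B0 V p).
have d0 p : 0 <= dpgf Q2 eta2 (1 - near_mass B V p) by exact: dpgf_ge0.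
have i0 y : (0 <= \int[V]_z (c2 * dpgf Q2 eta2 (1 - near_mass B V (y, z)))%:E)%E.
  by apply: integral_ge0 => z _; rewrite lee_fin mulr_ge0.
apply: ge0_le_integralT => y.
  by apply: mule_ge0; [rewrite lee_fin|exact: i0].
apply: lee_wpmul2l; first by rewrite lee_fin.
apply: ge0_le_integralT => z; first by rewrite lee_fin mulr_ge0.
by rewrite lee_fin; exact: dpgf_c.
Qed.
Hypothesis mu_box : forall k : R, (mu (centered_box k) < +oo)%E.

Lemma radial_profile_compare (C : set 'rV[R]_n) (a b : R) : borel C -> a <= b ->
  c2 * (radial_profile mu B Q2 V eta2 C b - radial_profile mu B Q2 V eta2 C a) <=
  c1 * (radial_profile mu B Q1 V eta1 C b - radial_profile mu B Q1 V eta1 C a).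
Proof.
move=> bC ab.
have bS : borel ((gauge_disk B b `\` gauge_disk B a) `&` cone B C).
  by apply: borelI; [apply: borelD; exact: borel_gauge_disk|exact: borel_cone].
have H := radial_mass_compare bS.
rewrite -(radial_profileB mu_box Bcompact Bconvex B0 HL1 bC ab) in H.
rewrite -(radial_profileB mu_box Bcompact Bconvex B0 HL2 bC ab) in H.
by rewrite -!EFinM lee_fin in H.
Qed.
End comparison.

Theorem proposition3p7 (R : realType) (n : nat) (hn : (0 < n)%N)
  (B : set 'rV[R]_n) (hBcompact : compact B)
  (hBconvex : convex_set (B : set (convex_lmodType 'rV[R]_n)))
  (hB0 : nbhs (0 : 'rV[R]_n) B)
  (u0 : 'rV[R]_n) (hu0 : topological_boundary (reflect_set B) u0)
  (V : probability (borelType R n) R)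
  (d1 d2 e1 e2 : measure_display)
  (O1 : measurableType d1) (P1 : probability O1 R)
  (O2 : measurableType d2) (P2 : probability O2 R)
  (T1 : measurableType e1) (Q1 : probability T1 R) (eta1 : T1 -> nat)
  (T2 : measurableType e2) (Q2 : probability T2 R) (eta2 : T2 -> nat)
  (N1 : O1 -> set 'rV[R]_n) (N2 : O2 -> set 'rV[R]_n)
  (hN1 : neyman_scott_process P1 Q1 V eta1 N1)
  (hN2 : neyman_scott_process P2 Q2 V eta2 N2)
  (hintensity : intensity P1 N1 = intensity P2 N2)
  (horder : lg_order Q1 eta1 Q2 eta2) :
  forall (t : R) (C : set 'rV[R]_n), 0 <= t -> borel C ->
    hazard P2 B u0 N2 t C <= hazard P1 B u0 N1 t C.
Proof.
have [mu [muE mu_shift mu_scale mu_box]] := @lebesgue_rV_measure R n.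
have [l1 [L1 [HL1 HN1]]] := hN1.
have [l2 [L2 [HL2 HN2]]] := hN2.
have l10 : 0 < l1 by case: HN1.
have l20 : 0 < l2 by case: HN2.
have Hd1 A : borel A -> lebesgue_rV A = 0%E -> difference_measure Q1 L1 A = 0%E.
  by case: HN1 => _ [_ _ H] _ _; exact: H.
have Hd2 A : borel A -> lebesgue_rV A = 0%E -> difference_measure Q2 L2 A = 0%E.
  by case: HN2 => _ [_ _ H] _ _; exact: H.
have bU : borel (unit_cube : set 'rV[R]_n) by exact: borel_unit_cube.
have muU : mu unit_cube = 1%E by rewrite muE// lebesgue_rV_unit_cube.
have m10 : 0 < size_mu Q1 eta1 by exact (size_mu_gt0 (ns_eta_fin HL1) (ns_eta_gt0 HL1)).
have m20 : 0 < size_mu Q2 eta2 by exact (size_mu_gt0 (ns_eta_fin HL2) (ns_eta_gt0 HL2)).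
(* Both bounds on the mean count, applied to the unit cube, identify each intensity with lambda
   times the mean cluster size. *)
have rho12 : l1 * size_mu Q1 eta1 = l2 * size_mu Q2 eta2.
  have I1 := mean_count_le muE mu_shift mu_box HN1 HL1 bU (@unit_cube_box R n).
  have J1 := mean_count_ge hn muE mu_shift mu_scale mu_box HN1 HL1 Hd1 bU (@unit_cube_box R n).
  have I2 := mean_count_le muE mu_shift mu_box HN2 HL2 bU (@unit_cube_box R n).
  have J2 := mean_count_ge hn muE mu_shift mu_scale mu_box HN2 HL2 Hd2 bU (@unit_cube_box R n).
  rewrite !(muU, mule1) in I1 J1 I2 J2.
  apply: EFin_inj; apply/eqP; rewrite eq_le; apply/andP; split.
    by apply: (le_trans J1); rewrite -[leLHS]/(intensity P1 N1) hintensity.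
  by apply: (le_trans J2); rewrite -[leLHS]/(intensity P2 N2) -hintensity.
have dpgfE e (T : measurableType e) (Q : probability T R) eta s : 0 < size_mu Q eta ->
    dpgf Q eta s = size_mu Q eta * size_biased_gf Q eta s.
  by move=> m0; rewrite size_biased_gfE mulrA divff ?mul1r// gt_eqF.
have Hc s : 0 <= s <= 1 -> l2 * dpgf Q2 eta2 s <= l1 * dpgf Q1 eta1 s.
  move=> s01; rewrite (dpgfE _ _ _ _ _ m10) (dpgfE _ _ _ _ _ m20) (mulrA l1) (mulrA l2) -rho12.
  by apply: ler_wpM2l; [rewrite mulr_ge0// ltW|exact: horder].
move=> t C t0 bC.
have [k1 [H1 ->]] := hazard_derivative hn muE mu_shift mu_scale mu_box hBcompact hBconvex hB0 u0 HN1 HL1 bC t0.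
have [k2 [H2 ->]] := hazard_derivative hn muE mu_shift mu_scale mu_box hBcompact hBconvex hB0 u0 HN2 HL2 bC t0.
have K h : 0 < h -> l2 * ((radial_profile mu B Q2 V eta2 C (t + h) -
    radial_profile mu B Q2 V eta2 C t) / h) <= l1 * ((radial_profile mu B Q1 V eta1 C (t + h) -
    radial_profile mu B Q1 V eta1 C t) / h).
  move=> h0; rewrite (mulrA l2) (mulrA l1); apply: ler_wpM2r.
    by rewrite invr_ge0 ltW.
  have th : t <= t + h by rewrite lerDl ltW.
  exact (radial_profile_compare hBcompact hBconvex hB0 HL1 HL2 (ltW l10) (ltW l20) Hc mu_box bC th).
(* The weighted difference quotients are ordered for every h > 0, and the two hazards are their
   limits. *)
apply: (ler_cvg_to (cvgM (cvg_cst l2) H2) (cvgM (cvg_cst l1) H1)).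
by near=> h; apply: K; near: h; exact: nbhs_right_gt.
Unshelve. all: by end_near. Qed.
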